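(* Let $(M,h)$ be a closed Riemannian spin manifold, let $\kappa\in\mathbb{R}$, and let $(\phi,\psi)$ be a weak $\kappa$-Dirac-harmonic map from $M$ to the round sphere $S^n\subset\mathbb{R}^{n+1}$. Then for all $i,m\in\{1,\dots,n+1\}$ and all $\eta\in C^\infty(M)$, $$\int_M\big(\operatorname{Re}\langle e_\alpha\cdot\psi^i,\psi^m\rangle_{\Sigma M}+(\phi^i_\alpha\phi^m-\phi^i\phi^m_\alpha)\big)(\nabla_{e_\alpha}\eta)\, dM=0,$$ where the sum over $\alpha=1,\dots,\dim M$ is understood.
   Context: $\Sigma M$ is the spinor bundle of $(M,h)$ with hermitian scalar product $\langle\cdot,\cdot\rangle_{\Sigma M}$ (taken conjugate-linear in the first and linear in the second slot) and metric spin connection $\nabla^{\Sigma M}$. Clifford multiplication by tangent vectors is skew-symmetric, $\langle\psi,X\cdot\eta\rangle=-\langle X\cdot\psi,\eta\rangle$, and satisfies $X\cdot Y\cdot\psi+Y\cdot X\cdot\psi=-2h(X,Y)\psi$. $(e_\alpha)$ is a local orthonormal frame of $TM$, $\not\partial=e_\alpha\cdot\nabla^{\Sigma M}_{e_\alpha}$ is the Dirac operator on $\Sigma M$, repeated indices are summed, and $\phi^j_\alpha:=d\phi^j(e_\alpha)$. $\Delta$ is the Laplace-Beltrami operator $\operatorname{div}\nabla$ on functions. A map to $S^n$ is written $\phi=(\phi^1,\dots,\phi^{n+1})$ with $|\phi|=1$, and a vector spinor along $\phi$ (a section of $\Sigma M\otimes\phi^\ast TS^n$) is written $\psi=(\psi^1,\dots,\psi^{n+1})$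 with each $\psi^i$ a section of $\Sigma M$ and $\sum_i\phi^i\psi^i=0$; $|\psi|^2=\sum_i|\psi^i|^2$. A weak $\kappa$-Dirac-harmonic map from $M$ to $S^n$ is a pair $(\phi,\psi)\in W^{1,2}(M,S^n)\times W^{1,4/3}(M,\Sigma M\otimes\phi^\ast TS^n)$ solving, for $i=1,\dots,n+1$, almost everywhere and in the distributional sense, $$-\Delta\phi^i=|d\phi|^2\phi^i+\operatorname{Re}\langle\psi^i,e_\alpha\cdot\psi^j\rangle_{\Sigma M}\phi^j_\alpha,$$ $$\not\partial\psi^i=-\phi^j_\alpha\,\phi^i\, e_\alpha\cdot\psi^j-2\kappa\big(|\psi|^2\psi^i-\langle\psi^j,\psi^i\rangle_{\Sigma M}\psi^j\big).$$
   Formalization: In dimension of M at least 3 the spinor ψ is additionally assumed to lie in L^4 (automatic in dimensions 1 and 2); without this the claim fails, e.g. on the round S^3 with φ(r,w)=w and ψ=χ/sin r, χ a harmonic twisted spinor on S^2. *)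

(* Defs.v *)
From HB Require Import structures.
From mathcomp Require Import all_boot all_order all_algebra.
From mathcomp Require Import complex.
From mathcomp Require Import all_classical all_reals all_analysis.

Set Implicit Arguments.
Unset Strict Implicit.
Unset Printing Implicit Defensive.

Import Order.TTheory GRing.Theory Num.Theory.
Import numFieldNormedType.Exports.

Local Open Scope classical_set_scope.
Local Open Scope ring_scope.

(* T with its Borel sigma-algebra *)
Definition borel (T : ptopologicalType) := g_sigma_algebraType (@open T).
HB.instance Definition _ (T : ptopologicalType) := Measurable.on (borel T).

Section Euclidean.
Context {R : realType} {m : nat}.

Definition pd (k : 'I_m) (f : 'rV[R]_m -> R) (x : 'rV[R]_m) : R :=
  'D_(delta_mx 0 k) f x.

(* C^r on the open set V *)
Fixpoint Ck (r : nat) (V : set 'rV[R]_m) (f : 'rV[R]_m -> R) : Prop :=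
  if r is r'.+1 then
    (forall x, V x -> differentiable f x) /\ (forall k, Ck r' V (pd k f))
  else forall x, V x -> {for x, continuous f}.

Definition smooth (V : set 'rV[R]_m) (f : 'rV[R]_m -> R) : Prop :=
  forall r, Ck r V f.

Definition test_function (V : set 'rV[R]_m) (z : 'rV[R]_m -> R) : Prop :=
  smooth setT z /\
  exists K, [/\ compact K, K `<=` V & forall x, ~ K x -> z x = 0].

(* The library has no Lebesgue measure on R^m; it is the unique Borel measure
   with the following values on boxes. *)
Definition is_lebesgue (leb : {measure set (borel 'rV[R]_m) -> \bar R}) : Prop :=
  forall a b : 'rV[R]_m, (forall k, a 0 k <= b 0 k) ->
    leb [set x : 'rV[R]_m | forall k, a 0 k <= x 0 k < b 0 k] =
    (\prod_k (b 0 k - a 0 k))%:E.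

End Euclidean.

(* A closed (compact, boundaryless, not necessarily connected) smooth
   m-manifold, given by a smooth atlas.
   [chart_at p] is an arbitrary chart around
   p; covariant quantities are evaluated there, with a result that does not
   depend on the choice. *)
Record closed_manifold (R : realType) (m : nat) := ClosedManifold {
  carrier :> ptopologicalType;
  chart_index : Type;
  dom : chart_index -> set carrier;
  chart : chart_index -> carrier -> 'rV[R]_m;
  chart_inv : chart_index -> 'rV[R]_m -> carrier;
  chart_at : carrier -> chart_index;
  manifold_compact : compact [set: carrier];
  manifold_hausdorff : hausdorff_space carrier;
  dom_open : forall i, open (dom i);
  dom_chart_at : forall p, dom (chart_at p) p;
  img_open : forall i, open (chart i @` dom i);
  chartK : forall i p, dom i p -> chart_inv i (chart i p) = p;
  chart_continuous : forall i p, dom i p -> {for p, continuous (chart i)};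
  chart_inv_continuous : forall i x, (chart i @` dom i) x ->
    {for x, continuous (chart_inv i)};
  transition_smooth : forall i j k,
    smooth (chart i @` (dom i `&` dom j))
           (fun x => chart j (chart_inv i x) 0 k)
}.

Section Manifold.
Context {R : realType} {m : nat} (X : closed_manifold R m).

Definition img (i : chart_index X) : set 'rV[R]_m := chart i @` dom i.

Definition smooth_on (i : chart_index X) (U : set X) (f : X -> R) : Prop :=
  smooth (chart i @` (dom i `&` U)) (f \o chart_inv i).

Definition smooth_fun (f : X -> R) : Prop := forall i, smooth_on i setT f.

Definition dchart (i : chart_index X) (k : 'I_m) (f : X -> R) (p : X) : R :=
  pd k (f \o chart_inv i) (chart i p).

(* Jacobian of the transition map from chart i to chart j: entry (k, l) is
   the derivative of the l-th coordinate of j along the k-th coordinate of i. *)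
Definition jac (i j : chart_index X) (p : X) : 'M[R]_m :=
  'J (chart j \o chart_inv i) (chart i p).

(* A covector field, by its coordinate components in each chart. *)
Definition is_covector_field (w : chart_index X -> X -> 'cV[R]_m) : Prop :=
  forall i j p, dom i p -> dom j p -> w i p = jac i j p *m w j p.

End Manifold.

Record riemannian_metric (R : realType) (m : nat) (X : closed_manifold R m) :=
  RiemannianMetric {
  gmat :> chart_index X -> X -> 'M[R]_m;
  gmat_sym : forall i p, dom i p -> (gmat i p)^T = gmat i p;
  gmat_pos : forall i p (v : 'rV[R]_m), dom i p -> v != 0 ->
    0 < (v *m gmat i p *m v^T) 0 0;
  gmat_smooth : forall i a b, smooth_on i setT (fun p => gmat i p a b);
  gmat_covariant : forall i j p, dom i p -> dom j p ->
    gmat i p = jac i j p *m gmat j p *m (jac i j p)^T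
}.

Section Metric.
Context {R : realType} {m : nat} {X : closed_manifold R m}.
Variable h : riemannian_metric X.

(* Entry (q, l) is the Christoffel symbol Gamma^l_{kq}. *)
Definition christoffel (i : chart_index X) (p : X) (k : 'I_m) : 'M[R]_m :=
  (\matrix_(q, r) (2^-1 * (dchart i k (fun x => h i x q r) p
                           + dchart i q (fun x => h i x k r) p
                           - dchart i r (fun x => h i x k q) p)))
  *m invmx (h i p).

Definition is_volume (leb : {measure set (borel 'rV[R]_m) -> \bar R})
    (vol : {measure set (borel X) -> \bar R}) : Prop :=
  forall (i : chart_index X) (A : set (borel X)), measurable A -> A `<=` dom i ->
    vol A = (\int[leb]_(x in chart i @` A)
               (Num.sqrt (\det (h i (chart_inv i x))))%:E)%E.

End Metric.

Section Clifford.
Context {R : realType} {m N : nat}.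
Variable gamma : 'I_m -> 'M[R[i]]_N.

Definition clifford (v : 'rV[R]_m) : 'M[R[i]]_N :=
  \sum_a real_complex R (v 0 a) *: gamma a.

(* The group Spin(m), acting on the spinor module: products of an even number
   of unit vectors. *)
Definition in_spin (s : 'M[R[i]]_N) : Prop :=
  exists vs : seq 'rV[R]_m,
    [/\ ~~ odd (size vs), (forall v, v \in vs -> v *m v^T = 1%:M) &
        s = foldr (fun v t => clifford v *m t) 1%:M vs].

End Clifford.

(* Hermitian product, conjugate-linear in the first slot. *)
Definition hprod {R : realType} {N : nat} (u v : 'cV[R[i]]_N) : R[i] :=
  \sum_a conjc (u a 0) * v a 0.

Definition hnorm2 {R : realType} {N : nat} (u : 'cV[R[i]]_N) : R :=
  complex.Re (hprod u u).

(* A spin structure on (X, h), with the associated complex spinor bundle. The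
   atlas is fine enough for each chart domain to carry an orthonormal frame;
   row a of [frame i p] is e_a in the coordinate basis. The cocycle [spin_trans]
   is the lift to Spin(m) of the change of frames
     e^i_a = \sum_b (frame_change i j) a b e^j_b,
   which thereby takes its values in SO(m). The module of spinors is C^N with
   N = 2 ^ (m / 2), on which e_a acts by [gamma a]. *)
Definition spin_dim (m : nat) : nat := (2 ^ m./2)%N.

Definition frame_change (R : realType) (m : nat) (X : closed_manifold R m)
    (frame : chart_index X -> X -> 'M[R]_m) (i j : chart_index X) (p : X) : 'M[R]_m :=
  frame i p *m jac i j p *m invmx (frame j p).

Record spin_structure (R : realType) (m : nat) (X : closed_manifold R m)
    (h : riemannian_metric X) := SpinStructure {
  frame : chart_index X -> X -> 'M[R]_m;
  frame_smooth : forall i a k, smooth_on i setT (fun p => frame i p a k);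
  frame_orthonormal : forall i p, dom i p ->
    frame i p *m h i p *m (frame i p)^T = 1%:M;
  gamma : 'I_m -> 'M[R[i]]_(spin_dim m);
  gamma_clifford : forall a b,
    gamma a *m gamma b + gamma b *m gamma a = (- (2 *+ (a == b)))%:M;
  gamma_skew : forall a, (map_mx (@conjc R) (gamma a))^T = - gamma a;
  spin_trans : chart_index X -> chart_index X -> X -> 'M[R[i]]_(spin_dim m);
  trans_smooth : forall i j a b,
    smooth_on i (dom j) (fun p => complex.Re (spin_trans i j p a b)) /\
    smooth_on i (dom j) (fun p => complex.Im (spin_trans i j p a b));
  trans_spin : forall i j p, dom i p -> dom j p -> in_spin gamma (spin_trans i j p);
  trans_lift : forall i j p a, dom i p -> dom j p ->
    gamma a *m spin_trans i j p =
    spin_trans i j p *m clifford gamma (row a (frame_change frame i j p));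
  trans_id : forall i p, dom i p -> spin_trans i i p = 1%:M;
  trans_cocycle : forall i j k p, dom i p -> dom j p -> dom k p ->
    spin_trans i j p *m spin_trans j k p = spin_trans i k p
}.

Section SpinGeometry.
Context {R : realType} {m : nat} {X : closed_manifold R m}.
Context {h : riemannian_metric X} (S : spin_structure h).
Variable leb : {measure set (borel 'rV[R]_m) -> \bar R}.
Variable vol : {measure set (borel X) -> \bar R}.

Local Notation N := (spin_dim m).

(* Spinor fields, by their components in each chart. *)
Definition is_spinor_field (psi : chart_index X -> X -> 'cV[R[i]]_N) : Prop :=
  forall i j p, dom i p -> dom j p -> psi i p = spin_trans S i j p *m psi j p.

(* Spinor-valued 1-forms: [D i p k] is the value on the k-th coordinate
   vector of chart i. *)
Definition is_spinor_form (D : chart_index X -> X -> 'I_m -> 'cV[R[i]]_N) : Prop :=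
  forall i j p k, dom i p -> dom j p ->
    D i p k = spin_trans S i j p *m
              (\sum_l real_complex R (jac i j p k l) *: D j p l).

(* Entry (b, c) is h(nabla_k e_b, e_c), nabla being the Levi-Civita connection
   and k a coordinate direction. *)
Definition conn_form (i : chart_index X) (p : X) (k : 'I_m) : 'M[R]_m :=
  ((\matrix_(b, l) dchart i k (fun x => frame S i x b l) p)
   + frame S i p *m christoffel h i p k)
  *m h i p *m (frame S i p)^T.

(* The spin connection is nabla_k = d_k + spin_conn k. *)
Definition spin_conn (i : chart_index X) (p : X) (k : 'I_m) : 'M[R[i]]_N :=
  4^-1 *: \sum_b \sum_c
    real_complex R (conn_form i p k b c) *: (gamma S b *m gamma S c).

(* v is the weak k-th partial derivative of u in chart i. *)
Definition weak_pd (i : chart_index X) (k : 'I_m) (u v : X -> R) : Prop :=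
  forall z, test_function (img i) z ->
    (\int[leb]_(x in img i) (u (chart_inv i x) * pd k z x)%:E =
     - \int[leb]_(x in img i) (v (chart_inv i x) * z x)%:E)%E.

Definition weak_differential (u : X -> R) (w : chart_index X -> X -> 'cV[R]_m) :=
  forall i k, weak_pd i k u (fun p => w i p k 0).

Definition weak_nabla (psi : chart_index X -> X -> 'cV[R[i]]_N)
    (D : chart_index X -> X -> 'I_m -> 'cV[R[i]]_N) : Prop :=
  forall i k a,
    let d p := (D i p k - spin_conn i p k *m psi i p) a 0 in
    weak_pd i k (fun p => complex.Re (psi i p a 0)) (fun p => complex.Re (d p)) /\
    weak_pd i k (fun p => complex.Im (psi i p a 0)) (fun p => complex.Im (d p)).

(* w(e_a) at p *)
Definition covector_frame (w : chart_index X -> X -> 'cV[R]_m) (p : X) (a : 'I_m) : R :=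
  (frame S (chart_at p) p *m w (chart_at p) p) a 0.

(* nabla_{e_a} psi at p, where D = nabla psi *)
Definition nabla_frame (D : chart_index X -> X -> 'I_m -> 'cV[R[i]]_N) (p : X)
    (a : 'I_m) : 'cV[R[i]]_N :=
  \sum_k real_complex R (frame S (chart_at p) p a k) *: D (chart_at p) p k.

(* nabla_{e_a} eta at p *)
Definition deriv_frame (eta : X -> R) (p : X) (a : 'I_m) : R :=
  covector_frame (fun i q => \col_k dchart i k eta q) p a.

Definition dirac (D : chart_index X -> X -> 'I_m -> 'cV[R[i]]_N) (p : X) :
    'cV[R[i]]_N :=
  \sum_a gamma S a *m nabla_frame D p a.

Definition measurable_on (i : chart_index X) (f : X -> R) : Prop :=
  measurable_fun (dom i : set (borel X)) (f : borel X -> R).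

Definition measurable_covector (w : chart_index X -> X -> 'cV[R]_m) : Prop :=
  forall i k, measurable_on i (fun p => w i p k 0).

Definition measurable_spinor (psi : chart_index X -> X -> 'cV[R[i]]_N) : Prop :=
  forall i a, measurable_on i (fun p => complex.Re (psi i p a 0)) /\
              measurable_on i (fun p => complex.Im (psi i p a 0)).

Definition covector_norm (w : chart_index X -> X -> 'cV[R]_m) (p : X) : R :=
  Num.sqrt (\sum_a covector_frame w p a ^+ 2).

Definition spinor_norm (psi : chart_index X -> X -> 'cV[R[i]]_N) (p : X) : R :=
  Num.sqrt (hnorm2 (psi (chart_at p) p)).

Definition spinor_form_norm (D : chart_index X -> X -> 'I_m -> 'cV[R[i]]_N) (p : X) : R :=
  Num.sqrt (\sum_a hnorm2 (nabla_frame D p a)).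

Definition Lp (q : R) (f : X -> R) : Prop := (f : borel X -> R) \in Lfun vol q%:E.

(* u is in W^{1,q}(M), with weak differential w. *)
Record sobolev_function (q : R) (u : X -> R) (w : chart_index X -> X -> 'cV[R]_m) :
    Prop := SobolevFunction {
  sobolev_function_Lp : Lp q u;
  sobolev_function_covector : is_covector_field w;
  sobolev_function_measurable : measurable_covector w;
  sobolev_function_dLp : Lp q (covector_norm w);
  sobolev_function_weak : weak_differential u w
}.

(* psi is in W^{1,q}(M, Sigma M), with weak covariant derivative D. *)
Record sobolev_spinor (q : R) (psi : chart_index X -> X -> 'cV[R[i]]_N)
    (D : chart_index X -> X -> 'I_m -> 'cV[R[i]]_N) : Prop := SobolevSpinor {
  sobolev_spinor_field : is_spinor_field psi;
  sobolev_spinor_measurable : measurable_spinor psi;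
  sobolev_spinor_Lp : Lp q (spinor_norm psi);
  sobolev_spinor_form : is_spinor_form D;
  sobolev_spinor_dmeasurable : forall k, measurable_spinor (fun i p => D i p k);
  sobolev_spinor_dLp : Lp q (spinor_form_norm D);
  sobolev_spinor_weak : weak_nabla psi D
}.

Section DiracHarmonic.
Variables (n : nat) (kappa : R).
Variables (phi : 'I_n.+1 -> X -> R) (dphi : 'I_n.+1 -> chart_index X -> X -> 'cV[R]_m).
Variables (psi : 'I_n.+1 -> chart_index X -> X -> 'cV[R[i]]_N).
Variable Dpsi : 'I_n.+1 -> chart_index X -> X -> 'I_m -> 'cV[R[i]]_N.

(* psi^i at p *)
Definition spinor_at (i : 'I_n.+1) (p : X) : 'cV[R[i]]_N := psi i (chart_at p) p.

(* phi^i_a = dphi^i(e_a) *)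
Definition dphi_frame (i : 'I_n.+1) (p : X) (a : 'I_m) : R :=
  covector_frame (dphi i) p a.

(* |dphi|^2 phi^i + Re <psi^i, e_a . psi^j> phi^j_a *)
Definition map_rhs (i : 'I_n.+1) (p : X) : R :=
  (\sum_j \sum_a dphi_frame j p a ^+ 2) * phi i p
  + \sum_j \sum_a complex.Re (hprod (spinor_at i p) (gamma S a *m spinor_at j p))
                  * dphi_frame j p a.

(* - phi^j_a phi^i e_a . psi^j
   - 2 kappa (|psi|^2 psi^i - <psi^j, psi^i> psi^j) *)
Definition spinor_rhs (i : 'I_n.+1) (p : X) : 'cV[R[i]]_N :=
  - (\sum_j \sum_a real_complex R (dphi_frame j p a * phi i p)
                   *: (gamma S a *m spinor_at j p))
  - real_complex R (2 * kappa) *: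
      (real_complex R (\sum_j hnorm2 (spinor_at j p)) *: spinor_at i p
       - \sum_j hprod (spinor_at j p) (spinor_at i p) *: spinor_at j p).

Record weak_dirac_harmonic : Prop := WeakDiracHarmonic {
  wdh_phi : forall i, sobolev_function 2 (phi i) (dphi i);
  wdh_sphere : {ae vol, forall p : borel X, \sum_i phi i p ^+ 2 = 1};
  wdh_psi : forall i, sobolev_spinor (4 / 3) (psi i) (Dpsi i);
  wdh_tangent : {ae vol, forall p : borel X,
    \sum_i real_complex R (phi i p) *: spinor_at i p = 0};
  (* psi is in L^4. For m <= 2 nothing is required here: this is the Sobolev
     embedding of W^{1,4/3}. For m >= 3 it no longer follows, and without it the
     currents need not be conserved: near 0 in R^3, with kappa = 0, take
     phi = x / |x| and psi = chi / |x|, where chi is a holomorphic section of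
     K^{1/2} * T^{1,0} S^2 = O(1) over S^2, a harmonic spinor of pure chirality.
     All other conditions hold (the term Re <psi^i, e_a . psi^j> phi^j_a vanishes
     identically), but Re <e_a . psi^i, psi^m> e_a has a constant nonzero flux
     through the spheres |x| = r. *)
  wdh_L4 : (2 < m)%N -> forall i, Lp 4 (spinor_norm (psi i));
  wdh_map_integrable : forall i,
    vol.-integrable setT (fun p : borel X => (map_rhs i p)%:E);
  (* - div (grad phi^i) = map_rhs i in the sense of distributions *)
  wdh_map : forall i eta, smooth_fun eta ->
    (\int[vol]_p (\sum_a dphi_frame i p a * deriv_frame eta p a)%:E =
     \int[vol]_p (map_rhs i p * eta p)%:E)%E;
  wdh_spinor : forall i,
    {ae vol, forall p : borel X, dirac (Dpsi i) p = spinor_rhs i p}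
}.

End DiracHarmonic.
End SpinGeometry.

(* Main.v *)
(** The Dirac part of the current satisfies, weakly,
      [div (Re<e_a psi^i, psi^m> e_a) = Re<D psi^i, psi^m> - Re<psi^i, D psi^m>],
    where [D] is the Dirac operator; inserting the spinor equation, the quartic
    terms are symmetric in [i], [m] and cancel, and what remains is opposite to
    the divergence of [phi^m dphi^i - phi^i dphi^m] computed from the map
    equation.  These product rules are not formal at this regularity: they hold
    because [phi] is bounded and [psi] is in L^4 while its derivative is in
    L^(4/3).  In a chart one factor is mollified on a cube by the Landau kernels
    [(1 - w |x - y|^2)^n / c_n]; as these are polynomials, mollification is a
    finite sum of products, which makes it smooth and self-adjoint without any
    appeal to Fubini's theorem.  In dimension one and two the L^4 bound comes
    from the inequality of Gagliardo and Nirenberg.  Finally the test function is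
    split as [sum_p b_p^2 (eta / sum_q b_q^2)] with bumps [b_p] in charts. *)

Require Import Defs.
From HB Require Import structures.
From mathcomp Require Import all_boot all_order all_algebra.
From mathcomp Require Import complex ring lra.
From mathcomp Require Import perm.
From mathcomp Require Import all_classical all_reals all_analysis measurable_realfun.

Set Implicit Arguments.
Unset Strict Implicit.
Unset Printing Implicit Defensive.

Import Order.TTheory GRing.Theory Num.Theory.
Import numFieldNormedType.Exports.
Local Open Scope classical_set_scope.
Local Open Scope ring_scope.

(** * Smooth functions of several variables *)

(** Every product rule needs two cutoffs, and this is why the bumps enter squared. The Landau
    kernels do not vanish at the boundary of the cube, so a factor [v] is mollified only after
    multiplication by a cutoff [c]: then [c * K n x] is an admissible test function for the weak
    derivative of [v], and differentiation passes through the mollifier. The mollified function is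
    again nonzero up to the boundary, and a second cutoff [z] turns it into a test function for the
    other equation. Mollification is shown to converge in L^1. The dualities of L^4 with L^(4/3), of
    L^2 with itself and of L^1 with bounded functions are reduced to this by one notion,
    [dual_pair]: the tails of [f y * g x] are bounded by [A y + B x] with small integrals, and
    symmetric sub-Markov kernels preserve such bounds. The geometry enters through two facts on the
    Levi-Civita form [W]. It is skew, so the spin connection is skew-hermitian and its commutator
    with [gamma a] is linear in [gamma]; and its trace is the divergence of the frame, which cancels
    that commutator. *)

Lemma differentiable_near (R : realType) (V W : normedModType R) (f g : V -> W)
    (x : V) : (\forall y \near x, f y = g y) ->
  differentiable f x -> differentiable g x.
Proof.
move=> fg df; have [cf Ef] := (diff_locallyP x f).1 df.
have fgx : f x = g x by exact: (nbhs_singleton fg).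
have E : g \o shift x = cst (g x) + 'd f x +o_ 0 id.
  apply/eqaddoP => e egt0.
  have /eqaddoP/(_ e egt0) Ee := Ef.
  near=> y.
  have <- : (f \o shift x - (cst (f x) + 'd f x)) y
          = (g \o shift x - (cst (g x) + 'd f x)) y.
    rewrite !fctE /= fgx; congr (_ - _).
    near: y; move/nbhs0P : fg; apply: filterS => y.
    by rewrite /= addrC.
  by near: y.
have dE := diff_unique cf E.
by apply/diff_locallyP; rewrite dE.
Unshelve. all: by end_near. Qed.

Section Calculus.
Context {R : realType} {m : nat}.
Implicit Types (V W : set 'rV[R]_m) (f g : 'rV[R]_m -> R) (x : 'rV[R]_m) (r : nat).

Lemma pd_diff k f x : differentiable f x -> pd k f x = 'd f x (delta_mx 0 k).
Proof. by move=> df; rewrite /pd deriveE. Qed.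

Lemma pd_near k f g x : (\forall y \near x, f y = g y) -> pd k f x = pd k g x.
Proof. by move=> fg; rewrite /pd; exact: near_eq_derive. Qed.

Lemma pd_eq k f g V x : open V -> V x -> (forall y, V y -> f y = g y) ->
  pd k f x = pd k g x.
Proof.
move=> oV Vx fg; apply: pd_near; near=> y; apply: fg.
by near: y; exact: open_nbhs_nbhs.
Unshelve. all: by end_near. Qed.

Lemma pdD k f g x : differentiable f x -> differentiable g x ->
  pd k (fun y => f y + g y) x = pd k f x + pd k g x.
Proof. by move=> df dg; rewrite /pd deriveD//; exact: diff_derivable. Qed.

Lemma pdM k f g x : differentiable f x -> differentiable g x ->
  pd k (fun y => f y * g y) x = pd k f x * g x + f x * pd k g x.
Proof.
move=> df dg; rewrite /pd (@deriveM _ _ f g); [|exact: diff_derivable..].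
by rewrite addrC /GRing.scale /= [_ * g x]mulrC.
Qed.

Lemma pdV k f x : differentiable f x -> f x != 0 ->
  pd k (fun y => (f y)^-1) x = - pd k f x * ((f x)^-1 * (f x)^-1).
Proof.
move=> df f0; rewrite /pd (@deriveV _ _ f)//; last exact: diff_derivable.
by rewrite /GRing.scale /= expr2 invfM mulNr mulNr mulrC.
Qed.

Lemma pd_cst k (c : R) x : pd k (fun=> c) x = 0.
Proof. by rewrite /pd derive_cst. Qed.

Lemma differentiable_coord0 l x : differentiable (fun y : 'rV[R]_m => y 0 l) x.
Proof. exact: differentiable_coord. Qed.

Lemma pd_coord k l x : pd k (fun y : 'rV[R]_m => y 0 l) x = (k == l)%:R.
Proof.
rewrite pd_diff; last exact: differentiable_coord0.
(* The coordinate is packaged as a linear map, which is its own differential. *)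
have @h : {linear 'rV[R]_m -> R}.
  by exists (fun y : 'rV[R]_m => y 0 l); do 2!eexists; do ?[constructor];
     rewrite ?mxE// => ? *; rewrite ?mxE//; move=> ?; rewrite !mxE.
rewrite (_ : (fun y => _) = h)//.
rewrite diff_lin; last by move=> y; exact: coord_continuous.
by rewrite /h/= mxE eqxx /= eq_sym.
Qed.

Lemma pd_comp1 k (G : R -> R) (c : R) f x : differentiable f x ->
  is_derive (f x) 1 G c ->
  differentiable (fun y => G (f y)) x /\
  pd k (fun y => G (f y)) x = c * pd k f x.
Proof.
move=> df [/derivable1_diffP dG Gg].
have dGf : differentiable (G \o f) x by exact: differentiable_comp.
split => //; rewrite pd_diff// diff_comp//= pd_diff// diff1E//.
by rewrite derive1E Gg /GRing.scale /= mulrC.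
Qed.

End Calculus.
Section Chain.
Context {R : realType} {m n : nat}.

Lemma differentiable_row (t : 'rV[R]_m -> 'rV[R]_n) x :
  (forall l, differentiable (fun y => t y 0 l) x) -> differentiable t x.
Proof.
move=> dt.
rewrite (_ : t = \sum_(l < n) (fun y => t y 0 l *: (delta_mx 0 l : 'rV[R]_n))).
  by apply: differentiable_sum => l; exact: differentiableZl.
by apply/funext => y; rewrite fct_sumE [LHS]row_sum_delta.
Qed.

Lemma pd_chain k (t : 'rV[R]_m -> 'rV[R]_n) (f : 'rV[R]_n -> R) x :
  (forall l, differentiable (fun y => t y 0 l) x) -> differentiable f (t x) ->
  differentiable (f \o t) x /\
  pd k (f \o t) x = \sum_l pd k (fun y => t y 0 l) x * pd l f (t x).
Proof.
move=> dt df; have dtx := differentiable_row dt.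
have dft : differentiable (f \o t) x by exact: differentiable_comp.
split => //; rewrite pd_diff// diff_comp//=.
have -> : 'd t x (delta_mx 0 k) =
   \sum_l pd k (fun y => t y 0 l) x *: (delta_mx 0 l : 'rV[R]_n).
  rewrite [LHS]row_sum_delta; apply: eq_bigr => l _; congr (_ *: _).
  rewrite /pd -deriveE// derive_mx; last exact: diff_derivable.
  by rewrite mxE.
rewrite linear_sum; apply: eq_bigr => l _.
by rewrite linearZ (pd_diff l df).
Qed.

End Chain.

Section Ck.
Context {R : realType} {m : nat}.
Implicit Types (V W : set 'rV[R]_m) (f g : 'rV[R]_m -> R) (x : 'rV[R]_m) (r : nat).

Lemma Ck_eq r V f g : open V -> (forall x, V x -> f x = g x) ->
  Ck r V f -> Ck r V g.
Proof.
move=> oV; elim: r f g => [|r IH] f g fg /=.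
  move=> cf x Vx; have nV : \forall y \near x, f y = g y.
    by near=> y; apply: fg; near: y; exact: open_nbhs_nbhs.
  rewrite /prop_for /continuous_at -(fg _ Vx).
  exact: cvg_trans (near_eq_cvg nV) (cf x Vx).
move=> [df pf]; split=> [x Vx|k].
  apply: differentiable_near (df x Vx).
  by near=> y; apply: fg; near: y; exact: open_nbhs_nbhs.
by apply: IH (pf k) => x Vx; apply: pd_eq Vx fg.
Unshelve. all: by end_near. Qed.

Lemma Ck_sub r V W f : W `<=` V -> Ck r V f -> Ck r W f.
Proof.
move=> WV; elim: r f => [|r IH] f /= => [cf x /WV|[df pf]]; first exact: cf.
by split=> [x /WV|k]; [exact: df|exact: IH].
Qed.

(** [Ck] is a condition at each point separately, so it glues over any family of sets. Functions
    extended by zero are shown to be smooth in this way. *)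
Lemma Ck_bigcup r (I : Type) (D : set I) (V : I -> set 'rV[R]_m) f :
  (forall i, D i -> Ck r (V i) f) -> Ck r (\bigcup_(i in D) V i) f.
Proof.
elim: r f => [|r IH] f /= H => [x [i Di Vx]|]; first exact: (H i Di x Vx).
split=> [x [i Di Vx]|k]; first exact: (H i Di).1.
by apply: IH => i Di; exact: (H i Di).2.
Qed.

Lemma Ck_cont r V f x : Ck r V f -> V x -> {for x, continuous f}.
Proof.
case: r => [|r] /= => [cf Vx|[df _] Vx]; first exact: cf.
by apply: differentiable_continuous; exact: df.
Qed.

Lemma CkW r V f : Ck r.+1 V f -> Ck r V f.
Proof.
elim: r f => [|r IH] f [df pf]; first by move=> x Vx; apply: (@Ck_cont 1 V).
by split=> // k; exact: IH.
Qed.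

Lemma Ck_cst r V (c : R) : Ck r V (fun=> c).
Proof.
elim: r c => [|r IH] c /=; first by move=> x _; exact: cst_continuous.
split=> [x _|k]; first exact: differentiable_cst.
by rewrite (_ : pd k _ = fun=> 0)//; apply/funext => x; rewrite pd_cst.
Qed.

Lemma Ck_coord r V l : Ck r V (fun x => x 0 l).
Proof.
case: r => [|r] /=; first by move=> x _; exact: coord_continuous.
split=> [x _|k]; first exact: differentiable_coord0.
rewrite (_ : pd k _ = fun=> (k == l)%:R); first exact: Ck_cst.
by apply/funext => x; rewrite pd_coord.
Qed.

Lemma CkD r V f g : open V -> Ck r V f -> Ck r V g -> Ck r V (fun x => f x + g x).
Proof.
move=> oV; elim: r f g => [|r IH] f g /=.
  by move=> cf cg x Vx; apply: continuousD; [exact: cf|exact: cg].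
move=> [df pf] [dg pg]; split=> [x Vx|k].
  by apply: differentiableD; [exact: df|exact: dg].
apply: Ck_eq oV _ (IH _ _ (pf k) (pg k)) => x Vx.
by rewrite pdD//; [exact: df|exact: dg].
Qed.

Lemma CkM r V f g : open V -> Ck r V f -> Ck r V g -> Ck r V (fun x => f x * g x).
Proof.
move=> oV; elim: r f g => [|r IH] f g.
  by move=> cf cg x Vx; apply: continuousM; [exact: cf|exact: cg].
move=> Cf Cg; have cf := CkW Cf; have cg := CkW Cg.
case: Cf Cg => [df pf] [dg pg]; split=> [x Vx|k].
  by apply: differentiableM; [exact: df|exact: dg].
apply: Ck_eq oV _ (CkD oV (IH _ _ (pf k) cg) (IH _ _ cf (pg k))) => x Vx.
by rewrite pdM//; [exact: df|exact: dg].
Qed.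

Lemma CkZ r V (c : R) f : open V -> Ck r V f -> Ck r V (fun x => c * f x).
Proof. by move=> oV; apply: CkM => //; exact: Ck_cst. Qed.

Lemma CkN r V f : open V -> Ck r V f -> Ck r V (fun x => - f x).
Proof.
by move=> oV /(CkZ (- 1) oV); apply: Ck_eq => // x _; rewrite mulN1r.
Qed.

Lemma CkB r V f g : open V -> Ck r V f -> Ck r V g -> Ck r V (fun x => f x - g x).
Proof. by move=> oV Cf Cg; apply: CkD => //; exact: CkN. Qed.

Lemma Ck_sum r V (I : Type) (s : seq I) (P : pred I) (f : I -> 'rV[R]_m -> R) :
  open V -> (forall i, P i -> Ck r V (f i)) -> Ck r V (fun x => \sum_(i <- s | P i) f i x).
Proof.
move=> oV Cf; elim: s => [|i s IH].
  by apply: Ck_eq oV _ (Ck_cst r V 0) => x _; rewrite big_nil.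
case: (boolP (P i)) => Pi.
  by apply: Ck_eq oV _ (CkD oV (Cf i Pi) IH) => x _; rewrite big_cons Pi.
by apply: Ck_eq oV _ IH => x _; rewrite big_cons (negbTE Pi).
Qed.

Lemma Ck_prod r V (I : Type) (s : seq I) (P : pred I) (f : I -> 'rV[R]_m -> R) :
  open V -> (forall i, P i -> Ck r V (f i)) -> Ck r V (fun x => \prod_(i <- s | P i) f i x).
Proof.
move=> oV Cf; elim: s => [|i s IH].
  by apply: Ck_eq oV _ (Ck_cst r V 1) => x _; rewrite big_nil.
case: (boolP (P i)) => Pi.
  by apply: Ck_eq oV _ (CkM oV (Cf i Pi) IH) => x _; rewrite big_cons Pi.
by apply: Ck_eq oV _ IH => x _; rewrite big_cons (negbTE Pi).
Qed.

Lemma Ck_exp r V f n : open V -> Ck r V f -> Ck r V (fun x => f x ^+ n).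
Proof.
move=> oV Cf; elim: n => [|n IH].
  by apply: Ck_eq oV _ (Ck_cst r V 1) => x _; rewrite expr0.
by apply: Ck_eq oV _ (CkM oV Cf IH) => x _; rewrite exprS.
Qed.

Lemma CkV r V f : open V -> (forall x, V x -> f x != 0) -> Ck r V f ->
  Ck r V (fun x => (f x)^-1).
Proof.
move=> oV f0; elim: r => [|r IH].
  by move=> cf x Vx; apply: continuousV; [exact: f0|exact: cf].
move=> Cf; have /IH CV := CkW Cf; case: Cf => df pf.
split=> [x Vx|k]; first by apply: differentiableV; [exact: df|exact: f0].
apply: Ck_eq oV _ (CkM oV (CkN oV (pf k)) (CkM oV CV CV)) => x Vx.
by rewrite pdV//; [exact: df|exact: f0].
Qed.

Lemma Ck_sqrt r V f : open V -> (forall x, V x -> 0 < f x) -> Ck r V f ->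
  Ck r V (fun x => Num.sqrt (f x)).
Proof.
move=> oV f0; elim: r => [|r IH].
  move=> cf x Vx; apply: (@continuous_comp _ _ _ f (@Num.sqrt R)); first exact: cf.
  exact: sqrt_continuous.
move=> Cf; have /IH CS := CkW Cf; case: Cf => df pf.
have H x k : V x -> differentiable (fun y => Num.sqrt (f y)) x /\
    pd k (fun y => Num.sqrt (f y)) x = (2 * Num.sqrt (f x))^-1 * pd k f x.
  by move=> Vx; apply: pd_comp1; [exact: df|exact: is_derive1_sqrt (f0 x Vx)].
split=> [x Vx|k].
  (* With [m = 0] there is no index [k] at which [H] can be used, but then every function is
     constant. *)
  case: (posnP m) => [m0|m0]; last exact: (H x (Ordinal m0) Vx).1.
  have x0 : forall y : 'rV[R]_m, y = x.
    by move=> y; apply/rowP => -[j jm]; exfalso; rewrite m0 in jm.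
  rewrite (_ : (fun y => _) = fun=> Num.sqrt (f x)); first exact: differentiable_cst.
  by apply/funext => y; rewrite (x0 y).
have C2 : Ck r V (fun x => (2 * Num.sqrt (f x))^-1).
  apply: CkV => //; last exact: CkZ.
  by move=> x Vx; rewrite mulf_neq0// gt_eqF// sqrtr_gt0 f0.
apply: Ck_eq oV _ (CkM oV C2 (pf k)) => x Vx.
by rewrite (H x k Vx).2.
Qed.

End Ck.

(** Induction on the order, for all [f] at once: the chain rule produces the functions
    [pd l f \o t], to which the induction applies one order lower. *)
Lemma Ck_comp {R : realType} {m n : nat} r (V : set 'rV[R]_m) (W : set 'rV[R]_n)
    (t : 'rV[R]_m -> 'rV[R]_n) (f : 'rV[R]_n -> R) :
  open V -> (forall x, V x -> W (t x)) ->
  (forall l, Ck r V (fun x => t x 0 l)) -> Ck r W f -> Ck r V (f \o t).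
Proof.
move=> oV VW; elim: r f => [|r IH] f Ct Cf.
  move=> x Vx; apply: continuous_comp; last exact/Cf/VW.
  rewrite /prop_for /continuous_at; have FF : Filter (nbhs x) := nbhs_filter x.
  apply/cvg_ballP => e e0.
  have H : nbhs x [set y | forall l, ball (t x 0 l) e (t y 0 l)].
    apply: (@filter_forall _ _ (fun l y => ball (t x 0 l) e (t y 0 l)) _ FF) => l.
    by have /cvg_ballP := Ct l x Vx; exact.
  by apply: filterS H => y /= H; split=> // i l; rewrite ord1; exact: H.
have dt x l : V x -> differentiable (fun y => t y 0 l) x by move=> Vx; exact: (Ct l).1.
have df x : V x -> differentiable f (t x) by move=> Vx; exact/Cf.1/VW.
split=> [x Vx|k].
  apply: differentiable_comp; last exact: df.
  by apply: differentiable_row => l; exact: dt.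
have Ctr l := CkW (Ct l).
have C l : Ck r V (fun x => pd k (fun y => t y 0 l) x * (pd l f \o t) x).
  by apply: CkM oV ((Ct l).2 k) _; apply: IH => //; exact: (Cf.2 l).
apply: Ck_eq oV _ (Ck_sum (index_enum 'I_n) (P := xpredT) oV (fun l _ => C l)) => x Vx.
by rewrite (pd_chain k (fun l => dt x l Vx) (df x Vx)).2.
Qed.

(** * A smooth function vanishing on a half-line *)

Section Flat.
Context {R : realType}.

(** The powers of 1/t in front of exp(-1/t) make the family closed under differentiation, so that
    smoothness is an induction on the order. *)
Definition flat (j : nat) (t : R) : R :=
  if t <= 0 then 0 else t^-1 ^+ j * expR (- t^-1).

Lemma flat_ge0 j t : 0 <= flat j t.
Proof.
rewrite /flat; case: (leP t 0) => // t0.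
by rewrite mulr_ge0 ?expR_ge0// exprn_ge0// invr_ge0 ltW.
Qed.

Lemma flat_gt0 j t : 0 < t -> 0 < flat j t.
Proof.
move=> t0; rewrite /flat leNgt t0/=.
by rewrite mulr_gt0 ?expR_gt0// exprn_gt0// invr_gt0.
Qed.

Lemma flat_le0 j t : t <= 0 -> flat j t = 0.
Proof. by rewrite /flat => ->. Qed.

(** With n = j + 2, the inequality s/n <= exp(s/n) raised to the power n gives s^n <= n^n exp(s); at
    s = 1/t this is the claim. A bound of order t^2 is what makes the derivative at 0 vanish. *)
Lemma flat_quadratic j t : flat j t <= (j.+2)%:R ^+ j.+2 * t ^+ 2.
Proof.
rewrite /flat; case: (leP t 0) => t0.
  by apply: mulr_ge0; rewrite ?sqr_ge0 ?exprn_ge0.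
set n := j.+2; have n0 : (0 : R) < n%:R by rewrite ltr0n.
set s := t^-1; have s0 : 0 < s by rewrite invr_gt0.
have H : s ^+ n <= n%:R ^+ n * expR s.
  have h1 : s / n%:R <= expR (s / n%:R).
    by apply: le_trans (expR_ge1Dx _); rewrite lerDr.
  have -> : expR s = expR (s / n%:R) ^+ n.
    by rewrite -expRM_natl mulrC divfK// gt_eqF.
  rewrite -exprMn; apply: lerXn2r.
  - by rewrite nnegrE ltW.
  - by rewrite nnegrE mulr_ge0 ?expR_ge0 ?ltW.
  - by rewrite mulrC -ler_pdivrMr.
rewrite expRN ler_pdivrMr ?expR_gt0// mulrAC.
have -> : t ^+ 2 = (s ^+ 2)^-1 by rewrite /s exprVn invrK.
rewrite ler_pdivlMr ?exprn_gt0//.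
by rewrite -exprD addn2.
Qed.

Lemma flat_is_derive j (t : R) :
  is_derive t 1 (flat j) (flat j.+2 t - j%:R * flat j.+1 t).
Proof.
have [t0|t0|->] := ltgtP t 0.
- rewrite !flat_le0 ?(ltW t0)// mulr0 subr0.
  apply: (@near_eq_is_derive _ _ _ (cst 0)) => //.
  by near=> y; rewrite flat_le0//; apply/ltW; near: y; exact: lt_nbhsl.
- pose g := fun y : R => y^-1 ^+ j * expR (- y^-1).
  apply: (@near_eq_is_derive _ _ _ g) => //.
    near=> y; rewrite /flat/g leNgt.
    suff -> : 0 < y by [].
    by near: y; exact: lt_nbhsr.
  have tn0 : t != 0 by rewrite gt_eqF.
  have dv : is_derive t 1 (fun y : R => y^-1) (- t ^- 2).
    apply: DeriveDef; first exact: (@derivableV _ _ (fun y : R => y)).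
    by rewrite (@deriveV _ _ (fun y : R => y))// derive_id /GRing.scale/= mulr1.
  have dX := @is_deriveX _ _ (fun y : R => y^-1) j t 1 _ dv.
  have dN := is_deriveN dv.
  have dE : is_derive t 1 (fun y : R => expR (- y^-1)) (expR (- t^-1) * t ^- 2).
    have := @is_derive1_comp _ expR (fun y => - y^-1) t _ _ (is_derive_expR _) dN.
    by rewrite opprK.
  have dM := is_deriveM dX dE; rewrite exprfctE in dM.
  apply: (is_derive_eq dM).
  rewrite /flat leNgt t0/= /GRing.scale/=.
  by case: j {g dX dM} => [|j]; rewrite /= ?exprS ?expr0; field.
- rewrite !flat_le0// mulr0 subr0.
  (* By the quadratic bound the difference quotient at 0 is at most a constant times |h|. *)
  have L : h^-1 *: (flat j (h *: 1 + 0) - flat j 0) @[h --> 0^'] --> (0 : R).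
    apply/cvgr0Pnorm_lt => e e0; near=> h.
    have h0 : h != 0 by near: h; exact: nbhs_dnbhs_neq.
    rewrite addr0 [flat j 0]flat_le0// subr0 /GRing.scale/= mulr1 normrM.
    rewrite (ger0_norm (flat_ge0 _ _)) normfV.
    rewrite mulrC ltr_pdivrMr ?normr_gt0//.
    apply: le_lt_trans (flat_quadratic _ _) _.
    rewrite -(@real_normK _ h) ?num_real// expr2 mulrA ltr_pM2r ?normr_gt0//.
    rewrite -ltr_pdivlMl ?exprn_gt0//.
    near: h; apply: dnbhs0_lt.
    by rewrite mulr_gt0// invr_gt0 exprn_gt0.
  apply: DeriveDef; first by apply/cvg_ex; exists 0.
  exact: cvg_lim.
Unshelve. all: by end_near. Qed.
End Flat.

(** The induction runs over all [j] together, since the derivative of [flat j] involves [flat j.+1]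
    and [flat j.+2]. *)
Lemma Ck_flat {R : realType} {m : nat} r (V : set 'rV[R]_m) j f : open V ->
  Ck r V f -> Ck r V (fun x => flat j (f x)).
Proof.
move=> oV; elim: r j => [|r IH] j Cf.
  move=> x Vx; apply: (@continuous_comp _ _ _ f (flat j)); first exact: Cf.
  apply/differentiable_continuous/derivable1_diffP.
  by have [] := flat_is_derive j (f x).
have H x k : V x -> differentiable (fun y => flat j (f y)) x /\
    pd k (fun y => flat j (f y)) x =
    (flat j.+2 (f x) - j%:R * flat j.+1 (f x)) * pd k f x.
  by move=> Vx; apply: pd_comp1; [exact: Cf.1|exact: flat_is_derive].
split=> [x Vx|k].
  apply: (@differentiable_comp _ _ _ _ f (flat j)); first exact: Cf.1.
  by apply/derivable1_diffP; have [] := flat_is_derive j (f x).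
have cf := CkW Cf.
apply: Ck_eq oV _ (CkM oV (CkB oV (IH j.+2 cf) (CkZ j%:R oV (IH j.+1 cf))) (Cf.2 k)).
by move=> x Vx; rewrite (H x k Vx).2.
Qed.

(** * Borel sets and the Lebesgue measure *)

Section Borel.
Context {T : ptopologicalType}.

Lemma borel_open (A : set T) : open A -> measurable (A : set (borel T)).
Proof. by move=> oA; exact: sub_sigma_algebra. Qed.

Lemma open_preimage (U : ptopologicalType) (V : set T) (f : T -> U) (A : set U) :
  open V -> (forall x, V x -> {for x, continuous f}) -> open A ->
  open (V `&` f @^-1` A).
Proof.
move=> oV cf oA; rewrite openE => x [Vx Ax].
rewrite /interior; apply: filterI; first exact: open_nbhs_nbhs.
by apply: cf => //; exact: open_nbhs_nbhs.
Qed.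

Lemma borel_continuous (U : ptopologicalType) (V : set T) (f : T -> U) :
  open V -> (forall x, V x -> {for x, continuous f}) ->
  measurable_fun (V : set (borel T)) (f : borel T -> borel U).
Proof.
move=> oV cf; apply: (@measurability _ _ (borel T) (borel U) V f (@open U)) => //.
by move=> _ [A oA <-]; apply: borel_open; exact: open_preimage.
Qed.

Lemma borel_continuous_real (R : realType) (V : set T) (f : T -> R) :
  open V -> (forall x, V x -> {for x, continuous f}) ->
  measurable_fun (V : set (borel T)) (f : borel T -> R).
Proof.
move=> oV cf.
apply: (@measurability _ _ (borel T) R V f _ (RGenOpens.measurableE R)).
move=> _ [_ [a [b ->] <-]]; apply: borel_open.
by apply: open_preimage => //; exact: interval_open.
Qed.

End Borel.

Section Boxes.
Context {R : realType} {m : nat}.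
Local Notation rV := 'rV[R]_m.
Implicit Types a b x y : rV.

Lemma coord_le_norm x k : `|x 0 k| <= `|x|.
Proof.
rewrite [leRHS]mx_normrE.
exact: (le_bigmax (0 : R) (fun ij : 'I_1 * 'I_m => `|x ij.1 ij.2|) (0, k)).
Qed.

Definition hobox a b : set rV := [set x | forall k, a 0 k <= x 0 k < b 0 k].
Definition oobox a b : set rV := [set x | forall k, a 0 k < x 0 k < b 0 k].

Lemma open_oobox a b : open (oobox a b).
Proof.
rewrite openE => x abx; rewrite /interior.
apply: (@filter_forall _ _ (fun k y => a 0 k < y 0 k < b 0 k) (nbhs x) (nbhs_filter x)) => k.
have /coord_continuous : nbhs (x 0 k) [set t | a 0 k < t < b 0 k].
  apply: open_nbhs_nbhs; split; last exact: abx.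
  rewrite (_ : [set t | _] = `]a 0 k, b 0 k[%classic); first exact: interval_open.
  by apply/seteqP; split=> t /=; rewrite in_itv.
by [].
Qed.

Lemma measurable_coord k : measurable_fun setT (fun x : borel rV => x 0 k).
Proof. by apply: borel_continuous_real; [exact: openT|move=> x _; exact: coord_continuous]. Qed.

Lemma measurable_hobox a b : measurable (hobox a b : set (borel rV)).
Proof.
have -> : hobox a b = \bigcap_(k in [set: 'I_m]) [set x | a 0 k <= x 0 k < b 0 k].
  by apply/seteqP; split=> x H; [move=> k _; exact: H|move=> k; exact: H].
apply: (@fin_bigcap_measurable _ (borel rV)); first exact: finite_finset.
move=> k _; rewrite -[X in measurable X]setTI.
rewrite (_ : (fun _ => _) = (fun x : rV => x 0 k) @^-1` `[a 0 k, b 0 k[%classic).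
  by apply: measurable_coord => //; exact: measurable_itv.
by apply/seteqP; split=> t /=; rewrite in_itv.
Qed.

Lemma hobox_setI : setI_closed [set A : set rV | exists a b, A = hobox a b].
Proof.
move=> _ _ [a [b ->]] [a' [b' ->]].
exists (\row_k Num.max (a 0 k) (a' 0 k)), (\row_k Num.min (b 0 k) (b' 0 k)).
apply/seteqP; split=> x /=.
  by move=> [H H'] k; rewrite !mxE ge_max lt_min; case/andP: (H k) => -> ->;
    case/andP: (H' k) => -> ->.
move=> H; split=> k; move: (H k); rewrite !mxE ge_max lt_min;
  by move=> /andP[/andP[h1 h2] /andP[h3 h4]]; apply/andP.
Qed.

Definition ratrow (q : 'rV[rat]_m) : rV := map_mx ratr q.

Lemma nbhs_box x (A : set rV) : nbhs x A ->
  exists e : R, 0 < e /\ forall y, (forall k, `|x 0 k - y 0 k| < e) -> A y.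
Proof.
move=> /nbhs_ballP[e /= e0 He]; exists e; split=> // y Hy.
by apply: He; split=> // i k; rewrite ord1; exact: Hy.
Qed.

(** Around each point of [A] there is a box with rational corners inside [A]. The index type is
    countable, and boxes that do not fit are replaced by the empty set, so the union is one of
    countably many measurable sets. *)
Lemma open_bigcup_hobox (A : set rV) : open A ->
  A = \bigcup_(q in [set: 'rV[rat]_m * 'rV[rat]_m])
        (if `[< hobox (ratrow q.1) (ratrow q.2) `<=` A >]
         then hobox (ratrow q.1) (ratrow q.2) else set0).
Proof.
move=> oA; apply/seteqP; split=> x; last first.
  by move=> [q _]; case: asboolP => // qA /qA.
move=> Ax; have [e [e0 He]] := nbhs_box (open_nbhs_nbhs (conj oA Ax)).
have /choice[q1 Hq1] k : exists q, ratr q \in `]x 0 k - e, x 0 k[ by apply: rat_in_itvoo; lra.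
have /choice[q2 Hq2] k : exists q, ratr q \in `]x 0 k, x 0 k + e[ by apply: rat_in_itvoo; lra.
exists (\row_k q1 k, \row_k q2 k) => //=; case: asboolP => H.
  move=> k; rewrite !mxE; move: (Hq1 k) (Hq2 k); rewrite !in_itv/= => /andP[_ h1] /andP[h2 _].
  by rewrite (ltW h1).
exfalso; apply: H => y Hy; apply: He => k.
move: (Hy k) (Hq1 k) (Hq2 k); rewrite !mxE !in_itv/= => /andP[? ?] /andP[? ?] /andP[? ?].
by rewrite ltr_norml; apply/andP; split; lra.
Qed.

Lemma borel_hobox : @measurable _ (borel rV) =
  <<s [set A : set rV | exists a b, A = hobox a b] >>.
Proof.
set G := [set A | _].
apply/seteqP; split=> A; last first.
  apply: smallest_sub; first exact: sigma_algebra_measurable.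
  by move=> _ [a [b ->]]; exact: measurable_hobox.
apply: smallest_sub; first exact: smallest_sigma_algebra.
move=> B oB; rewrite (open_bigcup_hobox oB).
apply: (@countable_bigcupT_measurable _ (g_sigma_algebraType G)).
  exact: countableP.
move=> q; case: asboolP => _; last exact: measurable0.
by apply: sub_sigma_algebra; exists (ratrow q.1), (ratrow q.2).
Qed.

Lemma hobox_cover : \bigcup_n hobox (const_mx (- n%:R)) (const_mx n%:R) = [set: rV].
Proof.
apply/seteqP; split=> // x _.
have [n Hn] : exists n : nat, `|x| < n%:R.
  exists (Num.truncn `|x|).+1; exact: truncnS_gt.
exists n => // k; rewrite !mxE.
have xk : `|x 0 k| <= `|x|.
  exact: coord_le_norm.
have : `|x 0 k| < n%:R by exact: le_lt_trans Hn.
by rewrite ltr_norml => /andP[/ltW -> ->].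
Qed.

(** Half-open boxes are stable under intersection, generate the Borel sets and exhaust the space by
    sets of finite measure. Invariance under translation and the comparison with the measures of the
    line and the plane all rest on this. *)
Lemma lebesgue_unique (l1 l2 : {measure set (borel rV) -> \bar R}) :
  is_lebesgue l1 -> is_lebesgue l2 -> forall A, measurable A -> l1 A = l2 A.
Proof.
move=> H1 H2 A mA.
apply: (@measure_unique _ R (borel rV) [set A : set rV | exists a b, A = hobox a b]
   (fun n => hobox (const_mx (- n%:R)) (const_mx n%:R))) => //.
- exact: borel_hobox.
- exact: hobox_setI.
- by move=> n; do 2 eexists.
- exact: hobox_cover.
- move=> _ [a [b ->]]; have [ab|nab] := pselect (forall k, a 0 k <= b 0 k).
    by rewrite [LHS](H1 a b ab) [RHS](H2 a b ab).
  (* A box with disordered corners is empty. *)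
  rewrite (_ : hobox a b = set0) ?measure0// -subset0 => x Hx.
  apply: nab => k; move: (Hx k) => /andP[h1 h2]; exact: le_trans (ltW h2).
- move=> n; rewrite [X in (X < _)%E]H1 ?ltry// => k; rewrite !mxE.
  by rewrite ge0_cp.
Qed.

End Boxes.

(** * Integral operators with separable kernels *)

Section L1.
Context {d : measure_display} {T : measurableType d} {R : realType}.
Variables (mu : {measure set T -> \bar R}) (D : set T).
Hypothesis mD : measurable D.
Implicit Types f g h : T -> R.

Definition L1 f := mu.-integrable D (EFin \o f).
Definition Int f := \int[mu]_(x in D) f x.

Lemma L1_meas f : L1 f -> measurable_fun D f.
Proof. by move=> /measurable_int /measurable_EFinP. Qed.

Lemma L1_eq f g : (forall x, D x -> f x = g x) -> L1 f -> L1 g.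
Proof. by move=> fg; apply: eq_integrable => // x; rewrite inE => Dx /=; rewrite fg. Qed.

Lemma Int_eq f g : (forall x, D x -> f x = g x) -> Int f = Int g.
Proof. by move=> fg; apply: eq_Rintegral => x; rewrite inE; exact: fg. Qed.

Lemma L1_le f g : measurable_fun D f -> (forall x, D x -> `|f x| <= `|g x|) ->
  L1 g -> L1 f.
Proof.
move=> mf fg; apply: le_integrable => //; first exact/measurable_EFinP.
Qed.

Lemma L1D f g : L1 f -> L1 g -> L1 (fun x => f x + g x).
Proof. by move=> Lf Lg; have := integrableD mD Lf Lg; apply: eq_integrable. Qed.

Lemma L1Z c f : L1 f -> L1 (fun x => c * f x).
Proof. by move=> Lf; have := integrableZl mD c Lf; apply: eq_integrable. Qed.

Lemma L1N f : L1 f -> L1 (fun x => - f x).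
Proof. by move=> /(L1Z (-1)); apply: L1_eq => x _; rewrite mulN1r. Qed.

Lemma L1B f g : L1 f -> L1 g -> L1 (fun x => f x - g x).
Proof. by move=> Lf /L1N; exact: L1D. Qed.

Lemma L1_abs f : L1 f -> L1 (fun x => `|f x|).
Proof. exact: integrable_norm. Qed.

Lemma L1_0 : L1 (fun=> 0).
Proof. exact: integrable0. Qed.

Lemma L1_sum (I : Type) (s : seq I) (P : pred I) (F : I -> T -> R) :
  (forall i, P i -> L1 (F i)) -> L1 (fun x => \sum_(i <- s | P i) F i x).
Proof.
move=> LF; elim: s => [|i s IH].
  by apply: L1_eq L1_0 => x _; rewrite big_nil.
case: (boolP (P i)) => Pi.
  by apply: L1_eq (L1D (LF i Pi) IH) => x _; rewrite big_cons Pi.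
by apply: L1_eq IH => x _; rewrite big_cons (negbTE Pi).
Qed.

Lemma L1_bddM f h : L1 f -> measurable_fun D h ->
  (exists c : R, forall x, D x -> `|h x| <= c) -> L1 (fun x => h x * f x).
Proof.
move=> Lf mh [c hc]; have c0 : 0 <= Num.max c 0 by rewrite le_max lexx orbT.
apply: (@L1_le _ (fun x => Num.max c 0 * f x)); last exact: L1Z.
  by apply: measurable_funM => //; exact: L1_meas.
move=> x Dx; rewrite !normrM ler_wpM2r// (ger0_norm c0) le_max.
by rewrite hc.
Qed.

Lemma IntD f g : L1 f -> L1 g -> Int (fun x => f x + g x) = Int f + Int g.
Proof. exact: RintegralD. Qed.

Lemma IntB f g : L1 f -> L1 g -> Int (fun x => f x - g x) = Int f - Int g.
Proof. exact: RintegralB. Qed.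

Lemma IntZ c f : L1 f -> Int (fun x => c * f x) = c * Int f.
Proof. exact: RintegralZl. Qed.

Lemma IntN f : L1 f -> Int (fun x => - f x) = - Int f.
Proof.
move=> Lf; rewrite -mulN1r -IntZ//.
by apply: Int_eq => x _; rewrite mulN1r.
Qed.

Lemma Int0 : Int (fun=> 0) = 0.
Proof. by rewrite /Int Rintegral_cst// mul0r. Qed.

Lemma Int_sum (I : Type) (s : seq I) (P : pred I) (F : I -> T -> R) :
  (forall i, P i -> L1 (F i)) ->
  Int (fun x => \sum_(i <- s | P i) F i x) = \sum_(i <- s | P i) Int (F i).
Proof.
move=> LF; elim: s => [|i s IH].
  by rewrite big_nil -[RHS]Int0; apply: Int_eq => x _; rewrite big_nil.
rewrite big_cons; case: ifPn => Pi; rewrite -IH.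
  rewrite -IntD; [|exact: LF|exact: L1_sum].
  by apply: Int_eq => x _; rewrite big_cons Pi.
by apply: Int_eq => x _; rewrite big_cons (negbTE Pi).
Qed.

Lemma Int_le f g : L1 f -> L1 g -> (forall x, D x -> f x <= g x) -> Int f <= Int g.
Proof. exact: le_Rintegral. Qed.

Lemma Int_ge0 f : (forall x, D x -> 0 <= f x) -> 0 <= Int f.
Proof. exact: Rintegral_ge0. Qed.

Lemma Int_abs f : L1 f -> `|Int f| <= Int (fun x => `|f x|).
Proof. exact: le_normr_Rintegral. Qed.

Lemma Int_fin f : L1 f -> (Int f)%:E = (\int[mu]_(x in D) (f x)%:E)%E.
Proof. by move=> Lf; rewrite /Int /Rintegral fineK//; exact: integrable_fin_num Lf. Qed.

Hypothesis fD : (mu D < +oo)%E.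

Lemma L1_bdd h : measurable_fun D h -> (exists c : R, forall x, D x -> `|h x| <= c) -> L1 h.
Proof.
move=> mh [c hc]; apply: measurable_bounded_integrable => //.
by exists c; split; [exact: num_real|move=> M cM x Dx /=; exact: le_trans (hc x Dx) (ltW cM)].
Qed.

Lemma L1_cst c : L1 (fun=> c).
Proof. by apply: L1_bdd => //; exists `|c|. Qed.

Lemma Int_dct (F : nat -> T -> R) f g : (forall n, measurable_fun D (F n)) ->
  measurable_fun D f -> L1 g ->
  (forall x, D x -> F n x @[n --> \oo] --> f x) ->
  (forall n x, D x -> `|F n x| <= g x) ->
  Int (F n) @[n --> \oo] --> Int f.
Proof.
move=> mF mf Lg cF leF.
have := @dominated_convergence _ T R mu D mD (fun n => EFin \o F n) (EFin \o f) (EFin \o g).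
case=> //.
- by move=> n; exact/measurable_EFinP.
- exact/measurable_EFinP.
- apply: aeW => x Dx; apply: cvg_EFin; first exact: nearW.
  exact: cF.
- by apply: aeW => x n Dx /=; rewrite lee_fin; exact: leF.
move=> Lf _ H; apply: (@cvg_comp _ _ _ _ fine _ _ _ H).
rewrite -(fineK (integrable_fin_num mD Lf)); exact: fine_cvg.
Qed.

End L1.

(** * Symmetric sub-Markov kernels of finite rank *)

Section SeparableKernel.
Context {d : measure_display} {T : measurableType d} {R : realType}.
Variables (mu : {measure set T -> \bar R}) (D : set T).
Hypothesis mD : measurable D.
Hypothesis fD : (mu D < +oo)%E.
Implicit Types f g h A B : T -> R.
Local Notation L1 := (L1 mu D).
Local Notation Int := (Int mu D).

Definition bmeas h := measurable_fun D h /\ exists c : R, forall x, D x -> `|h x| <= c.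

Lemma bmeas_L1 h : bmeas h -> L1 h.
Proof. by move=> [mh bh]; exact: L1_bdd. Qed.

Lemma bmeasM_L1 h f : bmeas h -> L1 f -> L1 (fun x => f x * h x).
Proof.
move=> [mh bh] Lf; apply: (@L1_eq _ _ _ mu D mD (fun x => h x * f x)).
  by move=> x _; rewrite mulrC.
exact: L1_bddM.
Qed.

Lemma bmeas_cst c : bmeas (fun=> c).
Proof. by split=> //; exists `|c|. Qed.

Lemma bmeasD f g : bmeas f -> bmeas g -> bmeas (fun x => f x + g x).
Proof.
move=> [mf [cf hf]] [mg [cg hg]]; split; first exact: measurable_funD.
exists (cf + cg) => x Dx; apply: le_trans (ler_normD _ _) _.
by apply: lerD; [exact: hf|exact: hg].
Qed.

Lemma bmeasM f g : bmeas f -> bmeas g -> bmeas (fun x => f x * g x).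
Proof.
move=> [mf [cf hf]] [mg [cg hg]]; split; first exact: measurable_funM.
exists (cf * cg) => x Dx; rewrite normrM; apply: ler_pM => //.
  exact: hf.
exact: hg.
Qed.

Lemma bmeas_eq f g : (forall x, D x -> f x = g x) -> bmeas f -> bmeas g.
Proof.
move=> fg [mf [c hc]]; split.
  by apply: eq_measurable_fun mf => x; rewrite inE; exact: fg.
by exists c => x Dx; rewrite -fg// hc.
Qed.

Lemma bmeas_sum (I : Type) (s : seq I) (P : pred I) (F : I -> T -> R) :
  (forall i, P i -> bmeas (F i)) -> bmeas (fun x => \sum_(i <- s | P i) F i x).
Proof.
move=> LF; elim: s => [|i s IH].
  by apply: bmeas_eq (bmeas_cst 0) => x _; rewrite big_nil.
case: (boolP (P i)) => Pi.
  by apply: bmeas_eq (bmeasD (LF i Pi) IH) => x _; rewrite big_cons Pi.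
by apply: bmeas_eq IH => x _; rewrite big_cons (negbTE Pi).
Qed.

Definition separable (K : T -> T -> R) := exists (I : finType) (a b : I -> T -> R),
  [/\ forall i, bmeas (a i), forall i, bmeas (b i) &
      forall x y, K x y = \sum_i a i x * b i y].

Definition op (K : T -> T -> R) f x := Int (fun y => f y * K x y).

Lemma separable_swap K : separable K -> separable (fun x y => K y x).
Proof.
move=> [I [a [b [Ha Hb HK]]]]; exists I, b, a; split=> // x y.
by rewrite HK; apply: eq_bigr => i _; rewrite mulrC.
Qed.

Lemma op_sum K (I : finType) (a b : I -> T -> R) f x : (forall i, bmeas (b i)) ->
  (forall x y, K x y = \sum_i a i x * b i y) -> L1 f ->
  op K f x = \sum_i a i x * Int (fun y => f y * b i y).
Proof.
move=> Hb HK Lf; rewrite /op.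
under eq_bigr => i _ do (rewrite -(IntZ mD); last exact: bmeasM_L1).
rewrite -(Int_sum mD); last by move=> i _; apply: L1Z => //; exact: bmeasM_L1.
apply: Int_eq => y _; rewrite HK mulr_sumr; apply: eq_bigr => i _.
by rewrite mulrCA.
Qed.

Lemma op_bmeas K f : separable K -> L1 f -> bmeas (op K f).
Proof.
move=> [I [a [b [Ha Hb HK]]]] Lf.
apply: (@bmeas_eq (fun x => \sum_i a i x * Int (fun y => f y * b i y))).
  by move=> x _; rewrite (op_sum _ Hb HK Lf).
by apply: bmeas_sum => i _; apply: bmeasM => //; exact: bmeas_cst.
Qed.

Lemma separable_bmeas K x : separable K -> bmeas (K x).
Proof.
move=> [I [a [b [Ha Hb HK]]]].
apply: (@bmeas_eq (fun y => \sum_i a i x * b i y)) => [y _|]; first by rewrite HK.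
by apply: bmeas_sum => i _; apply: bmeasM => //; exact: bmeas_cst.
Qed.

(** Both sides expand to the sum over [i] of a product of two single integrals. *)
Lemma op_swap K f g : separable K -> L1 f -> L1 g ->
  Int (fun x => g x * op K f x) = Int (fun y => f y * op (fun x y => K y x) g y).
Proof.
move=> [I [a [b [Ha Hb HK]]]] Lf Lg.
have HK' x y : K y x = \sum_i b i x * a i y.
  by rewrite HK; apply: eq_bigr => i _; rewrite mulrC.
under Int_eq => x Dx do rewrite (op_sum _ Hb HK Lf) mulr_sumr.
under [RHS]Int_eq => x Dx do rewrite (op_sum _ Ha HK' Lg) mulr_sumr.
rewrite !(Int_sum mD); last 2 first.
- move=> i _; apply: bmeasM_L1 => //; apply: bmeasM => //; exact: bmeas_cst.
- move=> i _; apply: bmeasM_L1 => //; apply: bmeasM => //; exact: bmeas_cst.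
apply: eq_bigr => i _.
transitivity (Int (fun y => f y * b i y) * Int (fun x => g x * a i x)).
  rewrite -(IntZ mD); last exact: bmeasM_L1.
  by apply: Int_eq => x _; ring.
rewrite mulrC -(IntZ mD); last exact: bmeasM_L1.
by apply: Int_eq => x _; ring.
Qed.

(** The mass is only bounded by 1, because a convolution kernel restricted to a cube loses mass near
    the boundary. *)
Definition submarkov (K : T -> T -> R) := [/\ separable K,
  forall x y, D x -> D y -> 0 <= K x y,
  forall x y, K x y = K y x &
  forall x, D x -> Int (K x) <= 1].

Lemma op_ge0 K f x : submarkov K -> (forall x, D x -> 0 <= f x) -> D x -> 0 <= op K f x.
Proof.
move=> [_ K0 _ _] f0 Dx; apply: Int_ge0 => y Dy.
by apply: mulr_ge0; [exact: f0|exact: K0].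
Qed.

(** The integral of [op K f] is its pairing with the constant 1; moving [K] to that side leaves [f]
    integrated against a function at most 1. *)
Lemma op_contraction K f : submarkov K -> L1 f -> (forall x, D x -> 0 <= f x) ->
  Int (op K f) <= Int f.
Proof.
move=> mK Lf f0; have [sK K0 symK K1] := mK.
have L := L1_cst mD fD 1.
have -> : Int (op K f) = Int (fun x => 1 * op K f x).
  by apply: Int_eq => x _; rewrite mul1r.
rewrite op_swap//; apply: Int_le => //.
  by apply: bmeasM_L1 => //; apply: op_bmeas => //; exact: separable_swap.
move=> y Dy; rewrite -[leRHS]mulr1 ler_wpM2l ?f0//.
apply: le_trans (K1 y Dy); rewrite /op.
rewrite le_eqVlt; apply/orP; left; apply/eqP; apply: Int_eq => x _.
by rewrite mul1r symK.
Qed.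

Lemma op_norm K f x : submarkov K -> L1 f -> D x -> `|op K f x| <= op K (fun y => `|f y|) x.
Proof.
move=> [sK K0 symK K1] Lf Dx; apply: le_trans (Int_abs mD _) _.
  exact/bmeasM_L1/Lf/separable_bmeas.
rewrite /op le_eqVlt; apply/orP; left; apply/eqP; apply: Int_eq => y Dy.
by rewrite normrM (ger0_norm (K0 _ _ Dx Dy)).
Qed.

Lemma op_contraction_norm K f : submarkov K -> L1 f ->
  Int (fun x => `|op K f x|) <= Int (fun x => `|f x|).
Proof.
move=> mK Lf; have sK : separable K by case: mK.
have La := L1_abs Lf.
apply: le_trans (op_contraction mK La _) => //.
apply: Int_le => //.
- by apply: L1_abs; apply: bmeas_L1; exact: op_bmeas.
- by apply: bmeas_L1; exact: op_bmeas.
- by move=> x Dx; exact: op_norm.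
Qed.

(** The bound by [A y + B x] survives integration against [K]: the part in [A] becomes [op K A],
    whose integral is contracted, and the part in [B] is multiplied by the mass of [K x], at most
    1. *)
Lemma op_tail K f g A B : submarkov K -> L1 f -> L1 g -> L1 A -> L1 B ->
  (forall y, D y -> 0 <= A y) -> (forall y, D y -> 0 <= B y) ->
  (forall x y, D x -> D y -> `|f y| * `|g x| <= A y + B x) ->
  Int (fun x => `|g x * op K f x|) <= Int A + Int B.
Proof.
move=> mK Lf Lg LA LB A0 B0 H; have [sK K0 symK K1] := mK.
have LopA : L1 (op K A) by apply: bmeas_L1; exact: op_bmeas.
have H1 x : D x -> `|g x * op K f x| <= op K A x + B x.
  move=> Dx; rewrite normrM.
  apply: (@le_trans _ _ (op K A x + B x * Int (K x))); last first.
    by rewrite lerD2l -[leRHS]mulr1 ler_wpM2l ?B0// K1.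
  apply: le_trans (ler_wpM2l (normr_ge0 _) (op_norm mK Lf Dx)) _.
  have bK := separable_bmeas x sK.
  rewrite /op -(IntZ mD (B x)); last exact: bmeas_L1.
  rewrite -(IntZ mD `|g x|); last by apply: bmeasM_L1 => //; exact: L1_abs.
  rewrite -(IntD mD); [|exact: bmeasM_L1|exact/L1Z/bmeas_L1].
  apply: Int_le => //.
  - by apply: L1Z => //; apply: bmeasM_L1 => //; exact: L1_abs.
  - by apply: L1D => //; [exact: bmeasM_L1|apply: L1Z => //; exact: bmeas_L1].
  - move=> y Dy; rewrite mulrA -mulrDl ler_wpM2r ?K0//.
    by rewrite mulrC; exact: H.
have Lgo : L1 (fun x => g x * op K f x).
  by apply: bmeasM_L1 => //; exact: op_bmeas.
apply: (@le_trans _ _ (Int (fun x => op K A x + B x))).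
  by apply: Int_le => //; [exact: L1_abs|exact: L1D].
by rewrite (IntD mD)// lerD2r; exact: op_contraction.
Qed.

(* Uniform integrability of [f y * g x] in the product; it is the form in which
   Hoelder duality of [f] and [g] is used. *)
Definition dual_pair f g := [/\ L1 f, L1 g & forall e : R, 0 < e ->
  exists (M : R) (A B : T -> R), [/\ L1 A, L1 B, forall x, D x -> 0 <= A x /\ 0 <= B x,
    Int A + Int B <= e &
    forall x y, D x -> D y -> M < `|g x| -> `|f y| * `|g x| <= A y + B x]].

Lemma dual_pair_L1 f g : dual_pair f g -> L1 (fun x => g x * f x).
Proof.
move=> [Lf Lg /(_ 1 ltr01)[M [A [B [LA LB AB0 _ H]]]]].
apply: (@L1_le _ _ _ mu D mD _ (fun x => `|M| * `|f x| + (A x + B x))).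
- by apply: measurable_funM; [exact: L1_meas Lg|exact: L1_meas Lf].
- move=> x Dx; have [A0 B0] := AB0 x Dx.
  rewrite [leRHS]ger0_norm ?addr_ge0 ?mulr_ge0//.
  have [gM|gM] := leP `|g x| M.
    rewrite normrM; apply: (@le_trans _ _ (`|M| * `|f x|)).
      by rewrite ler_wpM2r// (le_trans gM)// ler_norm.
    by rewrite lerDl addr_ge0.
  rewrite normrM mulrC; apply: le_trans (H x x Dx Dx gM) _.
  by rewrite lerDr mulr_ge0.
- apply: L1D => //; last exact: L1D.
  by apply: L1Z => //; exact: L1_abs.
Qed.

(** [g] is cut at a level [M]. Where [|g| <= M] the error is at most [M] times the L^1 error of
    mollification; where [|g| > M] the mollified term and the limit term are each at most the
    integral of [A + B]. Each of the three pieces receives e/3. *)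
Lemma dual_pair_cvg (K : nat -> T -> T -> R) f g : (forall n, submarkov (K n)) ->
  Int (fun x => `|op (K n) f x - f x|) @[n --> \oo] --> 0 ->
  dual_pair f g ->
  Int (fun x => g x * op (K n) f x) @[n --> \oo] --> Int (fun x => g x * f x).
Proof.
move=> mK cK dp; have Lgf := dual_pair_L1 dp; case: dp => Lf Lg dp.
apply/cvgrPdist_le => e e0.
have e3 : 0 < e / 3 by rewrite divr_gt0.
have [M0 [A [B [LA LB AB0 IAB H0]]]] := dp _ e3.
(* The level is enlarged to be positive, since it becomes a divisor; the tail bound persists at a
   higher level. *)
set M := `|M0| + 1; have Mgt0 : 0 < M by rewrite ltr_wpDl.
have H x y : D x -> D y -> M < `|g x| -> `|f y| * `|g x| <= A y + B x.
  move=> Dx Dy Mg; apply: H0 => //; apply: le_lt_trans Mg.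
  by rewrite /M (le_trans (ler_norm _))// lerDl.
have eM : 0 < e / 3 / M by rewrite divr_gt0.
near=> n.
have small : Int (fun x => `|op (K n) f x - f x|) <= e / 3 / M.
  near: n; move/cvgrPdist_le : cK => /(_ _ eM); apply: filterS => n.
  by rewrite sub0r normrN ger0_norm//; apply: Int_ge0.
have sK : separable (K n) by case: (mK n).
have Lop : L1 (op (K n) f) by apply: bmeas_L1; exact: op_bmeas.
have Lgo : L1 (fun x => g x * op (K n) f x) by apply: bmeasM_L1 => //; exact: op_bmeas.
pose gM x := if M < `|g x| then g x else 0.
have mgM : measurable_fun D gM.
  apply: measurable_fun_if => //.
    apply: measurable_fun_ltr => //.
    by apply: measurableT_comp => //; exact: L1_meas Lg.
  by apply: (measurable_funS mD) (L1_meas Lg); exact: subIsetl.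
have LgM : L1 gM.
  apply: L1_le Lg => // x Dx; rewrite /gM; case: ifP => // _.
  by rewrite normr0.
have Hg x y : D x -> D y -> `|f y| * `|gM x| <= A y + B x.
  move=> Dx Dy; rewrite /gM; case: ifP => Mg; first exact: H.
  by rewrite normr0 mulr0 addr_ge0//; [case: (AB0 y Dy)|case: (AB0 x Dx)].
have A0 y : D y -> 0 <= A y by case/AB0.
have B0 y : D y -> 0 <= B y by case/AB0.
have T1 := op_tail (mK n) Lf LgM LA LB A0 B0 Hg.
have LAB : L1 (fun x => A x + B x) by exact: L1D.
have LgMf : L1 (fun x => gM x * f x).
  apply: (L1_le mD _ _ LAB).
    by apply: measurable_funM => //; exact: L1_meas Lf.
  move=> x Dx; rewrite [leRHS]ger0_norm ?addr_ge0 ?A0 ?B0// normrM mulrC.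
  exact: Hg.
have T2 : Int (fun x => `|gM x * f x|) <= e / 3.
  apply: le_trans IAB; rewrite -(IntD mD)//.
  apply: Int_le => //; first exact: L1_abs.
  by move=> x Dx; rewrite normrM mulrC; exact: Hg.
have LgMo : L1 (fun x => gM x * op (K n) f x) by apply: bmeasM_L1 => //; exact: op_bmeas.
rewrite -(IntB mD)//.
have Lsub : L1 (fun x => op (K n) f x - f x) by exact: L1B.
apply: le_trans (Int_abs mD _) _; first exact: L1B.
apply: (@le_trans _ _ (Int (fun x => (M * `|op (K n) f x - f x| + `|gM x * op (K n) f x|)
    + `|gM x * f x|))).
  apply: Int_le => //.
  - by apply: L1_abs; exact: L1B.
  - apply: L1D => //; last exact: L1_abs.
    by apply: L1D => //; [apply: L1Z => //; exact: L1_abs|exact: L1_abs].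
  - move=> x Dx; rewrite /gM; case: ifP => Mg.
      apply: le_trans (ler_normB _ _) _; rewrite addrC lerD2r.
      by rewrite lerDr mulr_ge0// ltW.
    rewrite !mul0r normr0 !addr0 -mulrBr normrM distrC ler_wpM2r//.
    by rewrite leNgt Mg.
have LMo : L1 (fun x => M * `|op (K n) f x - f x|) by apply: L1Z => //; exact: L1_abs.
rewrite (IntD mD); [|apply: L1D => //; exact: L1_abs|exact: L1_abs].
rewrite (IntD mD)//; last exact: L1_abs.
rewrite (IntZ mD); last exact: L1_abs.
have S : M * Int (fun x => `|op (K n) f x - f x|) <= e / 3.
  by rewrite mulrC -ler_pdivlMr.
have T1' := le_trans T1 IAB.
by apply: le_trans (lerD (lerD S T1') T2) _; lra.
Unshelve. all: by end_near. Qed.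

End SeparableKernel.

Section DualPairs.
Context {d : measure_display} {T : measurableType d} {R : realType}.
Variables (mu : {measure set T -> \bar R}) (D : set T).
Hypothesis mD : measurable D.
Implicit Types f g h : T -> R.
Local Notation L1 := (L1 mu D).
Local Notation Int := (Int mu D).
Local Notation dual_pair := (dual_pair mu D).

Lemma measurable_cutoff M g h : measurable_fun D g -> measurable_fun D h ->
  measurable_fun D (fun x => if M < `|g x| then h x else 0).
Proof.
move=> mg mh; apply: measurable_fun_if => //.
  apply: measurable_fun_ltr => //.
  exact: measurableT_comp.
by apply: (measurable_funS mD) mh; exact: subIsetl.
Qed.

(** Dominated convergence: [g] takes finite values, so at each point the condition n < |g| fails for
    large n. *)
Lemma L1_tail g h (e : R) : measurable_fun D g -> L1 h -> (forall x, D x -> 0 <= h x) ->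
  0 < e -> exists2 M : R, 0 <= M & Int (fun x => if M < `|g x| then h x else 0) <= e.
Proof.
move=> mg Lh h0 e0; have mh := L1_meas Lh.
have /cvgrPdist_le/(_ e e0)[n _ /(_ n)] : Int (fun x => if n%:R < `|g x| then h x else 0)
  @[n --> \oo] --> Int (fun=> 0).
  apply: (@Int_dct _ _ _ mu D mD _ _ h) => //.
  - by move=> n; exact: measurable_cutoff.
  - move=> x Dx; apply: cvg_near_cst; near=> n; rewrite ifF//.
    apply/negbTE; rewrite -leNgt; near: n; exact: nbhs_infty_ger.
  - move=> n x Dx; case: ifP => _; first by rewrite ger0_norm// h0.
    by rewrite normr0 h0.
move=> /(_ (leqnn _)); rewrite (Int0 mu mD) sub0r normrN => H.
by exists n%:R => //; exact: le_trans (ler_norm _) H.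
Unshelve. all: by end_near. Qed.

(** The choice is [A = 0] and [B] equal to [c] times the tail of [|g|], with [c] a positive bound of
    [|f|]. *)
Lemma dual_pair_bdd f g : measurable_fun D f ->
  (exists c : R, forall x, D x -> `|f x| <= c) -> L1 f -> L1 g -> dual_pair f g.
Proof.
move=> mf [c0 hc0] Lf Lg; pose c := `|c0| + 1.
have c_gt0 : 0 < c by rewrite /c ltr_wpDl.
have hc x : D x -> `|f x| <= c.
  move=> Dx; apply: le_trans (hc0 x Dx) _; rewrite /c.
  by apply: le_trans (ler_norm _) _; rewrite lerDl.
split=> // e e0.
have La := L1_abs Lg.
have ec : 0 < e / c by rewrite divr_gt0.
have [M M0 HM] := @L1_tail g (fun x => `|g x|) (e / c) (L1_meas Lg) La (fun _ _ => normr_ge0 _) ec.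
have LB : L1 (fun x => if M < `|g x| then `|g x| else 0).
  apply: (L1_le mD _ _ La); first exact: measurable_cutoff (L1_meas Lg) (L1_meas La).
  by move=> x Dx; case: ifP => // _; rewrite normr0.
exists M, (fun=> 0), (fun x => c * (if M < `|g x| then `|g x| else 0)); split => //.
- exact: L1_0.
- exact: L1Z.
- by move=> x Dx; split=> //; apply: mulr_ge0; [exact: ltW|case: ifP].
- by rewrite (Int0 mu mD) add0r (IntZ mD)// mulrC -ler_pdivlMr.
- by move=> x y Dx Dy -> ; rewrite add0r ler_wpM2r// hc.
Qed.

(** Young's inequality for [l * |f|] and [|g| / l]. The parameter [l] is fixed first, small enough
    for the part in [f] to have integral at most e/2; then [M] is taken so large that the tail of
    [|g|^q], in spite of its factor l^(-q), has integral at most e/2. *)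
Lemma dual_pair_pow (p q : R) f g : 0 < p -> 0 < q -> p^-1 + q^-1 = 1 ->
  L1 f -> L1 g -> L1 (fun x => `|f x| `^ p) -> L1 (fun x => `|g x| `^ q) ->
  dual_pair f g.
Proof.
move=> p0 q0 pq Lf Lg Lfp Lgq; split=> // e e0.
set F := Int (fun x => `|f x| `^ p).
have F0 : 0 <= F by apply: Int_ge0 => x _; exact: powR_ge0.
have e2 : 0 < e / 2 by rewrite divr_gt0.
pose l := (e / 2 * p / (F + 1)) `^ p^-1.
have F1 : 0 < F + 1 by rewrite ltr_wpDl.
have l0 : 0 < l by rewrite powR_gt0// divr_gt0// mulr_gt0.
have lp : l `^ p = e / 2 * p / (F + 1).
  by rewrite -powRrM mulVf ?gt_eqF// powRr1// ltW// divr_gt0// mulr_gt0.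
have lq : 0 < l `^ q by exact: powR_gt0.
have elq : 0 < e / 2 * q * l `^ q by rewrite !mulr_gt0.
have [M M0 HM] := @L1_tail g (fun x => `|g x| `^ q) (e / 2 * q * l `^ q) (L1_meas Lg)
  Lgq (fun _ _ => powR_ge0 _ _) elq.
have LB : L1 (fun x => if M < `|g x| then `|g x| `^ q else 0).
  apply: (L1_le mD _ _ Lgq); first exact: measurable_cutoff (L1_meas Lg) (L1_meas Lgq).
  by move=> x Dx; case: ifP => // _; rewrite normr0.
exists M, (fun x => l `^ p / p * `|f x| `^ p),
  (fun x => (l `^ q)^-1 / q * (if M < `|g x| then `|g x| `^ q else 0)); split => //.
- exact: L1Z.
- exact: L1Z.
- move=> x Dx; split; first by rewrite mulr_ge0 ?powR_ge0// divr_ge0 ?powR_ge0// ltW.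
  rewrite mulr_ge0 ?divr_ge0 ?invr_ge0 ?powR_ge0 ?(ltW q0)//.
  by case: ifP => // _; exact: powR_ge0.
- rewrite !(IntZ mD)// -/F lp.
  apply: (@le_trans _ _ (e / 2 + e / 2)); last by rewrite -splitr.
  apply: lerD.
    rewrite (_ : _ * _ = e / 2 * (F / (F + 1))); last first.
      by field; rewrite !gt_eqF.
    rewrite -[leRHS]mulr1 ler_wpM2l ?(ltW e2)// ler_pdivrMr// mul1r.
    by rewrite lerDl.
  rewrite -invfM mulrC ler_pdivrMr ?mulr_gt0//.
  by apply: le_trans HM _; rewrite mulrAC mulrA.
- move=> x y Dx Dy ->.
  have := @conjugate_powR R (l * `|f y|) (`|g x| / l) p q.
  rewrite !mulr_ge0 ?invr_ge0 ?(ltW l0)// => /(_ isT isT p0 q0 pq) H.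
  rewrite (_ : `|f y| * `|g x| = l * `|f y| * (`|g x| / l)); last first.
    by field; rewrite gt_eqF.
  apply: le_trans H _; rewrite !powRM ?invr_ge0 ?(ltW l0)//.
  have -> : l^-1 `^ q = (l `^ q)^-1.
    by rewrite -powR_inv1 ?(ltW l0)// -powRrM mulN1r powRN.
  rewrite le_eqVlt; apply/orP; left; apply/eqP; field.
  by rewrite !gt_eqF.
Qed.

End DualPairs.

(** * From a generating family of sets to all integrable functions *)

Section ApproximateIdentity.
Context {d : measure_display} {T : measurableType d} {R : realType}.
Variables (mu : {measure set T -> \bar R}) (D : set T).
Hypothesis mD : measurable D.
Hypothesis fD : (mu D < +oo)%E.
Local Notation L1 := (L1 mu D).
Local Notation Int := (Int mu D).
Local Notation op := (op mu D).
Variable K : nat -> T -> T -> R.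
Hypothesis mK : forall n, submarkov mu D (K n).
Implicit Types f g : T -> R.

Definition op_cvg f := L1 f /\ Int (fun x => `|op (K n) f x - f x|) @[n --> \oo] --> 0.

Lemma op_L1 n f : L1 f -> L1 (op (K n) f).
Proof. by move=> Lf; apply: bmeas_L1 => //; apply: op_bmeas => //; case: (mK n). Qed.

Lemma opD n f g x : L1 f -> L1 g ->
  op (K n) (fun y => f y + g y) x = op (K n) f x + op (K n) g x.
Proof.
move=> Lf Lg; have sK : separable D (K n) by case: (mK n).
have bK := separable_bmeas x sK.
rewrite /op -(IntD mD); [|exact: bmeasM_L1|exact: bmeasM_L1].
by apply: Int_eq => y _; rewrite mulrDl.
Qed.

Lemma opZ n c f x : L1 f -> op (K n) (fun y => c * f y) x = c * op (K n) f x.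
Proof.
move=> Lf; have sK : separable D (K n) by case: (mK n).
have bK := separable_bmeas x sK.
rewrite /op -(IntZ mD); last exact: bmeasM_L1.
by apply: Int_eq => y _; rewrite mulrA.
Qed.

Lemma op_eq n f g x : (forall y, D y -> f y = g y) -> op (K n) f x = op (K n) g x.
Proof. by move=> fg; apply: Int_eq => y Dy; rewrite fg. Qed.

Let err n f := Int (fun x => `|op (K n) f x - f x|).

Let err_ge0 n f : 0 <= err n f.
Proof. exact: Int_ge0. Qed.

Let err_abs n f : L1 f -> L1 (fun x => `|op (K n) f x - f x|).
Proof. by move=> Lf; apply: L1_abs => //; apply: L1B => //; exact: op_L1. Qed.

Let errD n f g : L1 f -> L1 g -> err n (fun x => f x + g x) <= err n f + err n g.
Proof.
move=> Lf Lg; rewrite /err -(IntD mD); [|exact: err_abs|exact: err_abs].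
apply: Int_le => //.
- by apply: err_abs; exact: L1D.
- by apply: L1D => //; exact: err_abs.
- move=> x Dx; rewrite opD//; apply: le_trans (ler_normD _ _).
  by rewrite le_eqVlt; apply/orP; left; apply/eqP; congr (`|_|); ring.
Qed.

Let errZ n c f : L1 f -> err n (fun x => c * f x) = `|c| * err n f.
Proof.
move=> Lf; rewrite /err -(IntZ mD); last exact: err_abs.
by apply: Int_eq => x Dx; rewrite opZ// -mulrBr normrM.
Qed.

Let err_le n f : L1 f -> err n f <= 2 * Int (fun x => `|f x|).
Proof.
move=> Lf; have La := L1_abs Lf; have Lo := op_L1 n Lf.
have Loa := L1_abs Lo.
apply: (@le_trans _ _ (Int (fun x => `|op (K n) f x| + `|f x|))).
  apply: Int_le => //; [exact: err_abs|exact: L1D|].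
  by move=> x _; exact: ler_normB.
rewrite (IntD mD)// mulr2n mulrDl mul1r lerD2r.
exact: op_contraction_norm.
Qed.

Let err_eq n f g : (forall y, D y -> f y = g y) -> err n f = err n g.
Proof. by move=> fg; apply: Int_eq => x Dx; rewrite (op_eq n x fg) fg. Qed.

Let op_cvgP f : op_cvg f <-> L1 f /\ forall e : R, 0 < e -> \forall n \near \oo, err n f <= e.
Proof.
split=> -[Lf H]; split=> //.
  move=> e e0; move/cvgrPdist_le : H => /(_ e e0); apply: filterS => n.
  by rewrite sub0r normrN ger0_norm ?err_ge0.
apply/cvgrPdist_le => e e0; apply: filterS (H e e0) => n.
by rewrite sub0r normrN ger0_norm ?err_ge0.
Qed.

Lemma op_cvgD f g : op_cvg f -> op_cvg g -> op_cvg (fun x => f x + g x).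
Proof.
move=> /op_cvgP[Lf Hf] /op_cvgP[Lg Hg]; apply/op_cvgP; split; first exact: L1D.
move=> e e0; have e2 : 0 < e / 2 by rewrite divr_gt0.
near=> n; apply: le_trans (errD n Lf Lg) _; rewrite [e]splitr.
by apply: lerD; near: n; [exact: Hf|exact: Hg].
Unshelve. all: by end_near. Qed.

Lemma op_cvgZ c f : op_cvg f -> op_cvg (fun x => c * f x).
Proof.
move=> /op_cvgP[Lf Hf]; apply/op_cvgP; split; first exact: L1Z.
move=> e e0; have e2 : 0 < e / (`|c| + 1) by rewrite divr_gt0// ltr_wpDl.
near=> n; rewrite errZ//; apply: (@le_trans _ _ ((`|c| + 1) * err n f)).
  by rewrite ler_wpM2r ?err_ge0// lerDl.
rewrite mulrC -ler_pdivlMr; last by rewrite ltr_wpDl.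
by near: n; exact: Hf.
Unshelve. all: by end_near. Qed.

Lemma op_cvg_eq f g : (forall y, D y -> f y = g y) -> op_cvg f -> op_cvg g.
Proof.
move=> fg /op_cvgP[Lf Hf]; apply/op_cvgP; split; first exact: (L1_eq mD fg).
by move=> e e0; apply: filterS (Hf e e0) => n; rewrite (err_eq n fg).
Qed.

(** The operators are L^1 contractions, so the error of [f] exceeds that of [g] by at most twice
    their distance; e/3 for the distance and e/3 for the error of [g] add up to e. *)
Lemma op_cvg_lim f : L1 f -> (forall e : R, 0 < e ->
  exists2 g, op_cvg g & Int (fun x => `|f x - g x|) <= e) -> op_cvg f.
Proof.
move=> Lf H; apply/op_cvgP; split=> // e e0.
have e3 : 0 < e / 3 by rewrite divr_gt0.
have [g /op_cvgP[Lg Hg] fg] := H _ e3.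
have Lfg : L1 (fun x => f x - g x) by exact: L1B.
near=> n; rewrite (@err_eq n _ (fun x => (f x - g x) + g x)); last first.
  by move=> y _; rewrite subrK.
apply: le_trans (errD n Lfg Lg) _.
have h1 := err_le n Lfg.
have h2 : err n g <= e / 3 by near: n; exact: Hg.
by apply: le_trans (lerD (le_trans h1 (ler_wpM2l _ fg)) h2) _; lra.
Unshelve. all: by end_near. Qed.

Lemma op_cvg_sum (I : Type) (s : seq I) (F : I -> T -> R) :
  op_cvg (fun=> 0) -> (forall i, op_cvg (F i)) -> op_cvg (fun x => \sum_(i <- s) F i x).
Proof.
move=> H0 HF; elim: s => [|i s IH].
  by apply: op_cvg_eq H0 => x _; rewrite big_nil.
by apply: op_cvg_eq (op_cvgD (HF i) IH) => x _; rewrite big_cons.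
Qed.

Variable G : set (set T).
Hypothesis mG : @measurable _ T = <<s G >>.
Hypothesis GI : setI_closed G.
Hypothesis GK : forall A, G A -> op_cvg \1_A.
Hypothesis TK : op_cvg (fun=> 1).

Lemma indic_L1 A : measurable A -> L1 \1_A.
Proof.
move=> mA; apply: L1_bdd => //.
by exists 1 => x _; rewrite indicE; case: (x \in A); rewrite ?normr1 ?normr0.
Qed.

(** The sets whose indicators are approximated form a lambda-system: proper differences by
    linearity, increasing unions by L^1 limits. It contains the generating family [G], which is
    stable under intersection. *)
Lemma op_cvg_indic : forall A, measurable A -> op_cvg \1_A.
Proof.
pose P := [set A | measurable A /\ op_cvg (\1_A : T -> R)].
suff: @measurable _ T `<=` P by move=> H A /H[].
rewrite mG; apply: (lambda_system_subset GI) => //; last first.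
  move=> B GB; split; last exact: GK.
  by rewrite mG; exact: sub_sigma_algebra.
split => //.
- by split=> //; apply: op_cvg_eq TK => x _; rewrite indicE in_setT.
- move=> B A AB [mB HB] [mA HA]; split; first exact: measurableD.
  apply: op_cvg_eq (op_cvgD HB (op_cvgZ (-1) HA)) => x _.
  rewrite !indicE in_setD mulN1r.
  have [xA|xA] := boolP (x \in A); last by rewrite subr0 andbT.
  by rewrite (mem_set (AB x (set_mem xA))) subrr.
- move=> F ndF HF.
  have mF n : measurable (F n) by case: (HF n).
  have mU : measurable (\bigcup_k F k) by exact: bigcupT_measurable.
  split=> //; have LU := indic_L1 mU; apply: op_cvg_lim => // e e0.
  have : Int (fun x => `|\1_(\bigcup_k F k) x - \1_(F n) x|) @[n --> \oo] --> Int (fun=> 0).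
    apply: (@Int_dct _ _ _ mu D mD _ _ (fun=> 1)) => //.
    + move=> n; apply: measurableT_comp => //.
      by apply: measurable_funB; exact: measurable_indic.
    + exact: L1_cst.
    + move=> x Dx; have [[k _ Fk]|nU] := pselect ((\bigcup_k F k) x).
        apply: cvg_near_cst; near=> n.
        rewrite !indicE !mem_set ?subrr ?normr0//; last by exists k.
        have kn : (k <= n)%N by near: n; exact: nbhs_infty_ge.
        by have /subsetPset := ndF k n kn; exact.
      apply: cvg_near_cst; near=> n.
      rewrite !indicE !memNset ?subrr ?normr0// => Fn; apply: nU.
      by exists n.
    + move=> n x Dx; rewrite normr_id !indicE.
      by case: (_ \in _); case: (_ \in _); rewrite ?subrr ?subr0 ?sub0r ?normrN ?normr0 ?normr1.
  move/cvgrPdist_le => /(_ e e0)[n _ /(_ n (leqnn _))] /=.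
  rewrite (Int0 mu mD) sub0r normrN => Hn; exists (\1_(F n)); first by case: (HF n).
  exact: le_trans (ler_norm _) Hn.
Unshelve. all: by end_near. Qed.

Import HBSimple.

(** Simple functions are dense in L^1 and are finite combinations of indicators. *)
Lemma op_cvg_L1 f : L1 f -> op_cvg f.
Proof.
move=> Lf; apply: op_cvg_lim => // e e0.
have [g [Lg _ Hg]] := approximation_sfun_integrable mD Lf.
have Hc : forall n, op_cvg (g n : T -> R).
  move=> n.
  have [s Hs] : exists s : seq R,
      forall x, g n x = \sum_(y <- s) y * \1_(g n @^-1` [set y]) x.
    eexists => x; rewrite fimfunE fsbig_finite/=; last exact: fimfunP.
    by [].
  apply: (@op_cvg_eq (fun x => \sum_(y <- s) y * \1_(g n @^-1` [set y]) x)).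
    by move=> y _; rewrite -Hs.
  apply: op_cvg_sum; first by apply: op_cvg_eq (op_cvgZ 0 TK) => x _; rewrite mul0r.
  by move=> i; apply: op_cvgZ; exact: op_cvg_indic.
have Lfg : forall n, L1 (fun x => `|f x - g n x|).
  by move=> n; apply: L1_abs; apply: L1B => //; exact: Lg.
move/fine_cvgP : Hg => [_ /cvgrPdist_le/(_ e e0)[n _ /(_ n (leqnn _))]] /=.
rewrite sub0r normrN => Hn; exists (g n) => //.
apply: le_trans Hn; exact: ler_norm.
Qed.

End ApproximateIdentity.

(** * Cubes *)

Section Subset.
Context {d : measure_display} {T : measurableType d} {R : realType}.
Variable mu : {measure set T -> \bar R}.
Implicit Types (f : T -> R) (A B : set T).

Lemma L1_sub A B f : measurable A -> measurable B -> A `<=` B -> L1 mu B f -> L1 mu A f.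
Proof. by move=> mA mB AB; exact: integrableS. Qed.

Lemma Int_subset A B f : measurable A -> measurable B -> A `<=` B ->
  L1 mu B f -> (forall x, B x -> 0 <= f x) -> Int mu A f <= Int mu B f.
Proof.
move=> mA mB AB LB f0; have LA := L1_sub mA mB AB LB.
rewrite -lee_fin !Int_fin//; apply: ge0_subset_integral => //.
by apply/measurable_EFinP; exact: L1_meas LB.
Qed.

Lemma Int_indic A B f : Int mu A (fun x => \1_B x * f x) = Int mu (A `&` B) f.
Proof.
rewrite /Int Rintegral_mkcondr; apply: eq_Rintegral => x _.
by rewrite patchE indicE; case: (x \in B); rewrite ?mul1r ?mul0r.
Qed.

Lemma Int_setU A B f : measurable A -> measurable B -> [disjoint A & B] ->
  L1 mu (A `|` B) f -> Int mu (A `|` B) f = Int mu A f + Int mu B f.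
Proof. by move=> mA mB dAB Lf; exact: Rintegral_setU. Qed.

End Subset.

Section Cubes.
Context {R : realType} {m : nat}.
Local Notation rV := 'rV[R]_m.
Variable leb : {measure set (borel rV) -> \bar R}.
Hypothesis Hleb : is_lebesgue leb.
Implicit Types (x y : rV) (r : R).

Definition cube x r : set rV := [set y | forall k, `|y 0 k - x 0 k| < r].

Lemma cubeE x r : cube x r = oobox (x - const_mx r) (x + const_mx r).
Proof.
apply/seteqP; split=> y H k; move: (H k); rewrite !mxE.
  by rewrite ltr_norml => /andP[h1 h2]; apply/andP; split; lra.
by move=> /andP[h1 h2]; rewrite ltr_norml; apply/andP; split; lra.
Qed.

Lemma open_cube x r : open (cube x r).
Proof. by rewrite cubeE; exact: open_oobox. Qed.

Lemma measurable_cube x r : measurable (cube x r : set (borel rV)).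
Proof. by apply: borel_open; exact: open_cube. Qed.

Lemma cube_center x r : 0 < r -> cube x r x.
Proof. by move=> r0 k; rewrite subrr normr0. Qed.

Lemma le_cube x r r' : r <= r' -> cube x r `<=` cube x r'.
Proof. by move=> rr y H k; exact: lt_le_trans (H k) rr. Qed.

Lemma nbhs_cube x (A : set rV) : nbhs x A -> exists2 e, 0 < e & cube x e `<=` A.
Proof.
move=> /nbhs_box[e [e0 He]]; exists e => // y Hy; apply: He => k.
by rewrite distrC; exact: Hy.
Qed.

Lemma leb_cube_lty x r : (leb (cube x r) < +oo)%E.
Proof.
have [r0|r0] := leP 0 r; last first.
  (* In dimension zero a cube of negative radius is not empty: the condition on the coordinates is
     vacuous. *)
  have [m0|m0] := posnP m.
    apply: (@le_lt_trans _ _ (leb (hobox x x))); last first.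
      by rewrite [X in (X < _)%E]Hleb// ltry.
    apply: le_measure; rewrite ?inE; [exact: measurable_cube|exact: measurable_hobox|].
    by move=> y _ k; exfalso; case: k => k; rewrite m0.
  rewrite (_ : cube x r = set0) ?measure0// -subset0 => y /(_ (Ordinal m0)) H.
  by have := le_lt_trans (normr_ge0 _) H; rewrite ltNge ltW.
apply: (@le_lt_trans _ _ (leb (hobox (x - const_mx r) (x + const_mx r)))); last first.
  by rewrite [X in (X < _)%E]Hleb ?ltry// => k; rewrite !mxE; lra.
apply: le_measure; rewrite ?inE; [exact: measurable_cube|exact: measurable_hobox|].
by rewrite cubeE => y H k; have /andP[h1 h2] := H k; rewrite (ltW h1).
Qed.

Lemma leb_cube_gt0 x r : 0 < r -> (0 < leb (cube x r))%E.
Proof.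
move=> r0.
apply: (@lt_le_trans _ _ (leb (hobox x (x + const_mx r)))).
  rewrite [X in (_ < X)%E]Hleb; last by move=> k; rewrite !mxE; lra.
  by rewrite lte_fin; apply: prodr_gt0 => k _; rewrite !mxE addrAC subrr add0r.
apply: le_measure; rewrite ?inE; [exact: measurable_hobox|exact: measurable_cube|].
move=> y H k; move: (H k); rewrite !mxE => /andP[h1 h2].
by rewrite ltr_norml; apply/andP; split; lra.
Qed.

Lemma measurable_shift (c : rV) : measurable_fun setT (fun x : borel rV => x + c : borel rV).
Proof.
apply: (@borel_continuous _ _ setT); first exact: openT.
by move=> x _; apply: continuousD; [exact: cvg_id|exact: cst_continuous].
Qed.

(** The translated measure gives every box its volume, and this determines Lebesgue measure. *)
Lemma leb_shift (c : rV) (A : set rV) : measurable (A : set (borel rV)) ->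
  leb [set x : rV | A (x + c)] = leb A.
Proof.
move=> mA.
pose mphi := measurable_shift c.
pose mphi_mixin := isMeasurableFun.Build _ _ _ _ _ mphi.
pose phi : {mfun borel rV >-> borel rV} := HB.pack (fun x : borel rV => x + c : borel rV)
  mphi_mixin.
apply: (@lebesgue_unique R m (pushforward leb phi) leb) => // a b ab.
rewrite [LHS](_ : _ = leb (hobox (a - c) (b - c))).
  rewrite [LHS]Hleb; last by move=> k; rewrite !mxE lerD2r.
  by congr EFin; apply: eq_bigr => k _; rewrite !mxE; ring.
rewrite /pushforward; congr (leb _); apply/seteqP; split=> x /= H k; have := H k.
  by rewrite !mxE => /andP[h1 h2]; apply/andP; split; lra.
by rewrite !mxE => /andP[h1 h2]; apply/andP; split; lra.
Qed.

Lemma Int_shift (c : rV) (A : set rV) (g : rV -> R) : measurable (A : set (borel rV)) ->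
  measurable_fun (A : set (borel rV)) (g : borel rV -> R) ->
  (forall x, A x -> 0 <= g x) ->
  Int leb [set x : rV | A (x + c)] (fun x => g (x + c)) = Int leb A g.
Proof.
move=> mA mg g0.
pose mphi := measurable_shift c.
pose mphi_mixin := isMeasurableFun.Build _ _ _ _ _ mphi.
pose phi : {mfun borel rV >-> borel rV} := HB.pack (fun x : borel rV => x + c : borel rV)
  mphi_mixin.
have H : (\int[pushforward leb phi]_(y in A) (EFin \o g) y
    = \int[leb]_(x in phi @^-1` A) ((EFin \o g) \o phi) x)%E.
  apply: (@ge0_integral_pushforward _ _ _ _ R phi mphi leb A (EFin \o g) mA).
    exact/measurable_EFinP.
  by move=> x; rewrite inE => Ax; rewrite lee_fin g0.
 rewrite /Int /Rintegral; congr fine.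
rewrite -[LHS]H; apply: eq_measure_integral => B mB _.
exact: leb_shift.
Qed.

Lemma ccube_compact x r : compact [set y : rV | forall k, `|y 0 k - x 0 k| <= r].
Proof.
have := @rV_compact R m (fun k => `[x 0 k - r, x 0 k + r]%classic) (fun k =>
  @segment_compact R _ _).
congr compact; apply/seteqP; split=> y /= H k; move: (H k); rewrite /= in_itv/=.
  by move=> /andP[h1 h2]; rewrite ler_norml; apply/andP; split; lra.
by rewrite ler_norml => /andP[h1 h2]; apply/andP; split; lra.
Qed.

Lemma bmeas_cube x r (f : rV -> R) : (forall y, {for y, continuous f}) ->
  bmeas (cube x r : set (borel rV)) (f : borel rV -> R).
Proof.
move=> cf; split.
  by apply: borel_continuous_real => //; exact: open_cube.
have cK : compact (f @` [set y : rV | forall k, `|y 0 k - x 0 k| <= r]).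
  apply: continuous_compact; last exact: ccube_compact.
  by apply: continuous_subspaceT => y; exact: cf.
have [M [Mr HM]] := compact_bounded cK.
exists (M + 1) => y Hy; apply: (HM (M + 1)); first by rewrite ltrDl.
by exists y => // k; exact/ltW/Hy.
Qed.

End Cubes.

(** * Landau kernels *)

Section SmoothSeparable.
Context {R : realType} {m : nat}.
Local Notation rV := 'rV[R]_m.
Implicit Types (K L : rV -> rV -> R) (x y : rV) (f g : rV -> R).

Lemma smooth_cont f x : smooth setT f -> {for x, continuous f}.
Proof. by move=> sf; exact: (@Ck_cont _ _ 0 setT f x (sf 0)). Qed.

Lemma smooth_diff (V : set rV) f x : smooth V f -> V x -> differentiable f x.
Proof. by move=> sf Vx; exact: (sf 1).1. Qed.

Lemma smooth_pd (V : set rV) k f : smooth V f -> smooth V (pd k f).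
Proof. by move=> sf r; exact: (sf r.+1).2. Qed.

Definition smooth_separable K := exists (I : finType) (a b : I -> rV -> R),
  [/\ forall i, smooth setT (a i), forall i, smooth setT (b i) &
      forall x y, K x y = \sum_i a i x * b i y].

Lemma ssep_l f : smooth setT f -> smooth_separable (fun x _ => f x).
Proof.
move=> sf; exists unit, (fun=> f), (fun=> (fun=> 1)); split => //.
  by move=> _ r; exact: Ck_cst.
by move=> x y; rewrite (big_pred1 tt) ?mulr1// => -[].
Qed.

Lemma ssep_swap K : smooth_separable K -> smooth_separable (fun x y => K y x).
Proof.
move=> [I [a [b [Ha Hb HK]]]]; exists I, b, a; split=> // x y.
by rewrite HK; apply: eq_bigr => i _; rewrite mulrC.
Qed.

Lemma ssep_r f : smooth setT f -> smooth_separable (fun _ y => f y).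
Proof. by move=> sf; exact: ssep_swap (ssep_l sf). Qed.

Lemma ssepD K L : smooth_separable K -> smooth_separable L ->
  smooth_separable (fun x y => K x y + L x y).
Proof.
move=> [I [a [b [Ha Hb HK]]]] [J [a' [b' [Ha' Hb' HL]]]].
exists (I + J)%type, (fun i => match i with inl i => a i | inr j => a' j end),
  (fun i => match i with inl i => b i | inr j => b' j end); split.
- by case.
- by case.
- by move=> x y; rewrite big_sumType HK HL.
Qed.

Lemma ssepM K L : smooth_separable K -> smooth_separable L ->
  smooth_separable (fun x y => K x y * L x y).
Proof.
move=> [I [a [b [Ha Hb HK]]]] [J [a' [b' [Ha' Hb' HL]]]].
exists (I * J)%type, (fun i x => a i.1 x * a' i.2 x), (fun i y => b i.1 y * b' i.2 y); split.
- by move=> i r; apply: CkM; [exact: openT|exact: Ha|exact: Ha'].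
- by move=> i r; apply: CkM; [exact: openT|exact: Hb|exact: Hb'].
- move=> x y; rewrite HK HL big_distrlr/=.
  by rewrite pair_big/=; apply: eq_bigr => -[i j] _ /=; ring.
Qed.

Lemma ssep_cst (c : R) : smooth_separable (fun _ _ => c).
Proof. by apply: (@ssep_l (fun=> c)) => r; exact: Ck_cst. Qed.

Lemma ssep_sum (J : Type) (s : seq J) (K : J -> rV -> rV -> R) :
  (forall j, smooth_separable (K j)) -> smooth_separable (fun x y => \sum_(j <- s) K j x y).
Proof.
move=> HK; elim: s => [|j s IH].
  by under eq_fun do under eq_fun do rewrite big_nil; exact: ssep_cst.
by under eq_fun do under eq_fun do rewrite big_cons; exact: ssepD.
Qed.

Lemma ssepX K n : smooth_separable K -> smooth_separable (fun x y => K x y ^+ n).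
Proof.
move=> HK; elim: n => [|n IH].
  by under eq_fun do under eq_fun do rewrite expr0; exact: ssep_cst.
by under eq_fun do under eq_fun do rewrite exprS; exact: ssepM.
Qed.

Lemma pd_sumM (I : Type) (s : seq I) k (a : I -> rV -> R) (c : I -> R) x :
  (forall i, smooth setT (a i)) ->
  pd k (fun z => \sum_(i <- s) a i z * c i) x = \sum_(i <- s) pd k (a i) x * c i.
Proof.
move=> Ha.
have di j : differentiable (fun z => a j z * c j) x.
  by apply: differentiableM => //; exact: (smooth_diff (Ha j)).
elim: s => [|i s IH].
  by under eq_fun do rewrite big_nil; rewrite pd_cst big_nil.
have ds : forall s', differentiable (fun z => \sum_(j <- s') a j z * c j) x.
  elim=> [|j s' IHs]; first by under eq_fun do rewrite big_nil; exact: differentiable_cst.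
  by under eq_fun do rewrite big_cons; exact: differentiableD.
under eq_fun do rewrite big_cons.
rewrite pdD// IH big_cons; congr (_ + _).
rewrite pdM//; last exact: (smooth_diff (Ha i)).
by rewrite pd_cst mulr0 addr0.
Qed.

Lemma ssep_pd k K : smooth_separable K ->
  smooth_separable (fun x y => pd k (fun z => K z y) x).
Proof.
move=> [I [a [b [Ha Hb HK]]]]; exists I, (fun i => pd k (a i)), b; split=> //.
  by move=> i; exact: smooth_pd.
move=> x y; rewrite -pd_sumM//; congr (pd k _ x).
by apply/funext => z; rewrite HK.
Qed.

Variable leb : {measure set (borel rV) -> \bar R}.
Hypothesis Hleb : is_lebesgue leb.
Variables (x0 : rV) (r : R).
Local Notation D := (cube x0 r).
Local Notation L1 := (L1 leb D).
Local Notation Int := (Int leb D).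
Local Notation op := (op leb D).

Lemma ssep_separable K : smooth_separable K -> separable (D : set (borel rV)) K.
Proof.
move=> [I [a [b [Ha Hb HK]]]]; exists I, a, b; split => // i.
  by apply: bmeas_cube => y; exact: smooth_cont.
by apply: bmeas_cube => y; exact: smooth_cont.
Qed.

Let mD := measurable_cube x0 r.
Let fD := leb_cube_lty Hleb x0 r.

(** [op K f] is a combination of the functions [a i] with constant coefficients, so it is
    differentiated by differentiating the [a i]. *)
Lemma smooth_op K f : smooth_separable K -> L1 f ->
  smooth setT (op K f) /\
  forall k x, pd k (op K f) x = op (fun x y => pd k (fun z => K z y) x) f x.
Proof.
move=> HK Lf; have HdK k := ssep_pd k HK.
case: HK => I [a [b [Ha Hb HK]]].
have bb i : bmeas (D : set (borel rV)) (b i) by apply: bmeas_cube => y; exact: smooth_cont.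
have opE : op K f = fun x => \sum_i a i x * Int (fun y => f y * b i y).
  by apply/funext => x; apply: op_sum.
split.
  rewrite opE => q; apply: Ck_sum; first exact: openT.
  by move=> i _; apply: CkM; [exact: openT|exact: Ha|exact: Ck_cst].
move=> k x.
rewrite opE pd_sumM//.
have -> : (fun x y => pd k (fun z => K z y) x) = (fun x y => \sum_i pd k (a i) x * b i y).
  apply/funext => y; apply/funext => z; rewrite -pd_sumM//; congr (pd k _ y).
  by apply/funext => w; rewrite HK.
by rewrite (op_sum mD x bb (fun x y => erefl) Lf).
Qed.

End SmoothSeparable.

Section Landau.
Context {R : realType} {m : nat}.
Local Notation rV := 'rV[R]_m.
Variable leb : {measure set (borel rV) -> \bar R}.
Hypothesis Hleb : is_lebesgue leb.
Variables (x0 : rV) (r : R).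
Hypothesis r0 : 0 < r.
Local Notation D := (cube x0 r).
(** The difference of two points of [D] lies in the cube [C] of radius [2 * r] around 0. *)
Let L := 2 * r.
Local Notation C := (cube (0 : rV) L).
(** On [C] the squares of the coordinates add up to at most m L^2; the extra 1 keeps [landau_base]
    strictly positive there, in dimension zero too. *)
Let w : R := (m.+1%:R * L ^+ 2)^-1.

Let L0 : 0 < L. Proof. by rewrite mulr_gt0. Qed.
Let w0 : 0 < w. Proof. by rewrite invr_gt0 mulr_gt0// exprn_gt0. Qed.

Definition landau_base (z : rV) : R := 1 - w * \sum_k z 0 k ^+ 2.
Local Notation q := landau_base.

Lemma landau_baseN z : q (- z) = q z.
Proof. by congr (1 - _ * _); apply: eq_bigr => k _; rewrite mxE sqrrN. Qed.

Lemma sum_sqr_cube (z : rV) e : 0 < e -> cube 0 e z -> \sum_k z 0 k ^+ 2 <= m%:R * e ^+ 2.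
Proof.
move=> e0 Hz; apply: (@le_trans _ _ (\sum_(k < m) e ^+ 2)); last first.
  by rewrite sumr_const card_ord mulr_natl.
apply: ler_sum => k _; rewrite -[z 0 k ^+ 2]real_normK ?num_real//.
rewrite ler_sqr ?nnegrE ?(ltW e0)//.
by have /ltW := Hz k; rewrite mxE subr0.
Qed.

Lemma landau_base_gt0 z : C z -> 0 < q z.
Proof.
move=> Cz; rewrite subr_gt0.
apply: le_lt_trans (ler_wpM2l (ltW w0) (sum_sqr_cube L0 Cz)) _.
rewrite /w mulrC ltr_pdivrMr ?mulr_gt0 ?exprn_gt0// mul1r.
by rewrite ltr_pM2r ?exprn_gt0// ltr_nat.
Qed.

Lemma smooth_landau_base : smooth setT q.
Proof.
move=> p; apply: CkB; [exact: openT|exact: Ck_cst|apply: CkZ; first exact: openT].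
apply: Ck_sum; first exact: openT.
by move=> k _; apply: Ck_exp; [exact: openT|exact: Ck_coord].
Qed.

Let smooth_q n : smooth setT (fun z => q z ^+ n).
Proof. by move=> p; apply: Ck_exp; [exact: openT|exact: smooth_landau_base]. Qed.

Let L1q n x e : L1 leb (cube x e) (fun z => q z ^+ n).
Proof.
apply: bmeas_L1; [exact: measurable_cube|exact: leb_cube_lty|].
by apply: bmeas_cube => y; exact: smooth_cont.
Qed.

(** The mass is taken over [C], where the base is positive. For [x] in [D] the differences [x - y]
    with [y] in [D] stay in [C], so the normalised kernel has mass at most 1 on [D]. *)
Definition landau_mass n := Int leb C (fun z => q z ^+ n).

(** [a e] bounds [landau_base] from above outside the cube of radius [e], and [b e] bounds it from
    below on the cube of radius e / (2 (m + 1)). *)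
Let a (e : R) := 1 - w * e ^+ 2.
Let b (e : R) := 1 - w * (m%:R * (e / (2 * m.+1%:R)) ^+ 2).

(** The smaller radius is chosen for this: m / (2 (m + 1))^2 < 1. The ratio of [a] to [b] is the
    rate of concentration. *)
Let b_gt_a e : 0 < e -> a e < b e.
Proof.
move=> e0; rewrite /a /b ltrD2l ltrN2 ltr_pM2l//.
rewrite expr_div_n mulrCA gtr_pMr ?exprn_gt0//.
rewrite ltr_pdivrMr ?exprn_gt0 ?mulr_gt0// mul1r exprMn.
have : (m%:R : R) < m.+1%:R by rewrite ltr_nat.
have : (0 : R) <= m%:R by [].
have : (1 : R) <= m.+1%:R by rewrite ler1n.
nra.
Qed.

Let e' (e : R) := e / (2 * m.+1%:R).

Let e'0 e : 0 < e -> 0 < e' e.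
Proof. by move=> e0; rewrite divr_gt0// mulr_gt0. Qed.

Let e'_le e : 0 < e -> e' e <= e.
Proof.
move=> e0; rewrite ler_pdivrMr ?mulr_gt0// ler_peMr ?(ltW e0)//.
by rewrite -natrM ler1n muln_gt0.
Qed.

Let b_gt0 e : 0 < e -> e <= L -> 0 < b e.
Proof.
move=> e0 eL; rewrite /b subr_gt0 /w mulrC ltr_pdivrMr ?mulr_gt0 ?exprn_gt0// mul1r.
have h : (e / (2 * m.+1%:R)) ^+ 2 <= L ^+ 2.
  by rewrite ler_sqr ?nnegrE ?(ltW L0) ?(ltW (e'0 e0))// (le_trans (e'_le e0)).
apply: (@le_lt_trans _ _ (m%:R * L ^+ 2)); first by rewrite ler_wpM2l.
by rewrite ltr_pM2r ?exprn_gt0// ltr_nat.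
Qed.

Let mass_ge n e : 0 < e -> e <= L ->
  b e ^+ n * fine (leb (cube 0 (e' e))) <= landau_mass n.
Proof.
move=> e0 eL; have mc := measurable_cube (0 : rV) (e' e).
apply: (@le_trans _ _ (Int leb (cube 0 (e' e)) (fun z => q z ^+ n))).
  rewrite -(@Rintegral_cst _ _ R leb _ mc); apply: Int_le => //.
    by apply: L1_cst => //; exact: leb_cube_lty.
  move=> z Hz; apply: lerXn2r; rewrite ?nnegrE ?(ltW (b_gt0 _ _))//.
    apply/ltW/landau_base_gt0; apply: le_cube Hz.
    exact: le_trans (e'_le e0) eL.
  rewrite /b /landau_base lerD2l lerN2 ler_pM2l//.
  exact: sum_sqr_cube (e'0 e0) Hz.
apply: Int_subset => //; first exact: measurable_cube.
  by apply: le_cube; exact: le_trans (e'_le e0) eL.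
by move=> z /landau_base_gt0/ltW ?; rewrite exprn_ge0.
Qed.

Let v_gt0 e : 0 < e -> 0 < fine (leb (cube (0 : rV) (e' e))).
Proof.
move=> e0; apply: fine_gt0; apply/andP; split; last exact: leb_cube_lty.
by apply: leb_cube_gt0 => //; exact: e'0.
Qed.

Lemma landau_mass_gt0 n : 0 < landau_mass n.
Proof.
apply: lt_le_trans (mass_ge n L0 (lexx _)).
by rewrite mulr_gt0 ?exprn_gt0 ?b_gt0 ?v_gt0.
Qed.

Definition landau n (x y : rV) : R := (landau_mass n)^-1 * q (x - y) ^+ n.

Lemma landau_sym n x y : landau n x y = landau n y x.
Proof. by rewrite /landau -landau_baseN opprB. Qed.

Lemma landau_ssep n : smooth_separable (landau n).
Proof.
apply: ssepM; first exact: ssep_cst.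
apply: ssepX; apply: (@ssepD _ _ (fun _ _ => 1) (fun x y => - (w * \sum_k (x - y) 0 k ^+ 2))).
  exact: ssep_cst.
under eq_fun do under eq_fun do rewrite -mulNr.
apply: ssepM; first exact: ssep_cst.
apply: ssep_sum => k; apply: ssepX.
under eq_fun do under eq_fun do rewrite !mxE.
apply: (@ssepD _ _ (fun x _ => x 0 k) (fun _ y => - y 0 k)).
  by apply: ssep_l => p; exact: Ck_coord.
by apply: ssep_r => p; apply: CkN; [exact: openT|exact: Ck_coord].
Qed.

Lemma cube_sub x y : D x -> D y -> C (x - y).
Proof.
move=> Dx Dy k; rewrite !mxE subr0.
rewrite (_ : _ - _ = (x 0 k - x0 0 k) - (y 0 k - x0 0 k)); last by ring.
by apply: le_lt_trans (ler_normB _ _) _; rewrite /L mulr2n mulrDl mul1r ltrD// ?Dx ?Dy.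
Qed.

Lemma landau_ge0 n x y : D x -> D y -> 0 <= landau n x y.
Proof.
move=> Dx Dy; rewrite mulr_ge0 ?invr_ge0 ?(ltW (landau_mass_gt0 _))//.
by rewrite exprn_ge0// ltW// landau_base_gt0//; exact: cube_sub.
Qed.

Let Int_ball n x e : e <= L -> Int leb (cube x e) (landau n x) =
  (landau_mass n)^-1 * Int leb (cube 0 e) (fun z => q z ^+ n).
Proof.
move=> eL; have me := measurable_cube (0 : rV) e.
rewrite -(@Int_shift R m leb Hleb (- x) (cube 0 e) (fun z => q z ^+ n) me); first last.
- by move=> z Hz; rewrite exprn_ge0// ltW// landau_base_gt0//; apply: le_cube Hz.
- exact: L1_meas (L1q n 0 e).
have -> : [set z : rV | cube 0 e (z - x)] = cube x e.
  by apply/seteqP; split=> z H k; have := H k; rewrite !mxE subr0.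
rewrite -IntZ.
- by apply: Int_eq => z _; rewrite landau_sym.
- exact: measurable_cube.
- apply: bmeas_L1; [exact: measurable_cube|exact: leb_cube_lty|].
  apply: bmeas_cube => y; apply: smooth_cont => p.
  apply: (@Ck_comp _ _ _ _ _ setT (fun z => z - x) (fun z => q z ^+ n)) => //.
  + exact: openT.
  + move=> l; under eq_fun do rewrite !mxE.
    by apply: CkD; [exact: openT|exact: Ck_coord|exact: Ck_cst].
  + exact: smooth_q.
Qed.

Let smooth_landau n x : smooth setT (landau n x).
Proof.
have [I [a' [b' [_ Hb HK]]]] := landau_ssep n.
move=> p; have -> : landau n x = fun y => \sum_i a' i x * b' i y by apply/funext => y.
apply: Ck_sum; first exact: openT.
by move=> i _; apply: CkM; [exact: openT|exact: Ck_cst|exact: Hb].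
Qed.

Let L1landau n x y e : L1 leb (cube y e) (landau n x).
Proof.
apply: bmeas_L1; [exact: measurable_cube|exact: leb_cube_lty|].
by apply: bmeas_cube => z; exact: smooth_cont.
Qed.

Lemma landau_submarkov n : submarkov leb D (landau n).
Proof.
split.
- exact: ssep_separable (landau_ssep n).
- exact: landau_ge0.
- exact: landau_sym.
- move=> x Dx; apply: (@le_trans _ _ (Int leb (cube x L) (landau n x))).
    apply: Int_subset => //; [exact: measurable_cube|exact: measurable_cube| |].
      by move=> y Dy k; have := cube_sub Dy Dx k; rewrite !mxE subr0.
    move=> y Hy; rewrite mulr_ge0 ?invr_ge0 ?(ltW (landau_mass_gt0 _))//.
    rewrite exprn_ge0// ltW// landau_base_gt0// => k; rewrite !mxE subr0 distrC.
    exact: Hy.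
  by rewrite Int_ball// mulVf// gt_eqF// landau_mass_gt0.
Qed.

(* Laplace's method: outside of a cube [q ^ n] is exponentially smaller than
   its total mass. *)
Lemma landau_concentration n x e : 0 < e -> e <= L ->
  1 - Int leb (cube x e) (landau n x) <=
  (a e / b e) ^+ n * (fine (leb C) / fine (leb (cube 0 (e' e)))).
Proof.
move=> e0 eL; rewrite Int_ball//.
have M0 := landau_mass_gt0 n.
have a0 : 0 <= a e.
  rewrite subr_ge0 /w mulrC ler_pdivrMr ?mulr_gt0 ?exprn_gt0// mul1r.
  apply: (@le_trans _ _ (L ^+ 2)); first by rewrite ler_sqr ?nnegrE ?(ltW e0) ?(ltW L0).
  by rewrite ler_peMl ?sqr_ge0// ler1n.
have mc : measurable (cube (0 : rV) e : set (borel rV)) := measurable_cube _ _.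
have mC : measurable (C : set (borel rV)) := measurable_cube _ _.
have mCc : measurable (C `\` cube 0 e : set (borel rV)) by exact: measurableD.
have CE : cube 0 e `|` (C `\` cube 0 e) = C.
  by rewrite setDUK//; exact: le_cube.
have dis : [disjoint cube (0 : rV) e & C `\` cube 0 e].
  by rewrite disj_set2E; apply/eqP; apply/seteqP; split=> // z [? []].
have S : landau_mass n = Int leb (cube 0 e) (fun z => q z ^+ n)
    + Int leb (C `\` cube 0 e) (fun z => q z ^+ n).
  by rewrite -(Int_setU mc mCc dis) CE//; exact: L1q.
have -> : 1 - (landau_mass n)^-1 * Int leb (cube 0 e) (fun z => q z ^+ n) =
    (landau_mass n)^-1 * Int leb (C `\` cube 0 e) (fun z => q z ^+ n).
  have -> : Int leb (C `\` cube 0 e) (fun z => q z ^+ n) =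
    landau_mass n - Int leb (cube 0 e) (fun z => q z ^+ n) by rewrite S addrC addKr.
  by rewrite mulrBr mulVf// gt_eqF.
(* Outside the cube of radius [e] some coordinate has size at least [e], and its square alone brings
   the base down to [a e]. *)
have Hup : Int leb (C `\` cube 0 e) (fun z => q z ^+ n) <= a e ^+ n * fine (leb C).
  apply: (@le_trans _ _ (Int leb (C `\` cube 0 e) (fun=> a e ^+ n))).
    apply: Int_le => //.
    - exact: L1_sub mCc mC (@subDsetl _ _ _) (L1q n 0 L).
    - apply: L1_cst => //; apply: le_lt_trans (leb_cube_lty Hleb 0 L).
      by apply: le_measure; rewrite ?inE.
    - move=> z [Cz ncz]; apply: lerXn2r; rewrite ?nnegrE ?(ltW (landau_base_gt0 Cz))//.
      rewrite lerD2l lerN2 ler_pM2l//.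
      have [k Hk] : exists k, e <= `|z 0 k|.
        apply: contrapT => /forallNP H; apply: ncz => k; rewrite mxE subr0 ltNge.
        exact/negP.
      rewrite (bigD1 k)//= -[leLHS]addr0; apply: lerD; last first.
        by apply: sumr_ge0 => j _; rewrite sqr_ge0.
      rewrite -[z 0 k ^+ 2]real_normK ?num_real//.
      by rewrite ler_sqr ?nnegrE ?(ltW e0).
  rewrite /Int Rintegral_cst// ler_wpM2l ?exprn_ge0//.
  apply: fine_le; rewrite ?ge0_fin_numE//; first last.
  - by apply: le_measure; rewrite ?inE.
  - exact: leb_cube_lty.
  - apply: le_lt_trans (leb_cube_lty Hleb 0 L).
    by apply: le_measure; rewrite ?inE.
apply: (@le_trans _ _ ((landau_mass n)^-1 * (a e ^+ n * fine (leb C)))).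
  by rewrite ler_wpM2l// invr_ge0 ltW.
rewrite mulrC ler_pdivrMr//.
apply: le_trans (ler_wpM2l _ (mass_ge n e0 eL)); last first.
  rewrite mulr_ge0 ?exprn_ge0 ?divr_ge0// ?(ltW (b_gt0 _ _))//; exact: fine_ge0.
rewrite expr_div_n le_eqVlt; apply/orP; left; apply/eqP; field.
by rewrite gt_eqF ?v_gt0// expf_neq0// gt_eqF// b_gt0.
Qed.

(** It is enough to treat indicators of open sets. The excess of the mollified indicator outside [U]
    is controlled by its defect inside, and at a point of [U] the defect tends to 0 by concentration
    in a small cube contained in [U]. *)
Lemma landau_cvg f : L1 leb D f ->
  Int leb D (fun x => `|op leb D (landau n) f x - f x|) @[n --> \oo] --> 0.
Proof.
have mD := measurable_cube x0 r; have fD := leb_cube_lty Hleb x0 r.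
have ab_cvg e : 0 < e -> e <= L -> (a e / b e) ^+ n @[n --> \oo] --> 0.
  move=> e0 eL; apply: cvg_expr; rewrite normrM normfV (gtr0_norm (b_gt0 e0 eL)).
  rewrite ltr_pdivrMr ?b_gt0// mul1r ger0_norm ?b_gt_a//.
  rewrite subr_ge0 /w mulrC ler_pdivrMr ?mulr_gt0 ?exprn_gt0// mul1r.
  apply: (@le_trans _ _ (L ^+ 2)); first by rewrite ler_sqr ?nnegrE ?(ltW e0) ?(ltW L0).
  by rewrite ler_peMl ?sqr_ge0// ler1n.
have H U : open U -> op_cvg leb D landau (\1_U).
  move=> oU; have mU := borel_open oU.
  have LU : L1 leb D (\1_U) by exact: indic_L1.
  split=> //; set g := fun n => op leb D (landau n) \1_U.
  have U0 x : 0 <= \1_U x :> R by rewrite indicE.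
  have U1 x : \1_U x <= 1 :> R by rewrite indicE; case: (_ \in _).
  have bg n : bmeas (D : set (borel rV)) (g n) by apply: op_bmeas => //; have [] :=
    landau_submarkov n.
  have LK n x : L1 leb D (landau n x) by exact: L1landau.
  have g0 n x : D x -> 0 <= g n x.
    by move=> Dx; apply: op_ge0 (landau_submarkov n) _ Dx => y _; exact: U0.
  have g1 n x : D x -> g n x <= 1.
    move=> Dx; have [_ _ _ K1] := landau_submarkov n.
    apply: le_trans (K1 x Dx); apply: Int_le => //.
      apply: bmeasM_L1 => //; split; first exact: L1_meas (LK n x).
      by have [_] : bmeas (D : set (borel rV)) (landau n x) by apply: bmeas_cube => y;
        exact: smooth_cont.
    by move=> y Dy; rewrite ler_piMl ?U1// landau_ge0.
  have Lg n : L1 leb D (g n) by exact: bmeas_L1.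
  have LUg n : L1 leb D (fun x => \1_U x * (1 - g n x)).
    apply: bmeasM_L1 => //; apply: (@bmeas_eq _ _ _ _ (fun x => 1 + (-1) * g n x)).
      by move=> x _; rewrite mulN1r.
    by apply: bmeasD; [exact: bmeas_cst|apply: bmeasM => //; exact: bmeas_cst].
  (* With [u] the indicator of [U], the function [|g n - u|] equals
     [(g n - u) + 2 * (u * (1 - g n))], because [0 <= g n <= 1]. The bracket has nonpositive
     integral, by contraction. *)
  have key n : Int leb D (fun x => `|g n x - \1_U x|) <=
      2 * Int leb D (fun x => \1_U x * (1 - g n x)).
    have h1 : Int leb D (g n) <= Int leb D \1_U.
      by apply: op_contraction (landau_submarkov n) LU _ => // x _; exact: U0.
    have LgU : L1 leb D (fun x => g n x - \1_U x) by exact: L1B.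
    apply: (@le_trans _ _ (Int leb D (fun x => (g n x - \1_U x) + 2 * (\1_U x * (1 - g n x))))).
      apply: Int_le => //; first exact: L1_abs.
        by apply: L1D => //; exact: L1Z.
      move=> x Dx; have := g0 n x Dx; have := g1 n x Dx.
      rewrite indicE; case: (x \in U) => gx1 gx0; rewrite ?mulr1n ?mulr0n.
        by rewrite distrC ger0_norm ?subr_ge0//; lra.
      by rewrite subr0 ger0_norm//; lra.
    rewrite (IntD mD) ?(IntZ mD)//; last exact: L1Z.
    by rewrite (IntB mD)// -[leRHS]add0r lerD2r subr_le0.
  have T0 : Int leb D (fun x => \1_U x * (1 - g n x)) @[n --> \oo] --> Int leb D (fun=> 0).
    apply: (@Int_dct _ _ _ leb D mD _ _ (fun=> 1)) => //.
    - by move=> n; exact: L1_meas (LUg n).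
    - exact: L1_cst.
    - move=> x Dx; have [Ux|nUx] := pselect (U x); last first.
        by rewrite indicE memNset//; apply: cvg_near_cst; apply: nearW => n; rewrite mul0r.
      rewrite indicE mem_set//.
      have [e1 e10 He1] : exists2 e, 0 < e & cube x e `<=` D `&` U.
        apply: nbhs_cube; apply: filterI; apply: open_nbhs_nbhs; split => //.
        exact: open_cube.
      pose e := Num.min e1 L; have e0 : 0 < e by rewrite lt_min e10 L0.
      have eL : e <= L by rewrite ge_min lexx orbT.
      have He : cube x e `<=` D `&` U.
        by apply: subset_trans He1; apply: le_cube; rewrite ge_min lexx.
      have cV : (a e / b e) ^+ n * (fine (leb C) / fine (leb (cube 0 (e' e)))) @[n --> \oo] --> 0.
        by rewrite -[X in _ --> X](mul0r (fine (leb C) / fine (leb (cube 0 (e' e)))));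
          apply: cvgMl; exact: ab_cvg.
      apply: (@squeeze_cvgr _ _ _ _ (fun=> 0) _ _ _ _ _ cV); last exact: cvg_cst.
      apply: nearW => n; rewrite mul1r subr_ge0 g1//=.
      apply: le_trans (landau_concentration n x e0 eL); rewrite lerD2l lerN2.
      rewrite /g /op Int_indic; apply: Int_subset => //.
      + exact: measurable_cube.
      + exact: measurableI.
      + exact: L1_sub (measurableI _ _ mD mU) mD (@subIsetl _ _ _) (LK n x).
      + by move=> y [Dy _]; exact: landau_ge0.
    - move=> n x Dx; rewrite normrM (ger0_norm (U0 x)) ger0_norm ?subr_ge0 ?g1//.
      by rewrite mulr_ile1 ?U0 ?U1 ?subr_ge0 ?g1// lerBlDr lerDl g0.
  rewrite (Int0 leb mD) in T0.
  have T2 : 2 * Int leb D (fun x => \1_U x * (1 - g n x)) @[n --> \oo] --> 0.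
    by rewrite -[X in _ --> X](mulr0 (2:R)); apply: cvgMr.
  apply: (@squeeze_cvgr _ _ _ _ (fun=> 0) _ _ _ _ _ T2); last exact: cvg_cst.
  by apply: nearW => n; rewrite key andbT; apply: Int_ge0.
move=> Lf; have := @op_cvg_L1 _ _ R leb D mD fD landau landau_submarkov (@open rV).
case/(_ erefl _ H _ f Lf) => //.
- by move=> A B oA oB; exact: openI.
- by apply: op_cvg_eq (H setT openT) => // x _; rewrite indicE in_setT.
Qed.

End Landau.

(** * The product rule for weak derivatives *)

Section ProductRule.
Context {R : realType} {m : nat}.
Local Notation rV := 'rV[R]_m.
Variable leb : {measure set (borel rV) -> \bar R}.
Hypothesis Hleb : is_lebesgue leb.
Variables (x0 : rV) (r : R).
Hypothesis r0 : 0 < r.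
Local Notation D := (cube x0 r).
Local Notation L1 := (L1 leb D).
Local Notation Int := (Int leb D).
Local Notation op := (op leb D).
Local Notation dual_pair := (dual_pair leb D).
Local Notation K := (landau leb r).
Implicit Types (z f g u v : rV -> R) (U : 'I_m -> rV -> R).

Let mD := measurable_cube x0 r.
Let fD := leb_cube_lty Hleb x0 r.

Definition ccube (x : rV) (e : R) : set rV := [set y | forall k, `|y 0 k - x 0 k| <= e].

Definition cube_test z := smooth setT z /\
  exists2 e, e < r & forall x, ~ ccube x0 e x -> z x = 0.

Definition weak_div U f := forall z, cube_test z ->
  \sum_k Int (fun x => U k x * pd k z x) = Int (fun x => f x * z x).

Definition cube_wpd k v v' := forall z, cube_test z ->
  Int (fun x => v x * pd k z x) = - Int (fun x => v' x * z x).

Lemma cube_testM z g : cube_test z -> smooth setT g -> cube_test (fun x => z x * g x).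
Proof.
move=> [sz [e er Hz]] sg; split; first by move=> p; apply: CkM; [exact: openT|exact: sz|exact: sg].
by exists e => // x /Hz ->; rewrite mul0r.
Qed.

Lemma smooth_bmeas z : smooth setT z -> bmeas (D : set (borel rV)) z.
Proof. by move=> sz; apply: bmeas_cube => y; exact: smooth_cont. Qed.

(** The kernel depends on [x - y] alone. *)
Lemma landau_pd_anti n k x y :
  pd k (fun w => K n w y) x = - pd k (fun w => K n x w) y.
Proof.
pose P (w : rV) : R := (landau_mass leb r n)^-1 * landau_base r w ^+ n.
have sP : smooth setT P.
  move=> p; apply: CkZ; first exact: openT.
  by apply: Ck_exp; [exact: openT|exact: smooth_landau_base].
have dP w : differentiable P w by exact: (smooth_diff sP).
have d1 l : differentiable (fun w : rV => (w - y) 0 l) x.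
  rewrite (_ : (fun _ => _) = fun w : rV => w 0 l - y 0 l); last first.
    by apply/funext => w; rewrite !mxE.
  by apply: differentiableB => //; exact: differentiable_coord0.
have d2 l : differentiable (fun w : rV => (x - w) 0 l) y.
  rewrite (_ : (fun _ => _) = fun w : rV => x 0 l - w 0 l); last first.
    by apply/funext => w; rewrite !mxE.
  by apply: differentiableB => //; exact: differentiable_coord0.
have [_ E1] := pd_chain k d1 (dP (x - y)).
have [_ E2] := pd_chain k d2 (dP (x - y)).
transitivity (pd k (P \o +%R^~ (- y)) x); first by [].
rewrite E1; transitivity (- pd k (P \o (fun w : rV => x - w)) y); last by [].
rewrite E2 -sumrN; apply: eq_bigr => l _; rewrite -mulNr; congr (_ * _).
rewrite (_ : (fun y0 : rV => (y0 - y) 0 l) = fun w : rV => w 0 l + (- y 0 l)); last first.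
  by apply/funext => w; rewrite !mxE.
rewrite (_ : (fun y0 : rV => (x - y0) 0 l) = fun w : rV => x 0 l + (-1) * w 0 l); last first.
  by apply/funext => w; rewrite !mxE mulN1r.
have dc w := @differentiable_coord0 R m l w.
rewrite pdD// pd_cst addr0 pdD//; last by apply: differentiableM.
by rewrite pd_cst add0r pdM// pd_cst mul0r add0r mulN1r opprK !pd_coord.
Qed.

Lemma cvg_sumr (I : Type) (s : seq I) (u : I -> nat -> R) (l : I -> R) :
  (forall i, u i n @[n --> \oo] --> l i) ->
  (\sum_(i <- s) u i n) @[n --> \oo] --> \sum_(i <- s) l i.
Proof.
move=> H; elim: s => [|i s IH].
  by rewrite big_nil; under eq_fun do rewrite big_nil; exact: cvg_cst.
by rewrite big_cons; under eq_fun do rewrite big_cons; exact: cvgD.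
Qed.

(** The derivative falls on the kernel, becomes a derivative in [y] by [landau_pd_anti], and is
    moved to [v] by testing the weak derivative with [c * K n x], a test function thanks to the
    cutoff [c]. *)
Lemma mollified_pd n k v v' c : L1 v -> L1 v' -> cube_wpd k v v' -> cube_test c ->
  forall x, pd k (op (K n) (fun y => c y * v y)) x =
    op (K n) (fun y => c y * v' y + v y * pd k c y) x.
Proof.
move=> Lv Lv' wv tc x; have [sc _] := tc.
have bc := smooth_bmeas sc; have bpc := smooth_bmeas (smooth_pd k sc).
have Lcv : L1 (fun y => c y * v y).
  by apply: (L1_eq mD (f := fun y => v y * c y)) (bmeasM_L1 mD bc Lv) => y _; rewrite mulrC.
have sK := landau_ssep leb r n.
rewrite (smooth_op sK Lcv).2 /op.
have sKx : smooth setT (K n x).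
  have [I [a [b [_ Hb HK]]]] := sK.
  move=> p; have -> : K n x = fun y => \sum_i a i x * b i y by apply/funext => y.
  apply: Ck_sum; first exact: openT.
  by move=> i _; apply: CkM; [exact: openT|exact: Ck_cst|exact: Hb].
have bK := smooth_bmeas sKx; have bpK := smooth_bmeas (smooth_pd k sKx).
have := wv _ (cube_testM tc sKx).
have -> : (fun y => v y * pd k (fun x1 => c x1 * K n x x1) y) =
   (fun y => v y * pd k c y * K n x y + v y * (c y * pd k (K n x) y)).
  apply/funext => y; rewrite pdM; [|exact: (smooth_diff sc)|exact: (smooth_diff sKx)].
  by ring.
rewrite (IntD mD); first last.
- by apply: bmeasM_L1 => //; exact: bmeasM.
- by apply: bmeasM_L1 => //; exact: bmeasM_L1.
move=> E.
have -> : Int (fun y => c y * v y * pd k (fun w => K n w y) x) =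
    - Int (fun y => v y * (c y * pd k (K n x) y)).
  rewrite -(IntN mD); last by apply: bmeasM_L1 => //; exact: bmeasM.
  by apply: Int_eq => y _; rewrite landau_pd_anti; ring.
have -> : Int (fun y => (c y * v' y + v y * pd k c y) * K n x y) =
   Int (fun y => v' y * (c y * K n x y)) + Int (fun y => v y * pd k c y * K n x y).
  rewrite -(IntD mD).
  - by apply: Int_eq => y _; ring.
  - by apply: bmeasM_L1 => //; exact: bmeasM.
  - by apply: bmeasM_L1 => //; exact: bmeasM_L1.
by lra.
Qed.

(** The weak divergence is tested with [z * op (K n) (c * v)]. By [mollified_pd] each derivative
    lands on [z] or under the mollifier, the three resulting pairings converge by the three
    [dual_pair] hypotheses, and the limits recombine into the Leibniz formula for [c * z]. *)
Theorem product_rule U f v (v' : 'I_m -> rV -> R) c z :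
  (forall k, L1 (U k)) -> L1 f -> L1 v -> (forall k, L1 (v' k)) ->
  weak_div U f -> (forall k, cube_wpd k v (v' k)) -> cube_test c -> cube_test z ->
  (forall k, dual_pair (fun x => c x * v x) (fun x => U k x * pd k z x)) ->
  (forall k, dual_pair (fun x => c x * v' k x + v x * pd k c x) (fun x => U k x * z x)) ->
  dual_pair (fun x => c x * v x) (fun x => f x * z x) ->
  \sum_k Int (fun x => U k x * (v' k x * (c x * z x) + v x * pd k (fun y => c y * z y) x)) =
    Int (fun x => f x * v x * (c x * z x)).
Proof.
move=> LU Lf Lv Lv' wU wv tc tz dp1 dp2 dp3.
have [sc _] := tc; have [sz _] := tz.
pose g x := c x * v x; pose h k x := c x * v' k x + v x * pd k c x.
have Lg : L1 g by case: dp3.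
have Lh k : L1 (h k) by case: (dp2 k).
have mK := (fun n => landau_submarkov Hleb x0 r0 n).
have C1 k := dual_pair_cvg mD fD mK (landau_cvg Hleb r0 Lg) (dp1 k).
have C2 k := dual_pair_cvg mD fD mK (landau_cvg Hleb r0 (Lh k)) (dp2 k).
have C3 := dual_pair_cvg mD fD mK (landau_cvg Hleb r0 Lg) dp3.
have bz := smooth_bmeas sz; have bpz k := smooth_bmeas (smooth_pd k sz).
have L1o u n w : L1 w -> L1 u -> L1 (fun x => w x * op (K n) u x).
  by move=> Lw Lu; apply: bmeasM_L1 => //; apply: op_bmeas => //; case: (mK n).
have E n : \sum_k Int (fun x => U k x * pd k z x * op (K n) g x) +
           \sum_k Int (fun x => U k x * z x * op (K n) (h k) x) =
           Int (fun x => f x * z x * op (K n) g x).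
  have sF := (smooth_op (landau_ssep leb r n) Lg).1.
  have := wU _ (cube_testM tz sF).
  have -> : Int (fun x => f x * (z x * op (K n) g x)) = Int (fun x => f x * z x * op (K n) g x).
    by apply: Int_eq => x _; rewrite mulrA.
  move=> <-; rewrite -big_split; apply: eq_bigr => k _.
  rewrite /= -(IntD mD).
  - apply: Int_eq => x _; rewrite pdM; [|exact: (smooth_diff sz)|exact: (smooth_diff sF)].
    by rewrite (mollified_pd n Lv (Lv' k) (wv k) tc) -/(h k); ring.
  - by apply: L1o => //; exact: bmeasM_L1.
  - by apply: L1o => //; exact: bmeasM_L1.
have S1 := cvg_sumr (s := index_enum 'I_m) C1.
have S2 := cvg_sumr (s := index_enum 'I_m) C2.
have S := cvgD S1 S2.
have EQ : \sum_k Int (fun x => U k x * pd k z x * g x) +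
    \sum_k Int (fun x => U k x * z x * h k x) = Int (fun x => f x * z x * g x).
  apply: (cvg_unique (@Rhausdorff R) (S _)).
  apply: cvg_trans C3; apply: near_eq_cvg; apply: nearW => n.
  by rewrite -E.
transitivity (Int (fun x => f x * z x * g x)); last by apply: Int_eq => x _; rewrite /g; ring.
rewrite -EQ -big_split; apply: eq_bigr => k _ /=.
rewrite -(IntD mD); [|exact: dual_pair_L1 (dp1 k)|exact: dual_pair_L1 (dp2 k)].
apply: Int_eq => x _; rewrite /g /h pdM; [|exact: (smooth_diff sc)|exact: (smooth_diff sz)].
ring.
Qed.

End ProductRule.

(** * The Sobolev inequality in dimensions one and two *)

Section Lpow.
Context {d : measure_display} {T : measurableType d} {R : realType}.
Variables (mu : {measure set T -> \bar R}) (D : set T).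
Hypothesis mD : measurable D.
Hypothesis fD : (mu D < +oo)%E.
Implicit Types f g h : T -> R.
Local Notation L1 := (L1 mu D).
Local Notation Int := (Int mu D).
Local Notation op := (op mu D).
Local Notation bmeas := (bmeas D).

Definition Lpow (p : R) f := measurable_fun D f /\ L1 (fun x => `|f x| `^ p).

Lemma measurable_pow p f : measurable_fun D f -> measurable_fun D (fun x => `|f x| `^ p).
Proof.
move=> mf; apply: (@measurableT_comp _ _ _ _ _ _ (fun y : R => y `^ p));
  first exact: measurable_powR.
exact: measurableT_comp.
Qed.

Lemma powR_le (p a b : R) : 0 <= p -> 0 <= a -> a <= b -> a `^ p <= b `^ p.
Proof.
move=> p0 a0 ab; apply: ge0_ler_powR => //; rewrite nnegrE//.
exact: le_trans ab.
Qed.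

Lemma powR_add (p a b : R) : 0 <= p -> 0 <= a -> 0 <= b ->
  (a + b) `^ p <= 2 `^ p * (a `^ p + b `^ p).
Proof.
move=> p0 a0 b0; have p2 : 0 <= 2 `^ p :> R by exact: powR_ge0.
have [ab|/ltW ba] := leP a b.
  apply: (@le_trans _ _ ((2 * b) `^ p)).
    by apply: powR_le => //; [exact: addr_ge0|lra].
  by rewrite powRM// ler_wpM2l// lerDr powR_ge0.
apply: (@le_trans _ _ ((2 * a) `^ p)).
  by apply: powR_le => //; [exact: addr_ge0|lra].
by rewrite powRM// ler_wpM2l// lerDl powR_ge0.
Qed.

Lemma Lpow_le p f g : 0 <= p -> measurable_fun D f -> (forall x, D x -> `|f x| <= `|g x|) ->
  Lpow p g -> Lpow p f.
Proof.
move=> p0 mf fg [mg Lg]; split=> //.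
apply: (L1_le mD _ _ Lg); first exact: measurable_pow.
by move=> x Dx; rewrite !(ger0_norm (powR_ge0 _ _)) powR_le// fg.
Qed.

Lemma LpowD p f g : 0 <= p -> Lpow p f -> Lpow p g -> Lpow p (fun x => f x + g x).
Proof.
move=> p0 [mf Lf] [mg Lg]; have mfg : measurable_fun D (fun x => f x + g x)
  by exact: measurable_funD.
split=> //.
apply: (@L1_le _ _ _ mu D mD _ (fun x => 2 `^ p * (`|f x| `^ p + `|g x| `^ p))).
- exact: measurable_pow.
- move=> x Dx; rewrite (ger0_norm (powR_ge0 _ _)) [leRHS]ger0_norm;
  last by rewrite mulr_ge0 ?addr_ge0 ?powR_ge0.
  apply: le_trans (powR_add p0 (normr_ge0 _) (normr_ge0 _)).
  by apply: powR_le => //; exact: ler_normD.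
- by apply: L1Z => //; exact: L1D.
Qed.

Lemma LpowM p f h : 0 <= p -> Lpow p f -> bmeas h -> Lpow p (fun x => h x * f x).
Proof.
move=> p0 [mf Lf] [mh [c hc]].
have mhf : measurable_fun D (fun x => h x * f x) by exact: measurable_funM.
split=> //.
apply: (@L1_le _ _ _ mu D mD _ (fun x => `|c| `^ p * `|f x| `^ p)).
- exact: measurable_pow.
- move=> x Dx; rewrite (ger0_norm (powR_ge0 _ _)) [leRHS]ger0_norm;
  last by rewrite mulr_ge0 ?powR_ge0.
  rewrite -powRM//; apply: powR_le => //; rewrite normrM ler_wpM2r//.
  exact: le_trans (hc x Dx) (ler_norm _).
- exact: L1Z.
Qed.

Lemma powR_ge_id (p a : R) : 1 <= p -> 0 <= a -> a <= 1 + a `^ p.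
Proof.
move=> p1 a0; have [a1|/ltW a1] := leP a 1.
  by apply: le_trans a1 _; rewrite lerDl powR_ge0.
by apply: le_trans (le1r_powR a1 p1) _; rewrite lerDr.
Qed.

Lemma Lpow_L1 p f : 1 <= p -> Lpow p f -> L1 f.
Proof.
move=> p1 [mf Lf].
apply: (@L1_le _ _ _ mu D mD _ (fun x => 1 + `|f x| `^ p)) => //.
- move=> x Dx; rewrite [leRHS]ger0_norm ?addr_ge0 ?powR_ge0//.
  exact: powR_ge_id.
- by apply: L1D => //; exact: L1_cst.
Qed.

(** Jensen's inequality for a kernel of mass at most 1, obtained from Young's inequality at the
    scale [t] with [t^p = A + 1]. The additive 1 keeps [t] positive when [A] vanishes; on a set of
    finite measure it costs a constant. *)
Lemma op_jensen K (p q : R) f x : submarkov mu D K -> 0 < p -> 0 < q -> p^-1 + q^-1 = 1 ->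
  L1 f -> L1 (fun x => `|f x| `^ p) -> D x ->
  `|op K f x| `^ p <= op K (fun y => `|f y| `^ p) x + 1.
Proof.
move=> mK p0 q0 pq Lf Lfp Dx; have [sK K0 symK K1] := mK.
set A := op K (fun y => `|f y| `^ p) x.
have A0 : 0 <= A by apply: op_ge0 => // y _; exact: powR_ge0.
pose t := (A + 1) `^ p^-1.
have t0 : 0 < t by rewrite powR_gt0// ltr_wpDl.
have tp : t `^ p = A + 1 by rewrite -powRrM mulVf ?gt_eqF// powRr1// addr_ge0.
rewrite -tp; apply: powR_le => //; first exact: ltW.
apply: (@le_trans _ _ (op K (fun y => `|f y|) x)); first exact: op_norm.
have bK : bmeas (K x) by exact: separable_bmeas.
(* Young's inequality for the factorisation of [|f y|] into [|f y| * t^(-1/q)] and [t^(1/q)]. *)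
have young y : `|f y| <= t `^ (1 - p) / p * `|f y| `^ p + t / q.
  have := @conjugate_powR R (`|f y| * t `^ (- q^-1)) (t `^ q^-1) p q.
  rewrite mulr_ge0 ?powR_ge0// => /(_ isT isT p0 q0 pq).
  have -> : `|f y| * t `^ (- q^-1) * t `^ q^-1 = `|f y|.
    rewrite -[LHS]mulrA -powRD; last by apply/implyP => _; rewrite gt_eqF.
    by rewrite addNr powRr0 mulr1.
  have -> : (t `^ q^-1) `^ q = t by rewrite -powRrM mulVf ?gt_eqF// powRr1// ltW.
  rewrite powRM ?powR_ge0// -powRrM.
  have -> : - q^-1 * p = 1 - p.
    have -> : q^-1 = 1 - p^-1 by rewrite -pq addrAC subrr add0r.
    by field; rewrite gt_eqF.
  by move=> H; apply: le_trans H _; rewrite lerD2r le_eqVlt; apply/orP; left; apply/eqP; ring.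
have LK : L1 (K x) by exact: bmeas_L1.
apply: (@le_trans _ _ (Int (fun y => t `^ (1 - p) / p * (`|f y| `^ p * K x y) + t / q * K x y))).
  apply: Int_le => //.
  - by apply: bmeasM_L1 => //; exact: L1_abs.
  - by apply: L1D => //; apply: L1Z => //; exact: bmeasM_L1.
  - by move=> y Dy; rewrite mulrA -mulrDl ler_wpM2r ?K0.
rewrite (IntD mD); [|by apply: L1Z => //; exact: bmeasM_L1|exact: L1Z].
rewrite (IntZ mD); last exact: bmeasM_L1.
rewrite (IntZ mD)// -/(op K _ x) -/A.
apply: (@le_trans _ _ (t `^ (1 - p) / p * (A + 1) + t / q * 1)).
  apply: lerD.
    by rewrite ler_wpM2l ?divr_ge0 ?powR_ge0 ?(ltW p0)// lerDl.
  by rewrite ler_wpM2l ?divr_ge0 ?(ltW t0) ?(ltW q0)// K1.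
rewrite -tp mulrAC -powRD; last by apply/implyP => _; rewrite gt_eqF.
by rewrite subrK powRr1 ?(ltW t0)// mulr1 -mulrDr pq mulr1.
Qed.

End Lpow.

Section Line.
Context {R : realType}.
Local Notation mu := (@lebesgue_measure R).

Lemma ftc_bound (F f : R -> R) (a : R) : (forall t : R, is_derive t 1 F (f t)) ->
  continuous f -> (forall t, t <= a -> F t = 0) ->
  forall s, (`|F s|%:E <= \int[mu]_t `|f t|%:E)%E.
Proof.
move=> dF cf F0 s.
have [sa|as_] := leP s a.
  by rewrite F0// normr0; apply: integral_ge0 => t _; rewrite lee_fin.
have cF : continuous F.
  move=> t; apply/differentiable_continuous/derivable1_diffP.
  by have [] := dF t.
have mf : measurable_fun setT f by exact: continuous_measurable_fun.
have cwf : {within `[a, s], continuous f} by exact: continuous_subspaceT.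
have E : (\int[mu]_(t in `[a, s]) (f t)%:E = (F s)%:E - (F a)%:E)%E.
  apply: continuous_FTC2 => //.
    split; [by move=> t _; have [] :=
      dF t|exact/cvg_at_right_filter/cF|exact/cvg_at_left_filter/cF].
  by move=> t _; rewrite derive1E; have [_ ->] := dF t.
rewrite (F0 a)// sube0 in E.
rewrite -abse_EFin -E; apply: le_trans (le_abse_integral _ _ _) _ => //.
  by apply/measurable_EFinP; exact: measurable_funTS.
apply: ge0_subset_integral => //.
by apply/measurable_EFinP; exact: measurableT_comp.
Qed.

End Line.

(** * Lebesgue measure in coordinates on the line and the plane *)

Section Coordinates.
Context {R : realType} {m : nat}.
Local Notation rV := 'rV[R]_m.

Lemma measurable_row d (T : measurableType d) (f : T -> rV) :
  (forall k, measurable_fun setT (fun x => f x 0 k)) ->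
  measurable_fun setT (f : T -> borel rV).
Proof.
move=> mf; apply: (@measurability _ _ T (borel rV) _ f _ borel_hobox).
move=> _ [_ [a [b ->]] <-]; rewrite setTI.
have -> : f @^-1` hobox a b =
    \bigcap_(k in [set: 'I_m]) ((fun x => f x 0 k) @^-1` `[a 0 k, b 0 k[%classic).
  apply/seteqP; split=> x H; first by move=> k _; rewrite /= in_itv; exact: H.
  by move=> k; have := H k I; rewrite /= in_itv.
apply: fin_bigcap_measurable; first exact: finite_finset.
by move=> k _; rewrite -[X in measurable X]setTI; exact: mf.
Qed.

Lemma is_derive_line (w : rV -> R) k (g : R -> rV) (s : R) :
  (forall h t, g (h + t) = h *: delta_mx 0 k + g t) ->
  differentiable w (g s) -> is_derive s 1 (w \o g) (pd k w (g s)).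
Proof.
move=> gE dw; have dk := @diff_derivable _ _ _ w (g s) (delta_mx 0 k) dw.
have E : (fun h : R => h^-1 *: ((w \o g \o shift s) (h *: 1) - (w \o g) s)) =
   (fun h : R => h^-1 *: ((w \o shift (g s)) (h *: delta_mx 0 k) - w (g s))).
  by apply/funext => h /=; rewrite gE /GRing.scale/= mulr1.
split.
  by rewrite /derivable E; exact: dk.
by rewrite /derive E.
Qed.

Lemma continuous_line (v c : rV) : continuous (fun s : R => s *: v + c).
Proof.
move=> s; apply: cvgD; last exact: cvg_cst.
exact: scalel_continuous.
Qed.

End Coordinates.

Section Line1.
Context {R : realType}.
Local Notation rV := 'rV[R]_1.
Variable leb : {measure set (borel rV) -> \bar R}.
Hypothesis Hleb : is_lebesgue leb.
Local Notation mu := (@lebesgue_measure R).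

Definition row1 (s : measurableTypeR R) : borel rV := const_mx s : rV.

Lemma measurable_row1 : measurable_fun setT row1.
Proof.
apply: measurable_row => k; rewrite (_ : (fun _ => _) = id)//.
by apply/funext => s; rewrite mxE.
Qed.

Let row1_mixin := isMeasurableFun.Build _ _ _ _ _ measurable_row1.
Let row1_mfun : {mfun measurableTypeR R >-> borel rV} := HB.pack row1 row1_mixin.

(** It suffices to compare the two measures on boxes. Integrals over row vectors are thereby brought
    to the line, where the fundamental theorem of calculus lives. *)
Lemma leb1E A : measurable A -> pushforward mu row1 A = leb A.
Proof.
move=> mA; apply: (@lebesgue_unique R 1 (pushforward mu row1_mfun) leb) => // a b ab.
transitivity (mu `[a 0 0, b 0 0[%classic).
  congr (mu _); apply/seteqP; split=> s; rewrite /= in_itv/=.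
    by move=> /(_ 0); rewrite mxE.
  by move=> H k; rewrite ord1 mxE.
rewrite lebesgue_measure_itv/= big_ord1 lte_fin.
case: ltP => // ba; have -> : b 0 0 = a 0 0 by apply/eqP; rewrite eq_le ba ab.
by rewrite subrr.
Qed.

Lemma leb1_integral (g : rV -> R) : measurable_fun setT (g : borel rV -> R) ->
  (forall x, 0 <= g x) -> (\int[leb]_x (g x)%:E = \int[mu]_s (g (row1 s))%:E)%E.
Proof.
move=> mg g0.
have := @ge0_integral_pushforward _ _ _ _ R row1 measurable_row1 mu setT (EFin \o g) measurableT.
rewrite preimage_setT => <-.
- symmetry; apply: (@eq_measure_integral _ _ _ setT leb (pushforward mu row1_mfun)) => A mA _.
  exact: leb1E.
- exact/measurable_EFinP.
- by move=> x _; rewrite lee_fin.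
Qed.

Lemma sup_bound (w : rV -> R) (x0 : rV) e : smooth setT w ->
  (forall x, ~ ccube x0 e x -> w x = 0) ->
  forall x, (`|w x|%:E <= \int[leb]_y `|pd 0 w y|%:E)%E.
Proof.
move=> sw w0 x.
have cw' y : {for y, continuous (pd 0 w)} by apply: smooth_cont; exact: smooth_pd.
rewrite (@leb1_integral (fun y => `|pd 0 w y|)); first last.
- by move=> y.
- apply: measurableT_comp => //.
  by apply: borel_continuous_real => //; exact: openT.
rewrite (_ : x = row1 (x 0 0)); last by apply/rowP => k; rewrite ord1 mxE.
(* The starting point is one unit to the left of the supporting cube, so [w] vanishes there and
   further to the left. *)
apply: (@ftc_bound R (w \o row1) (fun s => pd 0 w (row1 s)) (x0 0 0 - e - 1)).
- move=> t; apply: is_derive_line; last exact: smooth_diff.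
  by move=> h s; apply/rowP => k; rewrite ord1 !mxE eqxx mulr1.
- move=> t; apply: (@continuous_comp _ _ _ row1 (pd 0 w)); last exact: cw'.
  rewrite (_ : row1 = fun s : R => s *: (const_mx 1 : rV)); first exact: scalel_continuous.
  by apply/funext => s; apply/rowP => k; rewrite !mxE mulr1.
- move=> t ht; apply: w0 => /(_ 0); rewrite mxE ler_norml => /andP[]; lra.
Qed.

End Line1.

(** Each of the two factors in the pointwise bound depends on one variable, so by Tonelli the
    integral of their product is a product of integrals. *)
Lemma integral_prod_le d1 d2 (T1 : measurableType d1) (T2 : measurableType d2)
    (R : realType) (m1 : {sigma_finite_measure set T1 -> \bar R})
    (m2 : {sigma_finite_measure set T2 -> \bar R}) (f g h : T1 * T2 -> \bar R) :
  (forall x, 0 <= f x)%E -> measurable_fun setT f ->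
  (forall x, 0 <= g x)%E -> measurable_fun setT g ->
  (forall x, 0 <= h x)%E -> measurable_fun setT h ->
  (forall s t, f (s, t) <= (\int[m2]_t' h (s, t')) * (\int[m1]_s' g (s', t)))%E ->
  (\int[(m1 \x m2)%E]_x f x <=
    (\int[(m1 \x m2)%E]_x g x) * \int[(m1 \x m2)%E]_x h x)%E.
Proof.
move=> f0 mf g0 mg h0 mh H.
rewrite (fubini_tonelli1 f)// (fubini_tonelli2 g)// (fubini_tonelli1 h)//.
have A0 t : (0 <= fubini_G m1 g t)%E by exact: integral_ge0.
have B0 s : (0 <= fubini_F m2 h s)%E by exact: integral_ge0.
have mA := measurable_fun_fubini_tonelli_G (m1 := m1) g mg g0.
have mB := measurable_fun_fubini_tonelli_F (m2 := m2) h mh h0.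
have A1 : (0 <= \int[m2]_t fubini_G m1 g t)%E by exact: integral_ge0.
rewrite -ge0_integralZl//; apply: ge0_le_integral => //.
- by move=> s _; apply: integral_ge0.
- exact: (measurable_fun_fubini_tonelli_F f).
- exact: measurable_funeM.
- move=> s _; rewrite muleC -ge0_integralZl//; apply: ge0_le_integral => //.
  + by apply: (measurableT_comp mf); exact: pair1_measurable.
  + exact: measurable_funeM.
Qed.

Section Plane.
Context {R : realType}.
Local Notation rV := 'rV[R]_2.
Variable leb : {measure set (borel rV) -> \bar R}.
Hypothesis Hleb : is_lebesgue leb.
Local Notation mu := (@lebesgue_measure R).
Local Notation RR := (measurableTypeR R * measurableTypeR R)%type.

Definition row2 (st : RR) : borel rV := \row_(k < 2) (if k == 0 then st.1 else st.2) : rV.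

Lemma measurable_row2 : measurable_fun setT row2.
Proof.
have m1 : measurable_fun setT (fst : RR -> measurableTypeR R) := measurable_fst.
have m2 : measurable_fun setT (snd : RR -> measurableTypeR R) := measurable_snd.
apply: measurable_row => k; case: (eqVneq k 0) => k0.
  by apply: eq_measurable_fun m1 => s _; rewrite mxE k0.
by apply: eq_measurable_fun m2 => s _; rewrite mxE (negbTE k0).
Qed.

Let row2_mixin := isMeasurableFun.Build _ _ _ _ _ measurable_row2.
Let row2_mfun : {mfun RR >-> borel rV} := HB.pack row2 row2_mixin.

Lemma leb2E A : measurable A -> pushforward (mu \x mu)%E row2 A = leb A.
Proof.
move=> mA; apply: (@lebesgue_unique R 2 (pushforward (mu \x mu)%E row2_mfun) leb) => // a b ab.
transitivity ((mu \x mu)%E (`[a 0 0, b 0 0[%classic `*` `[a 0 1, b 0 1[%classic)).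
  congr ((mu \x mu)%E _); apply/seteqP; split=> s; rewrite /= !in_itv/=.
    by move=> H; split; [move: (H 0)|move: (H 1)]; rewrite mxE.
  move=> [h0 h1] k; rewrite mxE; case: (eqVneq k 0) => [->//|].
  by case: k => [[|[|//]]] //= k2 _; rewrite (_ : Ordinal k2 = 1)//; exact: val_inj.
rewrite product_measure1E//= !lebesgue_measure_itv/= !lte_fin.
have F (x y : R) : x <= y -> (if x < y then (y%:E - x%:E)%E else 0%E) = (y - x)%:E.
  by move=> xy; case: ltP => // yx; have -> : y = x by [apply/eqP; rewrite eq_le yx xy];
    rewrite subrr.
rewrite !F// -EFinM big_ord_recl big_ord1; congr ((_ * (b 0 _ - a 0 _))%:E); exact: val_inj.
Qed.

Lemma leb2_integral (g : rV -> R) : measurable_fun setT (g : borel rV -> R) ->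
  (forall x, 0 <= g x) ->
  (\int[leb]_x (g x)%:E = \int[(mu \x mu)%E]_s (g (row2 s))%:E)%E.
Proof.
move=> mg g0.
have := @ge0_integral_pushforward _ _ _ _ R row2 measurable_row2 (mu \x mu)%E setT (EFin \o g)
  measurableT.
rewrite preimage_setT => <-.
- symmetry; apply: (@eq_measure_integral _ _ _ setT leb (pushforward (mu \x mu)%E row2_mfun)) =>
  A mA _.
  exact: leb2E.
- exact/measurable_EFinP.
- by move=> x _; rewrite lee_fin.
Qed.

(** At each point [|w|] is at most the integral of [|pd 0 w|] along the line in direction 0, and at
    most that of [|pd 1 w|] along the line in direction 1. These bounds depend on one variable each,
    and [w^2] is at most their product. *)
Lemma gagliardo (w : rV -> R) (x0 : rV) e : smooth setT w ->
  (forall x, ~ ccube x0 e x -> w x = 0) ->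
  (\int[leb]_x (w x ^+ 2)%:E <=
   (\int[leb]_x `|pd 0 w x|%:E) * (\int[leb]_x `|pd 1 w x|%:E))%E.
Proof.
move=> sw w0.
have cw y : {for y, continuous w} by exact: smooth_cont.
have cw' k y : {for y, continuous (pd k w)} by apply: smooth_cont; exact: smooth_pd.
have mabs k : measurable_fun setT ((fun y => `|pd k w y|) : borel rV -> R).
  apply: measurableT_comp => //.
  by apply: borel_continuous_real => //; exact: openT.
have mw2 : measurable_fun setT ((fun y => w y ^+ 2) : borel rV -> R).
  apply: measurable_funX.
  by apply: borel_continuous_real => //; exact: openT.
rewrite (leb2_integral mw2); last by move=> x; exact: sqr_ge0.
rewrite (leb2_integral (mabs 0))// (leb2_integral (mabs 1))//.
have mr2 (g : rV -> R) : measurable_fun setT (g : borel rV -> R) ->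
    measurable_fun setT (fun s : RR => (g (row2 s))%:E).
  by move=> mg; apply/measurable_EFinP; apply: (measurableT_comp mg); exact: measurable_row2.
pose A t := (\int[mu]_s `|pd 0 w (row2 (s, t))|%:E)%E.
pose B s := (\int[mu]_t `|pd 1 w (row2 (s, t))|%:E)%E.
have row2_0 h s t : row2 (h + s, t) = h *: delta_mx 0 0 + row2 (s, t) :> rV.
  by apply/rowP => k; rewrite !mxE; case: (k == 0); rewrite /= ?mulr1 ?mulr0 ?add0r.
have row2_1 h s t : row2 (s, h + t) = h *: delta_mx 0 1 + row2 (s, t) :> rV.
  apply/rowP => k; rewrite !mxE; case: (eqVneq k 0) => [->|k0]; rewrite /= ?mulr1 ?mulr0 ?add0r//.
  rewrite (_ : k == 1) ?mulr1//.
  by case: k k0 => [[|[|//]]].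
have c1 (t : R) : continuous ((fun s : R => row2 (s, t)) : R -> rV).
  move=> s; rewrite (_ : (fun _ => _) = fun s : R => s *: (delta_mx 0 0 : rV) + (row2 (0, t) : rV)).
    exact: continuous_line.
  by apply/funext => s'; rewrite -row2_0 addr0.
have c2 (s : R) : continuous ((fun t : R => row2 (s, t)) : R -> rV).
  move=> t; rewrite (_ : (fun _ => _) = fun t : R => t *: (delta_mx 0 1 : rV) + (row2 (s, 0) : rV)).
    exact: continuous_line.
  by apply/funext => t'; rewrite -row2_1 addr0.
have HA s t : (`|w (row2 (s, t))|%:E <= A t)%E.
  apply: (@ftc_bound R (fun s => w (row2 (s, t))) (fun s => pd 0 w (row2 (s, t))) (x0 0 0 - e - 1)).
  - move=> s'; apply: (@is_derive_line R 2 w 0 (fun s => row2 (s, t))) => //.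
    exact: smooth_diff.
  - by move=> s'; apply: continuous_comp; [exact: c1|exact: cw'].
  - move=> s' hs; apply: w0 => /(_ 0); rewrite mxE/= ler_norml => /andP[]; lra.
have HB s t : (`|w (row2 (s, t))|%:E <= B s)%E.
  apply: (@ftc_bound R (fun t => w (row2 (s, t))) (fun t => pd 1 w (row2 (s, t))) (x0 0 1 - e - 1)).
  - move=> t'; apply: (@is_derive_line R 2 w 1 (fun t => row2 (s, t))) => //.
    exact: smooth_diff.
  - by move=> t'; apply: continuous_comp; [exact: c2|exact: cw'].
  - move=> s' hs; apply: w0 => /(_ 1); rewrite mxE/= ler_norml => /andP[]; lra.
apply: (@integral_prod_le _ _ _ _ R mu mu (fun s : RR => (w (row2 s) ^+ 2)%:E)
   (fun s : RR => `|pd 0 w (row2 s)|%:E) (fun s : RR => `|pd 1 w (row2 s)|%:E)).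
- by move=> st; rewrite lee_fin sqr_ge0.
- exact: (mr2 _ mw2).
- by move=> st; rewrite lee_fin.
- exact: (mr2 _ (mabs 0)).
- by move=> st; rewrite lee_fin.
- exact: (mr2 _ (mabs 1)).
- move=> s t; rewrite -(@real_normK _ (w _)) ?num_real// expr2 EFinM.
  have W0 : (0 <= `|w (row2 (s, t))|%:E)%E by rewrite lee_fin.
  exact: (lee_pmul W0 W0 (HB s t) (HA s t)).
Qed.

End Plane.

Section Support.
Context {R : realType} {m : nat}.
Local Notation rV := 'rV[R]_m.
Variable leb : {measure set (borel rV) -> \bar R}.
Hypothesis Hleb : is_lebesgue leb.
Variables (x0 : rV) (r : R).
Local Notation D := (cube x0 r).

Lemma closed_ccube e : closed (ccube x0 e).
Proof. by apply: compact_closed; [exact: norm_hausdorff|exact: ccube_compact]. Qed.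

Lemma ccube_sub_cube e : e < r -> ccube x0 e `<=` D.
Proof. by move=> er x Hx k; exact: le_lt_trans (Hx k) er. Qed.

Lemma pd_out e (z : rV -> R) k x : (forall x, ~ ccube x0 e x -> z x = 0) ->
  ~ ccube x0 e x -> pd k z x = 0.
Proof.
move=> z0 nx; rewrite (@pd_eq _ _ k z (fun=> 0) (~` ccube x0 e)) ?pd_cst//.
exact/closed_openC/closed_ccube.
Qed.

Lemma integral_support (A : set rV) (f : borel rV -> \bar R) : (forall x, ~ A x -> f x = 0%E) ->
  (\int[leb]_x f x = \int[leb]_(x in A) f x)%E.
Proof.
move=> f0; rewrite [RHS]integral_mkcond; apply: eq_integral => x _.
by rewrite patchE; case: ifPn => // /negP xA; apply: f0 => Ax; apply: xA; rewrite inE.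
Qed.

(** The embedding of W^(1,4/3) into L^4 as an a priori bound on test functions. As a proposition it
    is proved dimension by dimension and used uniformly. *)
Definition sobolev_cube := forall Y : R, exists C : R, forall w, cube_test x0 r w ->
  (forall k, Int leb D (fun x => `|pd k w x| `^ (4 / 3)) <= Y) ->
  Int leb D (fun x => w x ^+ 4) <= C.

Lemma test_bmeas w : cube_test x0 r w -> bmeas (D : set (borel rV)) w.
Proof. by move=> [sw _]; exact: smooth_bmeas. Qed.

Lemma test_pd_bmeas k w : cube_test x0 r w -> bmeas (D : set (borel rV)) (pd k w).
Proof. by move=> [sw _]; apply: smooth_bmeas; exact: smooth_pd. Qed.

Lemma bmeas_abs (f : rV -> R) : bmeas (D : set (borel rV)) f -> bmeas (D : set (borel rV))
  (fun x => `|f x|).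
Proof.
move=> [mf [c hc]]; split; first exact: measurableT_comp.
by exists c => x Dx; rewrite normr_id hc.
Qed.

Lemma bmeas_pow p (f : rV -> R) : 0 <= p -> bmeas (D : set (borel rV)) f ->
  bmeas (D : set (borel rV)) (fun x => `|f x| `^ p).
Proof.
move=> p0 [mf [c hc]]; split; first exact: measurable_pow.
exists (`|c| `^ p) => x Dx; rewrite ger0_norm ?powR_ge0//; apply: powR_le => //.
exact: le_trans (hc x Dx) (ler_norm _).
Qed.

Lemma bmeasX n (f : rV -> R) : bmeas (D : set (borel rV)) f ->
  bmeas (D : set (borel rV)) (fun x => f x ^+ n).
Proof.
move=> bf; elim: n => [|n IH].
  by apply: bmeas_eq (bmeas_cst _ 1) => x _; rewrite expr0.
by apply: bmeas_eq (bmeasM bf IH) => x _; rewrite exprS.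
Qed.

End Support.

Lemma expr4_norm (R : realDomainType) (x : R) : x ^+ 4 = `|x| ^+ 4.
Proof. by rewrite -normrX ger0_norm// exprn_even_ge0. Qed.

(** [|w|] is at most the L^1 norm of its derivative, and t <= 1 + t^(4/3) bounds that norm by
    [V + Y]. *)
Lemma sobolev_cube1 (R : realType) (leb : {measure set (borel 'rV[R]_1) -> \bar R})
  (x0 : 'rV[R]_1) (r : R) : is_lebesgue leb -> sobolev_cube leb x0 r.
Proof.
move=> Hleb Y; have fD := leb_cube_lty Hleb x0 r; have mD := measurable_cube x0 r.
set V := fine (leb (cube x0 r)).
exists ((V + Y) ^+ 4 * V) => w tw HY; have [sw [e er w0]] := tw.
have bw := test_bmeas tw; have bp := test_pd_bmeas 0 tw.
have Lp : L1 leb (cube x0 r) (fun x => `|pd 0 w x|) by apply: bmeas_L1 => //; exact: bmeas_abs.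
have V0 : 0 <= V by exact: fine_ge0.
have h43 : (1 : R) <= 4 / 3 by lra.
have LP : L1 leb (cube x0 r) (fun x => `|pd 0 w x| `^ (4 / 3)).
  by apply: bmeas_L1 => //; apply: bmeas_pow => //; lra.
have hw x : `|w x| <= V + Y.
  have := sup_bound Hleb sw w0 x.
  rewrite (@integral_support _ _ _ (cube x0 r)); last first.
    move=> y nDy; rewrite (@pd_out _ _ x0 e) ?normr0// => cy.
    by apply: nDy; exact: ccube_sub_cube cy.
  rewrite -(Int_fin mD Lp) lee_fin => H; apply: le_trans H _.
  apply: (@le_trans _ _ (Int leb (cube x0 r) (fun x => 1 + `|pd 0 w x| `^ (4 / 3)))).
    apply: Int_le => //.
      by apply: L1D => //; exact: L1_cst.
    by move=> y Dy; exact: powR_ge_id.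
  rewrite (IntD mD)//; last exact: L1_cst.
  by apply: lerD; last exact: HY; rewrite /Int Rintegral_cst// mul1r.
rewrite -(@Rintegral_cst _ _ R leb _ mD); apply: Int_le => //.
- by apply: bmeas_L1 => //; exact: bmeasX.
- exact: L1_cst.
- by move=> x Dx; rewrite expr4_norm; apply: lerXn2r; rewrite ?nnegrE// (le_trans _ (hw x)).
Qed.

(** Young's inequality with exponents 4 and 4/3 for [|a| / u^3] and [|b| * u^3]; the weight [u]
    balances the two terms in [sobolev_cube2]. *)
Lemma young_43 (R : realType) (a b u : R) : 0 < u ->
  `|a| * `|b| <= a ^+ 4 / u ^+ 12 / 4 + 3 / 4 * (u ^+ 4 * `|b| `^ (4 / 3)).
Proof.
move=> u0; have u3 : 0 < u ^+ 3 by rewrite exprn_gt0.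
have := @conjugate_powR R (`|a| / u ^+ 3) (`|b| * u ^+ 3) 4 (4 / 3).
have h1 : 0 <= `|a| / u ^+ 3 by apply: divr_ge0 => //; exact: ltW.
have h2 : 0 <= `|b| * u ^+ 3 by apply: mulr_ge0 => //; exact: ltW.
rewrite h1 h2 => /(_ isT isT).
have -> : `|a| / u ^+ 3 * (`|b| * u ^+ 3) = `|a| * `|b| by field; rewrite gt_eqF.
move=> H; apply: le_trans (H _ _ _) _; [lra|lra|by field|].
apply: lerD.
  by rewrite (_ : (4 : R) = 4%:R)// powR_mulrn// expr_div_n -expr4_norm -exprM.
rewrite powRM ?(ltW u3)// -(@powR_mulrn _ u 3) ?(ltW u0)// -powRrM.
rewrite (_ : 3%:R * (4 / 3) = 4%:R :> R); last by field.
rewrite powR_mulrn ?(ltW u0)// le_eqVlt; apply/orP; left; apply/eqP.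
by field.
Qed.

(** Absorption: [u^24 <= 4 B^2] gives [u^12 <= 2 B], and [2 B] contains [u^12 / 2], which moves to
    the left. Dividing by [u^4] leaves [u^8 <= 3 Y], whose cube is the claim. *)
Lemma sobolev2_arith (R : realType) (X Y P Q u : R) : 0 < u -> 0 <= Y -> 0 <= P -> 0 <= Q ->
  u ^+ 24 = X -> X <= 4 * (P * Q) -> P <= u ^+ 12 / 4 + 3 / 4 * (u ^+ 4 * Y) ->
  Q <= u ^+ 12 / 4 + 3 / 4 * (u ^+ 4 * Y) -> X <= 27 * Y ^+ 3.
Proof.
move=> u0 Y0 P0 Q0 uX XP HP HQ.
set B := u ^+ 12 / 4 + 3 / 4 * (u ^+ 4 * Y) in HP HQ.
have XB : u ^+ 24 <= 4 * (B * B).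
  by rewrite uX; apply: le_trans XP _; rewrite ler_wpM2l//; apply: ler_pM.
have B0 : 0 <= B by exact: le_trans HP.
have h12 : u ^+ 12 <= 2 * B.
  rewrite -ler_sqr ?nnegrE ?exprn_ge0 ?(ltW u0) ?mulr_ge0// -exprM.
  by apply: le_trans XB _; rewrite le_eqVlt; apply/orP; left; apply/eqP; ring.
have u4 : 0 < u ^+ 4 by rewrite exprn_gt0.
have h8 : u ^+ 8 <= 3 * Y.
  rewrite -(ler_pM2l u4) -exprD /=.
  have : u ^+ 12 <= u ^+ 12 / 2 + 3 / 2 * (u ^+ 4 * Y).
    by apply: le_trans h12 _; rewrite /B le_eqVlt; apply/orP; left; apply/eqP; field.
  move: (u ^+ 12) (u ^+ 4) => a b; clear; lra.
rewrite -uX (_ : u ^+ 24 = (u ^+ 8) ^+ 3); last by rewrite -exprM.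
rewrite (_ : 27 * Y ^+ 3 = (3 * Y) ^+ 3); last by ring.
by apply: lerXn2r; rewrite ?nnegrE ?exprn_ge0 ?mulr_ge0 ?(ltW u0).
Qed.

Lemma ler_mul34 (R : realType) (a b c : R) : 0 <= a -> b <= c -> 3 / 4 * a * b <= 3 / 4 * (a * c).
Proof. by move=> a0 bc; rewrite -mulrA ler_wpM2l // ler_wpM2l. Qed.

(** [gagliardo] applied to [w^2] bounds [X] by [4 * (P 0 * P 1)], with [P k] the integral of
    [|w| * |pd k w|]. Young's inequality bounds [P k] by a fraction of the square root of [X] and a
    multiple of [Y], and the former is absorbed. *)
Lemma sobolev_cube2 (R : realType) (leb : {measure set (borel 'rV[R]_2) -> \bar R})
  (x0 : 'rV[R]_2) (r : R) : is_lebesgue leb -> sobolev_cube leb x0 r.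
Proof.
move=> Hleb Y; have fD := leb_cube_lty Hleb x0 r; have mD := measurable_cube x0 r.
exists (27 * Y ^+ 3) => w tw HY; have [sw [e er w0]] := tw.
have bw := test_bmeas tw; have bp k := test_pd_bmeas k tw.
have Y0 : 0 <= Y by apply: le_trans (HY 0); apply: Int_ge0 => x _; exact: powR_ge0.
set X := Int _ _ _.
have X0 : 0 <= X by apply: Int_ge0 => x _; rewrite expr4_norm exprn_ge0.
have [Xgt|] := ltP 0 X; last by move=> /le_trans; apply; rewrite mulr_ge0// exprn_ge0.
pose W x := w x * w x.
have sW : smooth setT W by move=> p; apply: CkM; [exact: openT|exact: sw|exact: sw].
have W0 x : ~ ccube x0 e x -> W x = 0 by move=> /w0; rewrite /W => ->; rewrite mul0r.
have pW k x : pd k W x = 2 * (w x * pd k w x).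
  by rewrite pdM; [ring|exact: (smooth_diff sw)|exact: (smooth_diff sw)].
pose P k := Int leb (cube x0 r) (fun x => `|w x| * `|pd k w x|).
have LPk k : L1 leb (cube x0 r) (fun x => `|w x| * `|pd k w x|).
  by apply: bmeas_L1 => //; apply: bmeasM; exact: bmeas_abs.
have LX : L1 leb (cube x0 r) (fun x => w x ^+ 4) by apply: bmeas_L1 => //; exact: bmeasX.
have XP : X <= 4 * (P 0 * P 1).
  have := gagliardo Hleb sW W0.
  have S (f : 'rV[R]_2 -> R) : (forall x, ~ ccube x0 e x -> f x = 0) ->
      L1 leb (cube x0 r) f -> (\int[leb]_x (f x)%:E = (Int leb (cube x0 r) f)%:E)%E.
    move=> f0 Lf; rewrite (@integral_support _ _ _ (cube x0 r)) ?Int_fin// => x nDx.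
    by rewrite f0// => cx; apply: nDx; exact: ccube_sub_cube cx.
  have S1 : (\int[leb]_x (W x ^+ 2)%:E = X%:E)%E.
    rewrite S.
    - by congr EFin; apply: Int_eq => x _; rewrite /W; ring.
    - by move=> x /W0 ->; rewrite expr0n.
    - by apply: (L1_eq mD (f := fun x => w x ^+ 4)) LX => x _; rewrite /W; ring.
  have S2 k : (\int[leb]_x `|pd k W x|%:E = (2 * P k)%:E)%E.
    have E x : `|pd k W x| = 2 * (`|w x| * `|pd k w x|).
      by rewrite pW !normrM ger0_norm.
    rewrite S.
    - congr EFin; rewrite /P -(IntZ mD)//; exact: Int_eq.
    - by move=> x nx; rewrite (pd_out k W0 nx) normr0.
    - apply: (L1_eq mD (f := fun x => 2 * (`|w x| * `|pd k w x|))); last exact: L1Z.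
      by move=> x _; rewrite E.
  rewrite S1 !S2 -EFinM lee_fin => H; apply: le_trans H _.
  by move: (P 0) (P 1) => a b; lra.
(* With X = u^24 the first term of Young's inequality, X / (4 u^12), equals u^12 / 4, small enough
   to be absorbed. *)
pose u := X `^ (24%:R^-1).
have u0 : 0 < u by exact: powR_gt0.
have uX : u ^+ 24 = X by rewrite -powR_mulrn ?(ltW u0)// -powRrM mulVf// powRr1.
have LYk k : L1 leb (cube x0 r) (fun x => `|pd k w x| `^ (4 / 3)).
  by apply: bmeas_L1 => //; apply: bmeas_pow => //; lra.
have HP k : P k <= u ^+ 12 / 4 + 3 / 4 * (u ^+ 4 * Y).
  apply: (@le_trans _ _ (Int leb (cube x0 r) (fun x =>
    (u ^+ 12)^-1 / 4 * w x ^+ 4 + 3 / 4 * u ^+ 4 * `|pd k w x| `^ (4 / 3)))).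
    apply: Int_le => //; first by apply: L1D => //; exact: L1Z.
    move=> x Dx; apply: le_trans (young_43 (w x) (pd k w x) u0) _.
    by rewrite le_eqVlt; apply/orP; left; apply/eqP; ring.
  rewrite (IntD mD) ?(IntZ mD)//; [|exact: L1Z|exact: L1Z].
  apply: lerD.
    rewrite -/X -uX le_eqVlt; apply/orP; left; apply/eqP.
    by field; rewrite gt_eqF.
  by apply: ler_mul34; [rewrite exprn_ge0// ltW|exact: HY].
have P0 k : 0 <= P k by apply: Int_ge0 => x _; exact: mulr_ge0.
exact: (sobolev2_arith u0 Y0 (P0 0) (P0 1) uX XP (HP 0) (HP 1)).
Qed.

(** * Fourth powers under convergence in L^1 *)

Section Truncation.
Context {d : measure_display} {T : measurableType d} {R : realType}.
Variables (mu : {measure set T -> \bar R}) (D : set T).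
Hypothesis mD : measurable D.
Hypothesis fD : (mu D < +oo)%E.

Lemma L1_comb (c a b : R) f g : L1 mu D f -> L1 mu D g -> L1 mu D (fun x =>
  c * (a * f x + b * g x)).
Proof. by move=> Lf Lg; apply: L1Z => //; apply: L1D => //; exact: L1Z. Qed.

Lemma Int_comb (c a b : R) f g : L1 mu D f -> L1 mu D g ->
  Int mu D (fun x => c * (a * f x + b * g x)) = c * (a * Int mu D f + b * Int mu D g).
Proof.
move=> Lf Lg; have La := L1Z mD a Lf; have Lb := L1Z mD b Lg.
by rewrite IntZ ?IntD ?IntZ//; exact: L1D.
Qed.

(** The fourth power cut at level [M] is Lipschitz, so its integral is continuous under L^1
    convergence. *)
Definition trunc4 (M x : R) : R := Num.min `|x| M ^+ 4.

Lemma trunc4_bounds (M x : R) : 0 <= M -> 0 <= Num.min `|x| M <= M.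
Proof. by move=> M0; rewrite le_min normr_ge0 M0 ge_min lexx orbT. Qed.

Lemma trunc4_ge0 (M x : R) : 0 <= M -> 0 <= trunc4 M x.
Proof. by move=> M0; rewrite exprn_ge0// le_min normr_ge0. Qed.

Lemma trunc4_le (M x : R) : 0 <= M -> trunc4 M x <= x ^+ 4.
Proof.
move=> M0; rewrite /trunc4 [leRHS]expr4_norm; apply: lerXn2r; rewrite ?nnegrE ?le_min ?normr_ge0//.
by rewrite ge_min lexx.
Qed.

Lemma pow4_lip (M a b : R) : 0 <= a <= M -> 0 <= b <= M ->
  a ^+ 4 <= b ^+ 4 + 4 * M ^+ 3 * `|a - b|.
Proof.
move=> /andP[a0 aM] /andP[b0 bM].
have M0 : 0 <= M by exact: le_trans aM.
have -> : a ^+ 4 = b ^+ 4 + (a ^+ 3 + a ^+ 2 * b + a * b ^+ 2 + b ^+ 3) * (a - b) by ring.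
rewrite lerD2l; apply: (@le_trans _ _ ((a ^+ 3 + a ^+ 2 * b + a * b ^+ 2 + b ^+ 3) * `|a - b|)).
  by rewrite ler_wpM2l ?ler_norm// !addr_ge0// ?mulr_ge0// exprn_ge0.
rewrite ler_wpM2r//.
have X1 (x y z : R) : 0 <= x <= M -> 0 <= y <= M -> 0 <= z <= M -> x * (y * z) <= M ^+ 3.
  move=> /andP[x0 xM] /andP[y0 yM] /andP[z0 zM]; rewrite !exprS expr0 mulr1.
  by rewrite ler_pM// ?mulr_ge0// ler_pM.
have := X1 a a a; have := X1 a a b; have := X1 a b b; have := X1 b b b.
rewrite a0 aM b0 bM => /(_ isT isT isT) h1 /(_ isT isT isT) h2 /(_ isT isT isT)
  h3 /(_ isT isT isT) h4.
have -> : 4 * M ^+ 3 = M ^+ 3 + M ^+ 3 + M ^+ 3 + M ^+ 3 by ring.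
rewrite !lerD//.
by rewrite expr2 -mulrA.
Qed.

Lemma trunc4_lip (M x y : R) : 0 <= M -> trunc4 M x <= trunc4 M y + 4 * M ^+ 3 * `|x - y|.
Proof.
move=> M0; apply: le_trans (pow4_lip (trunc4_bounds x M0) (trunc4_bounds y M0)) _.
rewrite lerD2l ler_wpM2l//; first by rewrite mulr_ge0// exprn_ge0.
apply: (@le_trans _ _ `| `|x| - `|y| |); last exact: ler_dist_dist.
move: (`|x|) (`|y|) => {x y}x y; rewrite ler_norml.
have h1 := ler_norm (x - y); have h2 : y - x <= `|x - y| by rewrite distrC ler_norm.
move: (`|x - y|) h1 h2 => t h1 h2.
by rewrite !minElt; case: ltP => ?; case: ltP => ?; apply/andP; split; lra.
Qed.

Lemma measurable_trunc4 M (f : T -> R) : measurable_fun D f -> measurable_fun D (fun x =>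
  trunc4 M (f x)).
Proof.
move=> mf; apply: (@measurable_funX _ _ _ _ (fun x => Num.min `|f x| M) 4).
by apply: measurable_minr => //; exact: measurableT_comp.
Qed.

Lemma trunc4_L1 M (f : T -> R) : 0 <= M -> measurable_fun D f -> L1 mu D (fun x => trunc4 M (f x)).
Proof.
move=> M0 mf; apply: L1_bdd => //; first exact: measurable_trunc4.
exists (M ^+ 4) => x _; rewrite ger0_norm ?trunc4_ge0//.
have /andP[h0 h1] := trunc4_bounds (f x) M0.
by apply: lerXn2r => //; rewrite nnegrE.
Qed.

(** Monotone convergence: truncations at integer levels increase to [f^4]. *)
Lemma trunc4_bounded (f : T -> R) (C : R) : measurable_fun D f ->
  (forall n : nat, Int mu D (fun x => trunc4 n%:R (f x)) <= C) -> L1 mu D (fun x => f x ^+ 4).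
Proof.
move=> mf H; apply/integrableP; split.
  by apply/measurable_EFinP; exact: measurable_funX.
pose g (n : nat) x := (trunc4 n%:R (f x))%:E.
have E x : D x -> limn (g ^~ x) = (f x ^+ 4)%:E.
  move=> _; apply/cvg_lim => //; apply: cvg_near_cst.
  have [n Hn] : exists n : nat, `|f x| <= n%:R.
    by exists (Num.truncn `|f x|).+1; apply/ltW; rewrite truncnS_gt.
  exists n => // k /= nk; rewrite /g /trunc4 min_l -?expr4_norm//.
  by apply: le_trans Hn _; rewrite ler_nat.
have g0 n x : D x -> (0 <= g n x)%E by move=> _; rewrite lee_fin trunc4_ge0.
have mg n : measurable_fun D (g n) by apply/measurable_EFinP; exact: measurable_trunc4.
have ndg x : D x -> {homo g ^~ x : n m / (n <= m)%N >-> (n <= m)%E}.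
  move=> _ n m nm; rewrite lee_fin; apply: lerXn2r; rewrite ?nnegrE ?le_min ?normr_ge0 ?ler0n//.
  by rewrite ge_min lexx /= ge_min ler_nat nm orbT.
have := @cvg_monotone_convergence _ _ _ mu D mD _ mg g0 ndg.
rewrite (_ : (\int[mu]_(x in D) limn (g ^~ x) = \int[mu]_(x in D) `|(f x ^+ 4)%R%:E|)%E);
  last first.
  apply: eq_integral => x; rewrite inE => Dx; rewrite E//= ger0_norm//.
  by rewrite expr4_norm exprn_ge0.
move=> cv; apply: (@le_lt_trans _ _ C%:E); last exact: ltry.
rewrite -(cvg_lim _ cv)//; apply: lime_le; first by apply/cvg_ex; eexists; exact: cv.
by apply: nearW => n; rewrite -Int_fin ?lee_fin//; exact: trunc4_L1.
Qed.

End Truncation.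

Section SobolevL4.
Context {R : realType} {m : nat}.
Local Notation rV := 'rV[R]_m.
Variable leb : {measure set (borel rV) -> \bar R}.
Hypothesis Hleb : is_lebesgue leb.
Variables (x0 : rV) (r : R).
Hypothesis r0 : 0 < r.
Local Notation D := (cube x0 r).
Local Notation L1 := (L1 leb D).
Local Notation Int := (Int leb D).
Local Notation op := (op leb D).
Local Notation Lpow := (Lpow leb D).
Local Notation K := (landau leb r).

Let mD := measurable_cube x0 r.
Let fD := leb_cube_lty Hleb x0 r.
Let p : R := 4 / 3.
Let p0 : 0 <= p. Proof. by rewrite divr_ge0. Qed.
Let p1 : 1 <= p. Proof. by rewrite /p; lra. Qed.

(** [op_jensen] pointwise, then L^1 contraction for [|g|^p]; the integral of 1 in the bound stems
    from the additive 1 there. *)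
Lemma op_pow_bound g : Lpow p g -> exists C : R, forall n,
  L1 (fun x => `|op (K n) g x| `^ p) /\ Int (fun x => `|op (K n) g x| `^ p) <= C.
Proof.
move=> [mg Lgp]; have Lg := Lpow_L1 mD fD p1 (conj mg Lgp).
exists (Int (fun x => `|g x| `^ p) + Int (fun=> 1)) => n.
have mK := landau_submarkov Hleb x0 r0 n; have [sK _ _ _] := mK.
have bg : bmeas (D : set (borel rV)) (op (K n) g) by exact: op_bmeas.
have bp : bmeas (D : set (borel rV)) (fun x => `|op (K n) g x| `^ p) by exact: bmeas_pow.
have Lo : L1 (op (K n) (fun y => `|g y| `^ p)) by apply: bmeas_L1 => //; exact: op_bmeas.
have L11 : L1 (fun=> 1) by exact: L1_cst.
have Lb := bmeas_L1 mD fD bp.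
split=> //; apply: (@le_trans _ _ (Int (fun x => op (K n) (fun y => `|g y| `^ p) x + 1))).
  apply: Int_le => //; first exact: L1D.
  by move=> x Dx; apply: (op_jensen mD fD (q := 4)) => //; rewrite /p; [lra|field].
rewrite (IntD mD)// lerD2r; apply: op_contraction => // x _; exact: powR_ge0.
Qed.

(** The a priori bound is applied to [w n], the mollified [c * v] cut off by [b], whose derivatives
    are bounded in L^(4/3) uniformly in [n]. Since [w n] converges in L^1, the bound passes to the
    limit for fourth powers truncated at each level [M], hence for the full fourth power. *)
Theorem sobolev_L4 v (v' : 'I_m -> rV -> R) b c : sobolev_cube leb x0 r ->
  Lpow p v -> (forall k, Lpow p (v' k)) -> (forall k, cube_wpd leb x0 r k v (v' k)) ->
  cube_test x0 r b -> cube_test x0 r c -> L1 (fun x => (b x * (c x * v x)) ^+ 4).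
Proof.
move=> sob Lv Lv' wv tb tc; have [sb [e er b0]] := tb; have [sc _] := tc.
have bc := smooth_bmeas x0 r sc; have bpc k := smooth_bmeas x0 r (smooth_pd k sc).
have bb := smooth_bmeas x0 r sb; have bpb k := smooth_bmeas x0 r (smooth_pd k sb).
pose g x := c x * v x; pose h k x := c x * v' k x + v x * pd k c x.
have Lg : Lpow p g by exact: LpowM.
have Lh k : Lpow p (h k).
  apply: LpowD => //; first exact: LpowM.
  have [mm LL] := @LpowM _ _ _ leb D mD p v (pd k c) p0 Lv (bpc k).
  rewrite (_ : (fun x => v x * pd k c x) = fun x => pd k c x * v x)//.
  by apply/funext => x; rewrite mulrC.
have L1v := Lpow_L1 mD fD p1 Lv; have L1v' k := Lpow_L1 mD fD p1 (Lv' k).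
have L1g := Lpow_L1 mD fD p1 Lg.
pose w n x := b x * op (K n) g x.
have sF n := (smooth_op (landau_ssep leb r n) L1g).1.
have tw n : cube_test x0 r (w n) by exact: cube_testM.
have pw n k x : pd k (w n) x = pd k b x * op (K n) g x + b x * op (K n) (h k) x.
  rewrite pdM; [|exact: (smooth_diff sb)|exact: (smooth_diff (sF n))].
  by rewrite (mollified_pd n L1v (L1v' k) (wv k) tc).
have [Cg HCg] := op_pow_bound Lg.
have /choice[Ch HCh] := fun k => op_pow_bound (Lh k).
have Bd f : bmeas (D : set (borel rV)) f -> exists2 B : R, 0 <= B & forall x, D x -> `|f x| <= B.
  move=> [_ [B HB]]; exists `|B| => // x Dx; exact: le_trans (HB x Dx) (ler_norm _).
have [Bb Bb0 HBb] := Bd _ bb.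
have /choice[Bp HBp] : forall k, exists B : R, 0 <= B /\ forall x, D x -> `|pd k b x| <= B.
  by move=> k; have [B B0 HB] := Bd _ (bpb k); exists B.
pose Y k := 2 `^ p * (Bp k `^ p * Cg + Bb `^ p * Ch k).
have [C HC] := sob (\sum_k `|Y k|).
have HwC n : Int (fun x => w n x ^+ 4) <= C.
  apply: HC => // k; apply: (@le_trans _ _ (Y k)); last first.
    by rewrite (bigD1 k)//= (le_trans (ler_norm _))// lerDl sumr_ge0.
  have [Lo1 Io1] := HCg n; have [Lo2 Io2] := HCh k n.
  have Lp1 : L1 (fun x => `|pd k (w n) x| `^ p).
    by apply: bmeas_L1 => //; apply: bmeas_pow => //; exact: test_pd_bmeas.
  apply: (@le_trans _ _ (Int (fun x => 2 `^ p * (Bp k `^ p * `|op (K n)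
    g x| `^ p + Bb `^ p * `|op (K n) (h k) x| `^ p)))).
    apply: Int_le => //.
      exact: (L1_comb mD _ _ _ Lo1 Lo2).
    move=> x Dx; rewrite pw.
    apply: (@le_trans _ _ ((Bp k * `|op (K n) g x| + Bb * `|op (K n) (h k) x|) `^ p)).
      apply: powR_le => //; apply: le_trans (ler_normD _ _) _; rewrite !normrM.
      apply: lerD; apply: ler_wpM2r => //; last exact: HBb.
      exact: (HBp k).2.
    rewrite -!powRM//; last exact: (HBp k).1.
    by apply: powR_add => //; apply: mulr_ge0 => //; exact: (HBp k).1.
  rewrite (Int_comb mD _ _ _ Lo1 Lo2) /Y.
  by apply: ler_wpM2l; [exact: powR_ge0|apply: lerD; apply: ler_wpM2l => //; exact: powR_ge0].
have mf : measurable_fun (D : set (borel rV)) (fun x => b x * (c x * v x)).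
  by apply: measurable_funM; [case: bb|exact: L1_meas L1g].
have mw n : measurable_fun (D : set (borel rV)) (w n) by have [] := test_bmeas (tw n).
apply: (trunc4_bounded mD fD (C := C)) => // n.
set M : R := n%:R; have M0 : 0 <= M by exact: ler0n.
have cv := landau_cvg Hleb r0 L1g.
apply/ler_addgt0Pr => eps eps0.
have A0 : 0 < 4 * M ^+ 3 * Bb + 1.
  by apply: ltr_wpDl => //; apply: mulr_ge0 => //; apply: mulr_ge0 => //; exact: exprn_ge0.
have e0 : 0 < eps / (4 * M ^+ 3 * Bb + 1) by exact: divr_gt0.
move/cvgrPdist_le : cv => /(_ _ e0)[N _ /(_ N (leqnn N))].
rewrite /= sub0r normrN ger0_norm; last by apply: Int_ge0.
move=> HN.
have LB : L1 (fun x => `|op (K N) g x - g x|).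
  apply: L1_abs; apply: L1B => //; apply: bmeas_L1 => //; apply: op_bmeas => //.
  by have [] := landau_submarkov Hleb x0 r0 N.
apply: (@le_trans _ _ (Int (fun x => w N x ^+ 4 + 4 * M ^+ 3 * Bb * `|op (K N) g x - g x|))).
  apply: Int_le => //.
  - exact: trunc4_L1.
  - apply: L1D => //; last exact: L1Z.
    by apply: bmeas_L1 => //; apply: bmeasX; exact: test_bmeas.
  - move=> x Dx; apply: le_trans (trunc4_lip _ (w N x) M0) _.
    apply: lerD; first exact: trunc4_le.
    rewrite -(mulrA _ Bb); apply: ler_wpM2l; first by apply: mulr_ge0 => //; exact: exprn_ge0.
    rewrite /w -mulrBr normrM distrC; apply: ler_wpM2r => //; exact: HBb.
rewrite (IntD mD); [|by apply: bmeas_L1 => //; apply: bmeasX; exact: test_bmeas|exact: L1Z].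
rewrite (IntZ mD)//; apply: lerD => //.
move: HN; rewrite ler_pdivlMr// mulrC; apply: le_trans.
by apply: ler_wpM2r; [exact: Int_ge0|rewrite lerDl].
Qed.

End SobolevL4.

(** * Weak derivatives of products *)

Section WeakProducts.
Context {R : realType} {m : nat}.
Local Notation rV := 'rV[R]_m.
Variable leb : {measure set (borel rV) -> \bar R}.
Hypothesis Hleb : is_lebesgue leb.
Variables (x0 : rV) (r : R).
Hypothesis r0 : 0 < r.
Local Notation D := (cube x0 r).
Local Notation L1 := (L1 leb D).
Local Notation Int := (Int leb D).
Local Notation Lpow := (Lpow leb D).
Implicit Types (z c : rV -> R).

Let mD := measurable_cube x0 r.
Let fD := leb_cube_lty Hleb x0 r.

(** [a] is smooth on [D] only. The product is smooth on [D] and vanishes off the closed cube that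
    supports [z], and these two open sets cover the space. *)
Lemma cube_test_smul a z : smooth D a -> cube_test x0 r z -> cube_test x0 r (fun x => a x * z x).
Proof.
move=> sa [sz [e er z0]]; split; last by exists e => // x /z0 ->; rewrite mulr0.
move=> q; pose V (b : bool) : set rV := if b then D else ~` ccube x0 e.
have oV b : open (V b).
  by case: b; [exact: open_cube|exact/closed_openC/closed_ccube].
apply: (@Ck_sub _ _ _ (\bigcup_(b in setT) V b)).
  move=> x _; have [cx|ncx] := pselect (ccube x0 e x); last by exists false.
  by exists true => //; exact: ccube_sub_cube cx.
apply: Ck_bigcup => -[] _.
  by apply: CkM; [exact: (oV true)|exact: sa|apply: Ck_sub (sz q)].
by apply: (Ck_eq (oV false)) (Ck_cst q _ 0) => x nx; rewrite z0// mulr0.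
Qed.

Lemma Lpow4_L43 (u : rV -> R) : Lpow 4 u -> Lpow (4 / 3) u.
Proof.
move=> [mu Lu]; split=> //.
have h : 0 <= 4 / 3 :> R by lra.
apply: (@L1_le _ _ _ leb D mD _ (fun x => 1 + `|u x| `^ 4)); first exact: measurable_pow.
  move=> x _; rewrite (ger0_norm (powR_ge0 _ _)) [leRHS]ger0_norm ?addr_ge0 ?powR_ge0//.
  have [le1|/ltW ge1] := leP `|u x| 1.
    apply: (@le_trans _ _ (1 `^ (4 / 3))); first exact: powR_le.
    by rewrite powR1 lerDl powR_ge0.
  by apply: (@le_trans _ _ (`|u x| `^ 4)); [apply: ler_powR => //; lra|rewrite lerDr].
by apply: L1D => //; exact: L1_cst.
Qed.

Lemma dual_pair_4_43 (u v : rV -> R) : Lpow 4 u -> Lpow (4 / 3) v -> dual_pair leb D u v.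
Proof.
move=> Lu Lv; apply: (dual_pair_pow mD (p := 4) (q := 4 / 3)); rewrite ?divr_gt0//.
- by field.
- by apply: (Lpow_L1 mD fD (p := 4)) => //; lra.
- by apply: (Lpow_L1 mD fD (p := 4 / 3)) => //; lra.
- exact: Lu.2.
- exact: Lv.2.
Qed.

Lemma dual_pair_43_4 (u v : rV -> R) : Lpow (4 / 3) u -> Lpow 4 v -> dual_pair leb D u v.
Proof.
move=> Lu Lv; apply: (dual_pair_pow mD (p := 4 / 3) (q := 4)); rewrite ?divr_gt0//.
- by field.
- by apply: (Lpow_L1 mD fD (p := 4 / 3)) => //; lra.
- by apply: (Lpow_L1 mD fD (p := 4)) => //; lra.
- exact: Lu.2.
- exact: Lv.2.
Qed.

Definition sobolev4 u (u' : 'I_m -> rV -> R) := [/\ Lpow 4 u, forall k, Lpow (4 / 3) (u' k) &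
  forall k, cube_wpd leb x0 r k u (u' k)].

(** Tests are products [c * z] of two test functions, the form that [product_rule] delivers: [c]
    cuts off before mollification and [z] after it. *)
Definition weak_diff F (F' : 'I_m -> rV -> R) := [/\ L1 F, forall k, L1 (F' k) & forall k c z,
  cube_test x0 r c -> cube_test x0 r z ->
  Int (fun x => F x * pd k (fun y => c y * z y) x) = - Int (fun x => F' k x * (c x * z x))].

Lemma cube_testP z : cube_test x0 r z -> bmeas (D : set (borel rV)) z /\
  forall k, bmeas (D : set (borel rV)) (pd k z).
Proof. by move=> tz; split; [exact: test_bmeas|move=> k; exact: test_pd_bmeas]. Qed.

Lemma cube_testMM c z : cube_test x0 r c -> cube_test x0 r z -> cube_test x0 r (fun x => c x * z x).
Proof. by move=> tc [sz _]; exact: cube_testM. Qed.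

(** [product_rule] for the vector field with [u] in direction [k] as its only component; in the sign
    convention of [weak_div] its divergence is [- u' k]. *)
Lemma weak_diff_mul u u' v v' : sobolev4 u u' -> sobolev4 v v' ->
  weak_diff (fun x => u x * v x) (fun k x => u' k x * v x + u x * v' k x).
Proof.
move=> [Lu Lu' wu] [Lv Lv' wv].
have p43 : 1 <= 4 / 3 :> R by lra.
have p430 : 0 <= 4 / 3 :> R by lra.
have p4 : 1 <= 4 :> R by lra.
have p40 : 0 <= 4 :> R by [].
have L1u := Lpow_L1 mD fD p4 Lu; have L1v := Lpow_L1 mD fD p4 Lv.
have L1u' k := Lpow_L1 mD fD p43 (Lu' k); have L1v' k := Lpow_L1 mD fD p43 (Lv' k).
have Luv : L1 (fun x => u x * v x).
  exact: dual_pair_L1 (dual_pair_43_4 (Lpow4_L43 Lv) Lu).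
have Luv' k : L1 (fun x => u x * v' k x) by exact: dual_pair_L1 (dual_pair_43_4 (Lv' k) Lu).
have Lu'v k : L1 (fun x => u' k x * v x) by exact: dual_pair_L1 (dual_pair_4_43 Lv (Lu' k)).
split=> // [k|k c z tc tz]; first exact: L1D.
have [bc bpc] := cube_testP tc; have [bz bpz] := cube_testP tz.
have [bcz bpcz] := cube_testP (cube_testMM tc tz).
pose U (l : 'I_m) x := if l == k then u x else 0.
pose f x := - u' k x.
have LU l : Lpow 4 (U l).
  rewrite /U; case: eqP => // _; split; first exact: measurable_cst.
  by apply: (L1_eq mD (f := fun=> 0)) (L1_0 _ _) => x _; rewrite normr0 powR0//; lra.
have L1U l := Lpow_L1 mD fD p4 (LU l).
have Lf : Lpow (4 / 3) f.
  by have := @LpowM _ _ _ leb D mD _ _ _ p430 (Lu' k) (bmeas_cst (D : set (borel rV)) (-1));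
    congr (Lpow _ _); apply/funext => x; rewrite mulN1r.
have L1f := Lpow_L1 mD fD p43 Lf.
have IntU g : \sum_l Int (fun x => U l x * g l x) = Int (fun x => u x * g k x).
  rewrite (bigD1 k)//= big1 ?addr0 => [|l lk].
    by apply: Int_eq => x _; rewrite /U eqxx.
  by rewrite -(Int0 leb mD); apply: Int_eq => x _; rewrite /U (negPf lk) mul0r.
have wdU : weak_div leb x0 r U f.
  move=> w tw; rewrite (IntU (fun l => pd l w)) wu// -(IntN mD).
    by apply: Int_eq => x _; rewrite mulNr.
  by apply: bmeasM_L1 => //; exact: (cube_testP tw).1.
have swap p g w : 0 <= p -> Lpow p g -> bmeas (D : set (borel rV)) w -> Lpow p (fun x => g x * w x).
  move=> pp Lg bw; have := LpowM mD pp Lg bw.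
  by congr (Lpow _ _); apply/funext => x; rewrite mulrC.
have := product_rule Hleb r0 L1U L1f L1v L1v' wdU wv tc tz.
have H1 l : dual_pair leb D (fun x => c x * v x) (fun x => U l x * pd l z x).
  apply: dual_pair_4_43; first exact: LpowM.
  by apply: swap => //; exact: Lpow4_L43.
have H2 l : dual_pair leb D (fun x => c x * v' l x + v x * pd l c x) (fun x => U l x * z x).
  apply: dual_pair_43_4; last exact: swap.
  apply: LpowD => //; first exact: LpowM.
  by apply: swap => //; exact: Lpow4_L43.
have H3 : dual_pair leb D (fun x => c x * v x) (fun x => f x * z x).
  by apply: dual_pair_4_43; [exact: LpowM|exact: swap].
move=> /(_ H1 H2 H3).
rewrite (IntU (fun l x => v' l x * (c x * z x) + v x * pd l (fun y => c y * z y) x)) => E.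
have A1 : L1 (fun x => u x * v' k x * (c x * z x)) by exact: bmeasM_L1.
have A2 : L1 (fun x => u x * v x * pd k (fun y => c y * z y) x) by exact: bmeasM_L1.
have A3 : L1 (fun x => u' k x * v x * (c x * z x)) by exact: bmeasM_L1.
have E1 : Int (fun x => u x * (v' k x * (c x * z x) + v x * pd k (fun y => c y * z y) x)) =
    Int (fun x => u x * v' k x * (c x * z x)) + Int (fun x => u x * v x * pd k (fun y =>
      c y * z y) x).
  by rewrite -(IntD mD)//; apply: Int_eq => x _; ring.
have E2 : Int (fun x => f x * v x * (c x * z x)) = - Int (fun x => u' k x * v x * (c x * z x)).
  by rewrite -(IntN mD)//; apply: Int_eq => x _; rewrite /f; ring.
have E3 : Int (fun x => (u' k x * v x + u x * v' k x) * (c x * z x)) =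
   Int (fun x => u' k x * v x * (c x * z x)) + Int (fun x => u x * v' k x * (c x * z x)).
  by rewrite -(IntD mD)//; apply: Int_eq => x _; ring.
move: E; rewrite E1 E2 E3.
move: (Int _) (Int _) (Int _) => P Q T; lra.
Qed.

Lemma weak_diffD F F' G G' : weak_diff F F' -> weak_diff G G' ->
  weak_diff (fun x => F x + G x) (fun k x => F' k x + G' k x).
Proof.
move=> [LF LF' wF] [LG LG' wG]; split=> [|k|k c z tc tz]; [exact: L1D|exact: L1D|].
have [bcz bpcz] := cube_testP (cube_testMM tc tz).
have -> : Int (fun x => (F x + G x) * pd k (fun y => c y * z y) x) =
   Int (fun x => F x * pd k (fun y => c y * z y) x) + Int (fun x => G x * pd k (fun y =>
     c y * z y) x).
  rewrite -(IntD mD); [by apply: Int_eq => x _; rewrite mulrDl|exact: bmeasM_L1..].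
have -> : Int (fun x => (F' k x + G' k x) * (c x * z x)) =
   Int (fun x => F' k x * (c x * z x)) + Int (fun x => G' k x * (c x * z x)).
  rewrite -(IntD mD); [by apply: Int_eq => x _; rewrite mulrDl|exact: bmeasM_L1..].
by rewrite wF// wG// opprD.
Qed.

Lemma weak_diffZ (a : R) F F' : weak_diff F F' ->
  weak_diff (fun x => a * F x) (fun k x => a * F' k x).
Proof.
move=> [LF LF' wF]; split=> [|k|k c z tc tz]; [exact: L1Z|exact: L1Z|].
have [bcz bpcz] := cube_testP (cube_testMM tc tz).
have -> : Int (fun x => a * F x * pd k (fun y => c y * z y) x) =
   a * Int (fun x => F x * pd k (fun y => c y * z y) x).
  rewrite -(IntZ mD); [by apply: Int_eq => x _; ring|exact: bmeasM_L1].
have -> : Int (fun x => a * F' k x * (c x * z x)) = a * Int (fun x => F' k x * (c x * z x)).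
  rewrite -(IntZ mD); [by apply: Int_eq => x _; ring|exact: bmeasM_L1].
by rewrite wF// mulrN.
Qed.

Lemma weak_diff0 : weak_diff (fun=> 0) (fun _ _ => 0).
Proof.
have L0 : L1 (fun=> 0) by exact: L1_0.
have I0 g : Int (fun x => 0 * g x) = 0.
  by transitivity (Int (fun=> 0)); [apply: Int_eq => x _; rewrite mul0r|exact: Int0].
by split=> // k c z tc tz; rewrite !I0 oppr0.
Qed.

Lemma weak_diff_sum (I : Type) (s : seq I) (F : I -> rV -> R) (F' : I -> 'I_m -> rV -> R) :
  (forall i, weak_diff (F i) (F' i)) ->
  weak_diff (fun x => \sum_(i <- s) F i x) (fun k x => \sum_(i <- s) F' i k x).
Proof.
move=> H; elim: s => [|i s IH].
  have -> : (fun x => \sum_(i <- [::]) F i x) = fun=> 0 by apply/funext => x; rewrite big_nil.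
  have -> : (fun k x => \sum_(i <- [::]) F' i k x) = fun _ _ => 0.
    by apply/funext => k; apply/funext => x; rewrite big_nil.
  exact: weak_diff0.
have -> : (fun x => \sum_(j <- i :: s) F j x) = fun x => F i x + \sum_(j <- s) F j x.
  by apply/funext => x; rewrite big_cons.
have -> : (fun k x => \sum_(j <- i :: s) F' j k x) = fun k x => F' i k x + \sum_(j <- s) F' j k x.
  by apply/funext => k; apply/funext => x; rewrite big_cons.
exact: weak_diffD.
Qed.

(** The coefficient is moved into the test function, [a * z] being one again, and Leibniz's rule on
    [a * (c * z)] gives the term with [pd k a]. *)
Lemma weak_diff_smul F F' a k c z : weak_diff F F' -> smooth D a ->
  cube_test x0 r c -> cube_test x0 r z ->
  L1 (fun x => a x * F' k x * (c x * z x)) -> L1 (fun x => pd k a x * F x * (c x * z x)) ->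
  Int (fun x => a x * F x * pd k (fun y => c y * z y) x) =
  - Int (fun x => (a x * F' k x + pd k a x * F x) * (c x * z x)).
Proof.
move=> [LF LF' wF] sa tc tz A1 A2; have taz := cube_test_smul sa tz.
have [bcaz bpcaz] := cube_testP (cube_testMM tc taz).
have [sc _] := tc; have [sz _] := tz.
have E x : D x -> F x * pd k (fun y => c y * (a y * z y)) x =
    a x * F x * pd k (fun y => c y * z y) x + pd k a x * F x * (c x * z x).
  move=> Dx.
  have da : differentiable a x by exact: (sa 1).1.
  have dcz : differentiable (fun y => c y * z y) x.
    by apply: differentiableM; [exact: (smooth_diff sc)|exact: (smooth_diff sz)].
  have -> : (fun y => c y * (a y * z y)) = fun y => a y * (c y * z y).
    by apply/funext => y; ring.
  by rewrite (pdM k da dcz); ring.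
have LE : L1 (fun x => F x * pd k (fun y => c y * (a y * z y)) x) by exact: bmeasM_L1.
have A3 : L1 (fun x => a x * F x * pd k (fun y => c y * z y) x).
  by apply: (L1_eq mD _ (L1B mD LE A2)) => x Dx; rewrite E// addrK.
have := wF k _ _ tc taz; rewrite (Int_eq leb E) (IntD mD)// => E2.
have E3 : Int (fun x => F' k x * (c x * (a x * z x))) = Int (fun x => a x * F' k x * (c x * z x)).
  by apply: Int_eq => x _; ring.
have E4 : Int (fun x => (a x * F' k x + pd k a x * F x) * (c x * z x)) =
  Int (fun x => a x * F' k x * (c x * z x)) + Int (fun x => pd k a x * F x * (c x * z x)).
  by rewrite -(IntD mD)//; apply: Int_eq => x _; ring.
rewrite E4; move: E2; rewrite E3.
move: (Int _) (Int _) (Int _) => P Q T; lra.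
Qed.

End WeakProducts.

(** * Spinor algebra *)

Section Hermitian.
Context {R : realType}.
Local Notation C := R[i].
Local Notation rc := (real_complex R).

Definition adj (p q : nat) (A : 'M[C]_(p, q)) : 'M[C]_(q, p) := (map_mx (@conjc R) A)^T.

Lemma adjM p q s (A : 'M[C]_(p, q)) (B : 'M[C]_(q, s)) : adj (A *m B) = adj B *m adj A.
Proof. by rewrite /adj map_mxM trmx_mul. Qed.

Lemma adjD p q (A B : 'M[C]_(p, q)) : adj (A + B) = adj A + adj B.
Proof. by apply/matrixP => i j; rewrite !mxE rmorphD. Qed.

Lemma adjZ p q (x : R) (A : 'M[C]_(p, q)) : adj (rc x *: A) = rc x *: adj A.
Proof. by apply/matrixP => i j; rewrite !mxE rmorphM; congr (_ * _); exact: conjc_real. Qed.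

Lemma adj_sum p q (I : finType) (F : I -> 'M[C]_(p, q)) :
  adj (\sum_i F i) = \sum_i adj (F i).
Proof.
apply: (big_ind2 (fun x y => adj x = y)) => //; last by move=> x1 x2 y1 y2 <- <-; exact: adjD.
by apply/matrixP => i j; rewrite !mxE conjc0.
Qed.

Lemma adj1 n : adj (1%:M : 'M[C]_n) = 1%:M.
Proof. by rewrite /adj map_mx1 trmx1. Qed.

Lemma ReD (x y : C) : complex.Re (x + y) = complex.Re x + complex.Re y.
Proof. by case: x y => [a b] [c e]. Qed.

Lemma ReN (x : C) : complex.Re (- x) = - complex.Re x.
Proof. by case: x. Qed.

Lemma ReZ (a : R) (x : C) : complex.Re (rc a * x) = a * complex.Re x.
Proof. by case: x => [u v] /=; rewrite mul0r subr0. Qed.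

Lemma Re_sum (I : finType) (F : I -> C) : complex.Re (\sum_i F i) = \sum_i complex.Re (F i).
Proof. by apply: (big_ind2 (fun x y => complex.Re x = y)) => // x1 x2 y1 y2 <- <-; exact: ReD. Qed.

Lemma ReJ (x : C) : complex.Re (conjc x) = complex.Re x.
Proof. by case: x. Qed.

Variable N : nat.
Implicit Types u v : 'cV[C]_N.

Lemma hprodE u v : hprod u v = (adj u *m v) 0 0.
Proof. by rewrite mxE; apply: eq_bigr => a _; rewrite !mxE. Qed.

Lemma hprod_adj (A : 'M[C]_N) u v : hprod (A *m u) v = hprod u (adj A *m v).
Proof. by rewrite !hprodE adjM -mulmxA. Qed.

Lemma hprod_unitary (T : 'M[C]_N) u v : adj T *m T = 1%:M -> hprod (T *m u) (T *m v) = hprod u v.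
Proof. by move=> HT; rewrite hprod_adj mulmxA HT mul1mx. Qed.

Lemma hprodJ u v : hprod v u = conjc (hprod u v).
Proof.
rewrite /hprod rmorph_sum; apply: eq_bigr => a _.
by rewrite rmorphM /= conjcK mulrC.
Qed.

Lemma hprodDl u1 u2 v : hprod (u1 + u2) v = hprod u1 v + hprod u2 v.
Proof. by rewrite !hprodE adjD mulmxDl mxE. Qed.

Lemma hprodDr u v1 v2 : hprod u (v1 + v2) = hprod u v1 + hprod u v2.
Proof. by rewrite !hprodE mulmxDr mxE. Qed.

Lemma hprodZr c u v : hprod u (c *: v) = c * hprod u v.
Proof. by rewrite !hprodE -scalemxAr mxE. Qed.

Lemma hprodZl c u v : hprod (c *: u) v = conjc c * hprod u v.
Proof. by rewrite hprodJ hprodZr rmorphM /= -hprodJ. Qed.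

Lemma hprodNl u v : hprod (- u) v = - hprod u v.
Proof. by rewrite !hprodE /adj map_mxN linearN /= mulNmx mxE. Qed.

Lemma hprod_suml (I : finType) (F : I -> 'cV[C]_N) v :
  hprod (\sum_i F i) v = \sum_i hprod (F i) v.
Proof.
apply: (big_ind2 (fun x y => hprod x v = y)) => //; last by move=> x1 x2 y1 y2 <- <-;
  exact: hprodDl.
by rewrite /hprod big1// => a _; rewrite mxE conjc0 mul0r.
Qed.

Lemma hprod_sumr (I : finType) (F : I -> 'cV[C]_N) u :
  hprod u (\sum_i F i) = \sum_i hprod u (F i).
Proof.
apply: (big_ind2 (fun x y => hprod u x = y)) => //; last by move=> x1 x2 y1 y2 <- <-;
  exact: hprodDr.
by rewrite /hprod big1// => a _; rewrite mxE mulr0.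
Qed.

Definition rprod u v : R := complex.Re (hprod u v).

Lemma rprodC u v : rprod u v = rprod v u.
Proof. by rewrite /rprod hprodJ ReJ. Qed.

Lemma rprodDl u1 u2 v : rprod (u1 + u2) v = rprod u1 v + rprod u2 v.
Proof. by rewrite /rprod hprodDl ReD. Qed.

Lemma rprodNl u v : rprod (- u) v = - rprod u v.
Proof. by rewrite /rprod hprodNl ReN. Qed.

Lemma rprodBl u1 u2 v : rprod (u1 - u2) v = rprod u1 v - rprod u2 v.
Proof. by rewrite rprodDl rprodNl. Qed.

Lemma rprodZl (c : R) u v : rprod (rc c *: u) v = c * rprod u v.
Proof. by rewrite /rprod hprodZl conjc_real ReZ. Qed.

Lemma rprod_suml (I : finType) (F : I -> 'cV[C]_N) v :
  rprod (\sum_i F i) v = \sum_i rprod (F i) v.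
Proof. by rewrite /rprod hprod_suml Re_sum. Qed.

Lemma rprodDr u v1 v2 : rprod u (v1 + v2) = rprod u v1 + rprod u v2.
Proof. by rewrite !(rprodC u) rprodDl. Qed.

Lemma rprodNr u v : rprod u (- v) = - rprod u v.
Proof. by rewrite !(rprodC u) rprodNl. Qed.

Lemma rprodBr u v1 v2 : rprod u (v1 - v2) = rprod u v1 - rprod u v2.
Proof. by rewrite rprodDr rprodNr. Qed.

Lemma rprodZr (c : R) u v : rprod u (rc c *: v) = c * rprod u v.
Proof. by rewrite !(rprodC u) rprodZl. Qed.

Lemma rprod_sumr (I : finType) (F : I -> 'cV[C]_N) u :
  rprod u (\sum_i F i) = \sum_i rprod u (F i).
Proof. by rewrite rprodC rprod_suml; apply: eq_bigr => i _; exact: rprodC. Qed.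

Lemma rprod_adj (A : 'M[C]_N) u v : rprod (A *m u) v = rprod u (adj A *m v).
Proof. by rewrite /rprod hprod_adj. Qed.

(** For a constant matrix [A] this writes the pairing as a combination, with constant coefficients,
    of products of two real functions, to which [weak_diff_mul] applies. *)
Lemma rprod_expand (A : 'M[C]_N) u v : rprod (A *m u) v =
  \sum_s \sum_t (complex.Re (A s t) * (complex.Re (u t 0) * complex.Re (v s 0))
              + complex.Re (A s t) * (complex.Im (u t 0) * complex.Im (v s 0))
              + (complex.Im (A s t) * (complex.Re (u t 0) * complex.Im (v s 0))
              - complex.Im (A s t) * (complex.Im (u t 0) * complex.Re (v s 0)))).
Proof.
rewrite /rprod /hprod Re_sum; apply: eq_bigr => s _.
rewrite mxE rmorph_sum mulr_suml Re_sum; apply: eq_bigr => t _ /=.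
by case: (A s t) => a a'; case: (u t 0) => b b'; case: (v s 0) => e e' /=; ring.
Qed.

Lemma hnorm2E u : hnorm2 u = \sum_a (complex.Re (u a 0) ^+ 2 + complex.Im (u a 0) ^+ 2).
Proof.
rewrite /hnorm2 /hprod Re_sum; apply: eq_bigr => a _.
by case: (u a 0) => b c /=; ring.
Qed.

Lemma hnorm2_ge0 u : 0 <= hnorm2 u.
Proof. by rewrite hnorm2E sumr_ge0// => a _; rewrite addr_ge0 ?sqr_ge0. Qed.

Lemma Re_le_hnorm u a : complex.Re (u a 0) ^+ 2 <= hnorm2 u.
Proof.
rewrite hnorm2E (bigD1 a)//= -addrA lerDl addr_ge0 ?sqr_ge0// sumr_ge0// => b _.
by rewrite addr_ge0 ?sqr_ge0.
Qed.

Lemma Im_le_hnorm u a : complex.Im (u a 0) ^+ 2 <= hnorm2 u.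
Proof.
rewrite hnorm2E (bigD1 a)//= addrAC lerDr addr_ge0 ?sqr_ge0// sumr_ge0// => b _.
by rewrite addr_ge0 ?sqr_ge0.
Qed.

Lemma hnorm2_unitary (T : 'M[C]_N) u : adj T *m T = 1%:M -> hnorm2 (T *m u) = hnorm2 u.
Proof. by move=> HT; rewrite /hnorm2 hprod_unitary. Qed.

End Hermitian.

(** Moving [A] through [D] and then through [B] changes the sign twice, so only the scalar terms
    survive. *)
Lemma mul_comm_aux (F : comPzRingType) n (A B D : 'M[F]_n) x y :
  B *m A = x%:M - A *m B -> D *m A = y%:M - A *m D ->
  B *m D *m A - A *m (B *m D) = y *: B - x *: D.
Proof.
move=> hB hD; rewrite -mulmxA hD mulmxBr mul_mx_scalar (mulmxA B A) hB mulmxBl mul_scalar_mx.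
by rewrite -!mulmxA; move: (A *m _) (y *: _) (x *: _) => P Q T; rewrite opprB addrA addrAC addrK.
Qed.

(** * Clifford multiplication and the spin connection *)

Section CliffordAlgebra.
Context {R : realType} {m N : nat}.
Local Notation C := R[i].
Local Notation rc := (real_complex R).
Variable gamma : 'I_m -> 'M[C]_N.
Hypothesis gammaC : forall a b, gamma a *m gamma b + gamma b *m gamma a = (- (2 *+ (a == b)))%:M.
Hypothesis gammaA : forall a, adj (gamma a) = - gamma a.

Lemma rprod_gamma a u v : rprod (gamma a *m u) v = - rprod u (gamma a *m v).
Proof. by rewrite rprod_adj gammaA mulNmx rprodNr. Qed.

Lemma clifford_adj v : adj (clifford gamma v) = - clifford gamma v.
Proof.
rewrite /clifford adj_sum -sumrN; apply: eq_bigr => a _.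
by rewrite adjZ gammaA scalerN.
Qed.

(** The double sum is added to itself with exchanged indices; the anticommutators leave the
    diagonal, and 2 is invertible. *)
Lemma clifford_sqr (v : 'rV[R]_m) : clifford gamma v *m clifford gamma v = (- rc ((v *m v^T)
  0 0))%:M.
Proof.
set X := _ *m _; suff H : X + X = (- rc ((v *m v^T) 0 0))%:M + (- rc ((v *m v^T) 0 0))%:M.
  have h2 : (2 : C) != 0 by rewrite pnatr_eq0.
  apply: (scalerI h2); rewrite !scaler_nat !mulr2n; exact: H.
have XE : X = \sum_a \sum_b rc (v 0 a * v 0 b) *: (gamma a *m gamma b).
  rewrite /X {1}/clifford mulmx_suml; apply: eq_bigr => a _.
  rewrite mulmx_sumr; apply: eq_bigr => b _.
  by rewrite -scalemxAl -scalemxAr scalerA -rmorphM.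
have XE' : X = \sum_a \sum_b rc (v 0 a * v 0 b) *: (gamma b *m gamma a).
  by rewrite XE exchange_big; apply: eq_bigr => a _; apply: eq_bigr => b _; rewrite mulrC.
rewrite {1}XE XE' -big_split /=.
transitivity (\sum_a (- rc (2 * v 0 a ^+ 2))%:M : 'M[C]_N).
  apply: eq_bigr => a _; rewrite -big_split /= (bigD1 a)//= big1 ?addr0 => [|b ba].
    rewrite -scalerDr gammaC eqxx scale_scalar_mx; congr (_%:M).
    by rewrite mulrN -expr2 [in RHS]mulrC [in RHS]rmorphM /= rmorph_nat.
  rewrite -scalerDr gammaC eq_sym (negPf ba) mulr0n oppr0.
  by rewrite scale_scalar_mx mulr0 raddf0.
rewrite -(raddf_sum (@scalar_mx _ N)) -raddfD /=; congr (_%:M).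
rewrite sumrN -rmorph_sum -opprD -rmorphD /=; congr (- rc _).
rewrite -mulr_sumr mulr_natl mulr2n.
by congr (_ + _); rewrite mxE; apply: eq_bigr => a _; rewrite mxE expr2.
Qed.

(** A unit vector acts unitarily: its adjoint is its negative and its square is -1. *)
Lemma spin_unitary s : in_spin gamma s -> adj s *m s = 1%:M.
Proof.
move=> [vs [_ Hvs ->]]; elim: vs Hvs => [|v vs IH] H /=; first by rewrite adj1 mulmx1.
rewrite adjM -mulmxA (mulmxA (adj (clifford _ _))) clifford_adj mulNmx clifford_sqr.
rewrite H ?mem_head// mxE eqxx rmorph1 -[(-1)%:M]scalemx1 scaleN1r opprK mul1mx.
by apply: IH => w hw; apply: H; rewrite inE hw orbT.
Qed.

Variable W : 'M[R]_m.
Hypothesis Wanti : W^T = - W.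
Let omega := 4^-1 *: \sum_b \sum_c rc (W b c) *: (gamma b *m gamma c).

Let Wc b c : W c b = - W b c.
Proof. by have := congr1 (fun A : 'M[R]_m => A b c) Wanti; rewrite !mxE. Qed.

(** The adjoint reverses [gamma b *m gamma c], and skewness of [W] turns the reversal into a
    sign. *)
Lemma omega_adj : adj omega = - omega.
Proof.
have h4 : (4^-1 : C) = rc 4^-1 by rewrite fmorphV rmorph_nat.
rewrite /omega h4 adjZ -scalerN; congr (_ *: _).
rewrite adj_sum; under eq_bigr do rewrite adj_sum.
rewrite exchange_big -sumrN; apply: eq_bigr => b _; rewrite -sumrN; apply: eq_bigr => c _.
by rewrite adjZ adjM !gammaA mulNmx mulmxN opprK Wc rmorphN scaleNr.
Qed.

(** The infinitesimal form of the lift from SO(m) to Spin(m). Each index of [W] contributes twice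
    the right-hand side, the two contributions being equal by skewness, and 1/4 normalises the
    total. *)
Lemma omega_comm a : omega *m gamma a - gamma a *m omega = \sum_c rc (W a c) *: gamma c.
Proof.
have E b c : gamma b *m gamma c *m gamma a - gamma a *m (gamma b *m gamma c) =
    (2 *+ (a == b)) *: gamma c - (2 *+ (a == c)) *: gamma b.
  have h1 : gamma c *m gamma a = (- (2 *+ (a == c)))%:M - gamma a *m gamma c.
    by rewrite (eq_sym a) -gammaC addrK.
  have h2 : gamma b *m gamma a = (- (2 *+ (a == b)))%:M - gamma a *m gamma b.
    by rewrite (eq_sym a) -gammaC addrK.
  by rewrite (mul_comm_aux h2 h1) !scaleNr opprK addrC.
rewrite /omega -scalemxAl -scalemxAr -scalerBr mulmx_suml mulmx_sumr -sumrB.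
have -> : \sum_i ((\sum_c rc (W i c) *: (gamma i *m gamma c)) *m gamma a -
      gamma a *m (\sum_c rc (W i c) *: (gamma i *m gamma c))) =
   \sum_b \sum_c (rc (W b c) *: ((2 *+ (a == b)) *: gamma c) - rc (W b c) *: ((2 *+ (a == c))
     *: gamma b)).
  apply: eq_bigr => b _; rewrite mulmx_suml mulmx_sumr -sumrB; apply: eq_bigr => c _.
  by rewrite -scalemxAl -scalemxAr -scalerBr E scalerBr.
under eq_bigr do rewrite sumrB.
rewrite sumrB.
have -> : \sum_b \sum_c rc (W b c) *: ((2 *+ (a == b)) *: gamma c) = 2 *: \sum_c rc (W a c)
  *: gamma c.
  rewrite (bigD1 a)//= [X in _ + X]big1 ?addr0 => [|b ba].
    by rewrite scaler_sumr; apply: eq_bigr => c _; rewrite eqxx mulr1n !scalerA mulrC.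
  by apply: big1 => c _; rewrite eq_sym (negPf ba) mulr0n scale0r scaler0.
have -> : \sum_b \sum_c rc (W b c) *: ((2 *+ (a == c)) *: gamma b) = - (2 *: \sum_c rc (W a c)
  *: gamma c).
  rewrite exchange_big (bigD1 a)//= [X in _ + X]big1 ?addr0 => [|b ba].
    rewrite scaler_sumr -sumrN; apply: eq_bigr => c _; rewrite eqxx mulr1n !scalerA Wc rmorphN.
    by rewrite mulNr scaleNr mulrC.
  by apply: big1 => c _; rewrite eq_sym (negPf ba) mulr0n scale0r scaler0.
rewrite opprK -scalerDl scalerA -[RHS]scale1r; congr (_ *: _).
by rewrite -natrD mulVf// pnatr_eq0.
Qed.

End CliffordAlgebra.

(** * Orthonormal frames and the volume density *)

Section Jacobi.
Context {R : realType} {m : nat}.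
Local Notation rV := 'rV[R]_m.
Implicit Types (x : rV) (k : 'I_m).

Lemma pdZ k (c : R) (f : rV -> R) x : differentiable f x ->
  pd k (fun y => c * f y) x = c * pd k f x.
Proof. by move=> df; rewrite pdM// pd_cst mul0r add0r. Qed.

Lemma pd_sum k (I : Type) (s : seq I) (P : pred I) (f : I -> rV -> R) x :
  (forall i, differentiable (f i) x) ->
  differentiable (fun y => \sum_(i <- s | P i) f i y) x /\
  pd k (fun y => \sum_(i <- s | P i) f i y) x = \sum_(i <- s | P i) pd k (f i) x.
Proof.
move=> df; elim: s => [|i s [IH1 IH2]].
  have -> : (fun y => \sum_(i <- [::] | P i) f i y) = fun=> 0 by apply/funext => y; rewrite big_nil.
  by rewrite big_nil pd_cst; split=> //; exact: differentiable_cst.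
rewrite big_cons; case: ifP => Pi; last first.
  by under eq_fun do rewrite big_cons Pi.
under eq_fun do rewrite big_cons Pi.
by rewrite pdD// IH2; split=> //; exact: differentiableD.
Qed.

Lemma pd_prod k (I : eqType) (s : seq I) (f : I -> rV -> R) x : uniq s ->
  (forall i, differentiable (f i) x) ->
  differentiable (fun y => \prod_(i <- s) f i y) x /\
  pd k (fun y => \prod_(i <- s) f i y) x =
    \sum_(i <- s) pd k (f i) x * \prod_(j <- s | j != i) f j x.
Proof.
move=> us df; elim: s us => [|i s IH] /=.
  move=> _; have -> : (fun y => \prod_(i <- [::]) f i y) = fun=> 1 by apply/funext => y;
    rewrite big_nil.
  by rewrite big_nil pd_cst; split=> //; exact: differentiable_cst.
move=> /andP[ni us]; have [IH1 IH2] := IH us.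
under eq_fun do rewrite big_cons.
rewrite big_cons pdM// IH2; split; first exact: differentiableM.
rewrite [in RHS]big_cons eqxx; congr (_ * _ + _).
  rewrite [RHS]big_seq_cond [LHS]big_seq_cond; apply: eq_bigl => j.
  by case: (boolP (j \in s)) => //= js; rewrite (_ : j != i)//; apply: contraNneq ni => <-.
rewrite mulr_sumr; apply: eq_big_seq => j js.
rewrite big_cons (_ : i != j); first by rewrite mulrCA.
by apply: contraNneq ni => ->.
Qed.

(** Jacobi's formula. Differentiating one row at a time gives the determinants of [B i], in which
    row [i] is replaced by its derivative, and each is expanded along that row. *)
Lemma pd_det k n (G : rV -> 'M[R]_n) x : (forall a b, differentiable (fun y => G y a b) x) ->
  differentiable (fun y => \det (G y)) x /\
  pd k (fun y => \det (G y)) x = \sum_i \sum_l pd k (fun y => G y i l) x * cofactor (G x) i l.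
Proof.
move=> dG.
have dp (s : {perm 'I_n}) : differentiable (fun y => \prod_i G y i (s i)) x.
  by have [] := pd_prod k (index_enum_uniq 'I_n) (fun i => dG i (s i)).
have ds (s : {perm 'I_n}) : differentiable (fun y => (-1) ^+ s * \prod_i G y i (s i)) x.
  exact: differentiableM.
have [d1 ->] := @pd_sum k _ (index_enum {perm 'I_n}) predT _ x ds; split=> //.
pose B i := \matrix_(a, b) if a == i then pd k (fun y => G y i b) x else G x a b.
transitivity (\sum_i \det (B i)).
  rewrite /determinant exchange_big; apply: eq_bigr => s _ /=.
  rewrite pdZ// -mulr_sumr; congr (_ * _).
  have [_ ->] := pd_prod k (index_enum_uniq 'I_n) (fun i => dG i (s i)).
  apply: eq_bigr => i _; rewrite [RHS](bigD1 i)//= mxE eqxx; congr (_ * _).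
  by apply: eq_bigr => j ji; rewrite mxE (negPf ji).
apply: eq_bigr => i _; rewrite (expand_det_row _ i); apply: eq_bigr => l _.
rewrite mxE eqxx; congr (_ * (_ * \det _)).
by apply/matrixP => a b; rewrite !mxE eq_sym (negPf (neq_lift _ _)).
Qed.

End Jacobi.

Section LocalFrame.
Context {R : realType} {m : nat}.
Local Notation rV := 'rV[R]_m.
Variable U : set rV.
Hypothesis oU : open U.
Variables E g : rV -> 'M[R]_m.
Hypothesis sE : forall a b, smooth U (fun x => E x a b).
Hypothesis sg : forall a b, smooth U (fun x => g x a b).
Hypothesis gT : forall x, U x -> (g x)^T = g x.
Hypothesis EgE : forall x, U x -> E x *m g x *m (E x)^T = 1%:M.

Definition dmx k (F : rV -> 'M[R]_m) x : 'M[R]_m := \matrix_(a, b) pd k (fun y => F y a b) x.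

Definition loc_christoffel k x : 'M[R]_m :=
  (\matrix_(q, r) (2^-1 * (pd k (fun y => g y q r) x + pd q (fun y => g y k r) x
     - pd r (fun y => g y k q) x))) *m invmx (g x).

Definition loc_conn k x : 'M[R]_m :=
  (dmx k E x + E x *m loc_christoffel k x) *m g x *m (E x)^T.

Definition vol_density x : R := Num.sqrt (\det (g x)).

Let dE x a b : U x -> differentiable (fun y => E y a b) x.
Proof. by move=> Ux; exact: (sE a b 1).1. Qed.

Let dg x a b : U x -> differentiable (fun y => g y a b) x.
Proof. by move=> Ux; exact: (sg a b 1).1. Qed.

Lemma frame_det x : U x -> \det (E x) ^+ 2 * \det (g x) = 1.
Proof. by move=> Ux; rewrite -(det1 R m) -(EgE Ux) !det_mulmx det_tr; ring. Qed.

Lemma det_metric_gt0 x : U x -> 0 < \det (g x).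
Proof.
move=> /frame_det H; rewrite ltNge; apply/negP => h.
have : \det (E x) ^+ 2 * \det (g x) <= 0 by rewrite mulr_ge0_le0 ?sqr_ge0.
by rewrite H ler10.
Qed.

Lemma metric_unit x : U x -> g x \in unitmx.
Proof. by move=> Ux; rewrite unitmxE unitfE gt_eqF// det_metric_gt0. Qed.

Lemma frame_inv x : U x -> g x *m (E x)^T *m E x = 1%:M.
Proof. by move=> /EgE; rewrite -mulmxA => /mulmx1C. Qed.

Lemma metric_inv x : U x -> invmx (g x) = (E x)^T *m E x.
Proof.
move=> Ux; rewrite -[RHS]mul1mx -(mulVmx (metric_unit Ux)) -!mulmxA.
by rewrite (mulmxA (g x)) frame_inv// mulmx1.
Qed.

Lemma vol_density_gt0 x : U x -> 0 < vol_density x.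
Proof. by move=> Ux; rewrite sqrtr_gt0 det_metric_gt0. Qed.

Lemma smooth_det : smooth U (fun x => \det (g x)).
Proof.
move=> r; rewrite /determinant; apply: Ck_sum => // s _; apply: CkZ => //.
by apply: Ck_prod => // i _; exact: sg.
Qed.

Lemma smooth_vol : smooth U vol_density.
Proof. by move=> r; apply: Ck_sqrt => // [x|]; [exact: det_metric_gt0|exact: smooth_det]. Qed.

Let dvol x : U x -> differentiable vol_density x.
Proof. by move=> Ux; exact: (smooth_vol 1).1. Qed.

(** Jacobi's formula for the square of the density, with the adjugate written as the determinant
    times the inverse. *)
Lemma pd_vol k x : U x -> pd k vol_density x =
  vol_density x * (2^-1 * \sum_i \sum_l pd k (fun y => g y i l) x * invmx (g x) l i).
Proof.
move=> Ux; have [_ Hd] := pd_det k (fun a b => dg a b Ux).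
have r0 := vol_density_gt0 Ux.
have sq y : U y -> vol_density y * vol_density y = \det (g y).
  by move=> Uy; rewrite -expr2 sqr_sqrtr// ltW// det_metric_gt0.
have H2 : 2 * vol_density x * pd k vol_density x = pd k (fun y => \det (g y)) x.
  rewrite -(@pd_eq _ _ k (fun y => vol_density y * vol_density y) _ U x oU Ux sq) pdM;
    [ring|exact: dvol..].
apply: (@mulfI _ (2 * vol_density x)); first by rewrite mulf_neq0// gt_eqF.
rewrite H2 Hd.
have -> : 2 * vol_density x * (vol_density x * (2^-1 * \sum_i \sum_l pd k (fun y => g y i l)
  x * invmx (g x) l i)) =
    \det (g x) * \sum_i \sum_l pd k (fun y => g y i l) x * invmx (g x) l i.
  by rewrite -sq//; field.
rewrite mulr_sumr; apply: eq_bigr => i _; rewrite mulr_sumr; apply: eq_bigr => l _.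
rewrite [RHS]mulrCA; congr (_ * _).
have <- : \adj (g x) l i = cofactor (g x) i l by rewrite mxE.
rewrite -[\adj (g x)]mul1mx -(mulVmx (metric_unit Ux)) -mulmxA mul_mx_adj.
by rewrite mul_mx_scalar mxE.
Qed.

Lemma dmxM k (F G : rV -> 'M[R]_m) x : (forall a b, differentiable (fun y => F y a b) x) ->
  (forall a b, differentiable (fun y => G y a b) x) ->
  dmx k (fun y => F y *m G y) x = dmx k F x *m G x + F x *m dmx k G x.
Proof.
move=> dF dG; apply/matrixP => a b; rewrite !mxE -big_split /=.
under eq_fun do rewrite mxE.
have dFG c : differentiable (fun y => F y a c * G y c b) x by exact: differentiableM.
have [_ ->] := @pd_sum R m k _ (index_enum 'I_m) predT _ x dFG.
by apply: eq_bigr => c _; rewrite pdM// !mxE.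
Qed.

Lemma addr_perm4 (V : zmodType) (a b c e : V) : e + b + (a + c) = a + (c + e) + b.
Proof. by rewrite [LHS]addrC !addrA. Qed.

(** Compatibility with the metric: the lowered Christoffel matrix [G] and its transpose add up to
    the derivative of [g], so the connection form plus its transpose is the derivative of the
    constant [E *m g *m E^T]. *)
Lemma loc_conn_anti k x : U x -> (loc_conn k x)^T = - loc_conn k x.
Proof.
move=> Ux; apply/eqP; rewrite -addr_eq0; apply/eqP.
pose G := \matrix_(q, r) (2^-1 * (pd k (fun y => g y q r) x + pd q (fun y => g y k r) x
     - pd r (fun y => g y k q) x)).
have gs a b y : U y -> g y a b = g y b a by move=> Uy; rewrite -[in LHS]gT// mxE.
have GG : G + G^T = dmx k g x.
  apply/matrixP => q r; rewrite !mxE.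
  rewrite (@pd_eq _ _ k (fun y => g y r q) (fun y => g y q r) U x oU Ux (gs r q)).
  by field.
have LE : loc_conn k x = dmx k E x *m g x *m (E x)^T + E x *m G *m (E x)^T.
  rewrite /loc_conn mulmxDl mulmxDl /loc_christoffel; congr (_ + _ *m _).
  by rewrite -(mulmxA _ _ (g x)) -(mulmxA G) mulVmx ?metric_unit// mulmx1.
have LT : (loc_conn k x)^T = E x *m g x *m (dmx k E x)^T + E x *m G^T *m (E x)^T.
  by rewrite LE raddfD /= !trmx_mul trmxK gT// !mulmxA.
have dT a b : differentiable (fun y => (E y)^T a b) x by under eq_fun do rewrite mxE; exact: dE.
have dEg a b : differentiable (fun y => (E y *m g y) a b) x.
  under eq_fun do rewrite mxE.
  by have [] := @pd_sum R m k _ (index_enum 'I_m) predT (fun c y => E y a c * g y c b)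
    x (fun c => differentiableM (dE a c Ux) (dg c b Ux)).
have : dmx k (fun y => E y *m g y *m (E y)^T) x = 0.
  apply/matrixP => a b; rewrite !mxE.
  rewrite (@pd_eq _ _ k _ (fun=> (1%:M : 'M[R]_m) a b) U x oU Ux) ?pd_cst// => y Uy.
  by rewrite EgE.
rewrite dmxM// dmxM; [|by move=> ? ?; exact: dE|by move=> ? ?; exact: dg].
have -> : dmx k (fun y => (E y)^T) x = (dmx k E x)^T.
  by apply/matrixP => a b; rewrite !mxE; congr (pd k _ x); apply/funext => y; rewrite mxE.
rewrite mulmxDl -GG => H; rewrite LT LE -[RHS]H mulmxDr mulmxDl.
rewrite [X in X + _ = _]addrC; set a := dmx k E x *m _ *m _; set b := E x *m g x *m _.
set c := E x *m G *m _; set e := E x *m G^T *m _.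
exact: addr_perm4.
Qed.

(** The divergence of a frame vector is the trace of its covariant derivative. In the trace of the
    Christoffel symbols two of the three terms cancel after an exchange of the summation indices,
    and the third is the logarithmic derivative of the volume density. *)
Lemma div_frame c x : U x ->
  \sum_k pd k (fun y => vol_density y * E y c k) x =
  vol_density x * \sum_k \sum_a E x a k * loc_conn k x c a.
Proof.
move=> Ux.
(* Multiplication by [E] undoes the lowering of the last index, as [g *m E^T] is the inverse of
   [E]. *)
have T1 k : \sum_a E x a k * loc_conn k x c a = (dmx k E x + E x *m loc_christoffel k x) c k.
  transitivity ((loc_conn k x *m E x) c k); first by rewrite mxE; apply: eq_bigr => a _;
    rewrite mulrC.
  by rewrite /loc_conn -!mulmxA (mulmxA (g x)) frame_inv// mulmx1.
have T2 : \sum_k (E x *m loc_christoffel k x) c k =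
    \sum_q E x c q * \sum_k loc_christoffel k x q k.
  under eq_bigr do rewrite mxE.
  by rewrite exchange_big; apply: eq_bigr => q _; rewrite mulr_sumr.
have T3 q : \sum_k loc_christoffel k x q k =
    2^-1 * \sum_i \sum_l pd q (fun y => g y i l) x * invmx (g x) l i.
  have inv_sym i l : invmx (g x) i l = invmx (g x) l i.
    by rewrite metric_inv// -[in LHS](trmxK ((E x)^T *m E x)) trmx_mul trmxK mxE.
  pose X k r := pd k (fun y => g y q r) x * invmx (g x) r k.
  pose Y k r := pd q (fun y => g y k r) x * invmx (g x) r k.
  transitivity (\sum_k \sum_r (2^-1 * X k r + 2^-1 * Y k r - 2^-1 * X r k)).
    apply: eq_bigr => k _; rewrite mxE; apply: eq_bigr => r _; rewrite !mxE /X /Y.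
    rewrite (inv_sym k r) (@pd_eq _ _ r (fun y => g y k q) (fun y => g y q k) U x oU Ux);
      first by ring.
    by move=> y Uy; rewrite -[in LHS]gT// mxE.
  transitivity (\sum_k \sum_r (2^-1 * X k r + 2^-1 * Y k r) - \sum_k \sum_r 2^-1 * X r k).
    by rewrite -sumrB; apply: eq_bigr => k _; rewrite -sumrB.
  rewrite [X in _ - X]exchange_big -sumrB mulr_sumr; apply: eq_bigr => k _ /=.
  rewrite -sumrB mulr_sumr; apply: eq_bigr => r _.
  by rewrite addrAC subrr add0r.
under [in RHS]eq_bigr => k _ do rewrite T1 mxE.
rewrite big_split /= T2.
transitivity (\sum_k (pd k vol_density x * E x c k + vol_density x * dmx k E x c k)).
  by apply: eq_bigr => k _; rewrite pdM ?mxE//; [exact: dvol|exact: dE].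
have PV k : pd k vol_density x = vol_density x * \sum_l loc_christoffel l x k l.
  by rewrite pd_vol// T3.
rewrite (eq_bigr _ (fun k _ => congr1 (fun t => t * _ + _) (PV k)))
  big_split /= -mulr_sumr mulrDr addrC; congr (_ + _).
by rewrite mulr_sumr; apply: eq_bigr => k _; ring.
Qed.

End LocalFrame.

(** * The divergence of the Dirac current *)

Section Current.
Context {R : realType} {m N : nat}.
Local Notation rV := 'rV[R]_m.
Local Notation C := R[i].
Local Notation rc := (real_complex R).
Variable leb : {measure set (borel rV) -> \bar R}.
Hypothesis Hleb : is_lebesgue leb.
Variables (x0 : rV) (r : R).
Hypothesis r0 : 0 < r.
Local Notation D := (cube x0 r).
Local Notation L1 := (L1 leb D).
Local Notation Int := (Int leb D).

Let mD := measurable_cube x0 r.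
Let fD := leb_cube_lty Hleb x0 r.

Lemma bmeas_ccube (f : rV -> R) : (forall y, ccube x0 r y -> {for y, continuous f}) ->
  bmeas (D : set (borel rV)) f.
Proof.
have Dc : D `<=` ccube x0 r by move=> y Dy k; exact: ltW.
move=> cf; split.
  by apply: borel_continuous_real => [|y /Dc]; [exact: open_cube|exact: cf].
have cK : compact (f @` ccube x0 r).
  apply: continuous_compact; last exact: ccube_compact.
  by apply: continuous_in_subspaceT => y; rewrite inE; exact: cf.
have [M [_ HM]] := compact_bounded cK; exists (M + 1) => y Dy.
by apply: HM; [rewrite ltrDl|exists y => //; exact: Dc].
Qed.

Variable gamma : 'I_m -> 'M[C]_N.
Hypothesis gammaC : forall a b, gamma a *m gamma b + gamma b *m gamma a = (- (2 *+ (a == b)))%:M.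
Hypothesis gammaA : forall a, adj (gamma a) = - gamma a.
Variable U : set rV.
Hypothesis oU : open U.
Hypothesis cU : ccube x0 r `<=` U.
Variables E g : rV -> 'M[R]_m.
Hypothesis sE : forall a b, smooth U (fun x => E x a b).
Hypothesis sg : forall a b, smooth U (fun x => g x a b).
Hypothesis gT : forall x, U x -> (g x)^T = g x.
Hypothesis EgE : forall x, U x -> E x *m g x *m (E x)^T = 1%:M.
Local Notation rho := (vol_density g).

Definition loc_spin_conn k x : 'M[C]_N :=
  4^-1 *: \sum_b \sum_c rc (loc_conn E g k x b c) *: (gamma b *m gamma c).

Definition weak_spinor (u : rV -> 'cV[C]_N) (u' : 'I_m -> rV -> 'cV[C]_N) := forall s,
  sobolev4 leb x0 r (fun x => complex.Re (u x s 0)) (fun k x => complex.Re (u' k x s 0)) /\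
  sobolev4 leb x0 r (fun x => complex.Im (u x s 0)) (fun k x => complex.Im (u' k x s 0)).

Lemma weak_diff_rprod (A : 'M[C]_N) u u' v v' : weak_spinor u u' -> weak_spinor v v' ->
  weak_diff leb x0 r (fun x => rprod (A *m u x) (v x))
    (fun k x => rprod (A *m u' k x) (v x) + rprod (A *m u x) (v' k x)).
Proof.
move=> Hu Hv.
pose F s t (x : rV) := complex.Re (A s t) * (complex.Re (u x t 0) * complex.Re (v x s 0))
              + complex.Re (A s t) * (complex.Im (u x t 0) * complex.Im (v x s 0))
              + (complex.Im (A s t) * (complex.Re (u x t 0) * complex.Im (v x s 0))
              + (- complex.Im (A s t)) * (complex.Im (u x t 0) * complex.Re (v x s 0))).
pose F' s t k (x : rV) :=
     complex.Re (A s t) * (complex.Re (u' k x t 0) * complex.Re (v x s 0)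
                         + complex.Re (u x t 0) * complex.Re (v' k x s 0))
   + complex.Re (A s t) * (complex.Im (u' k x t 0) * complex.Im (v x s 0)
                         + complex.Im (u x t 0) * complex.Im (v' k x s 0))
  + (complex.Im (A s t) * (complex.Re (u' k x t 0) * complex.Im (v x s 0)
                         + complex.Re (u x t 0) * complex.Im (v' k x s 0))
  + (- complex.Im (A s t)) * (complex.Im (u' k x t 0) * complex.Re (v x s 0)
                         + complex.Im (u x t 0) * complex.Re (v' k x s 0))).
have -> : (fun x => rprod (A *m u x) (v x)) = fun x => \sum_s \sum_t F s t x.
  apply/funext => x; rewrite rprod_expand; apply: eq_bigr => s _; apply: eq_bigr => t _.
  by rewrite /F mulNr.
have -> : (fun k x => rprod (A *m u' k x) (v x) + rprod (A *m u x) (v' k x)) =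
    fun k x => \sum_s \sum_t F' s t k x.
  apply/funext => k; apply/funext => x; rewrite !rprod_expand -big_split; apply: eq_bigr => s _.
  by rewrite -big_split; apply: eq_bigr => t _; rewrite /F' /=; ring.
apply: weak_diff_sum => // s; apply: weak_diff_sum => // t.
have [Ru Iu] := Hu t; have [Rv Iv] := Hv s.
apply: weak_diffD => //; apply: weak_diffD => //; apply: weak_diffZ => //; exact: weak_diff_mul.
Qed.

Let bc f : smooth U f -> bmeas (D : set (borel rV)) f.
Proof. by move=> sf; apply: bmeas_ccube => y /cU; exact: (Ck_cont (sf 0)). Qed.

Let sW a k : smooth U (fun x => rho x * E x a k).
Proof. by move=> p; apply: CkM => //; [exact: (smooth_vol oU sg EgE)|exact: sE]. Qed.

Let sD f k : smooth U f -> smooth U (pd k f).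
Proof. by move=> sf p; exact: (sf p.+1).2. Qed.

(** The skew-hermitian connection is moved across the pairing and leaves its commutator with
    [gamma a], a combination of the currents with coefficients from [W]. Summed against the frame,
    these coefficients are minus the divergences of the frame vectors, so only the two Dirac terms
    remain. *)
Lemma frame_current_div x (u v : 'cV[C]_N) (Du Dv : 'I_m -> 'cV[C]_N) : U x ->
  \sum_k \sum_a (rho x * E x a k *
      (rprod (gamma a *m (Du k - loc_spin_conn k x *m u)) v +
       rprod (gamma a *m u) (Dv k - loc_spin_conn k x *m v)) +
     pd k (fun y => rho y * E y a k) x * rprod (gamma a *m u) v) =
  rho x * (rprod (\sum_a gamma a *m \sum_k rc (E x a k) *: Du k) v -
           rprod u (\sum_a gamma a *m \sum_k rc (E x a k) *: Dv k)).
Proof.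
move=> Ux; pose W k := loc_conn E g k x.
have Wa k : (W k)^T = - W k by exact: (loc_conn_anti oU sE sg gT EgE k Ux).
have oa k : adj (loc_spin_conn k x) = - loc_spin_conn k x by exact: (omega_adj gammaA (Wa k)).
have T1 k a : rprod (gamma a *m (Du k - loc_spin_conn k x *m u)) v +
       rprod (gamma a *m u) (Dv k - loc_spin_conn k x *m v) =
   rprod (gamma a *m Du k) v - rprod u (gamma a *m Dv k) + \sum_c W k a c * rprod (gamma c *m u) v.
  rewrite mulmxBr rprodBl rprodBr.
  rewrite (rprod_gamma gammaA a u (Dv k)).
  have -> : rprod (gamma a *m u) (loc_spin_conn k x *m v) =
     - rprod (loc_spin_conn k x *m (gamma a *m u)) v.
    by rewrite [in RHS]rprod_adj oa mulNmx rprodNr opprK.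
  have -> : \sum_c W k a c * rprod (gamma c *m u) v =
     rprod ((loc_spin_conn k x *m gamma a - gamma a *m loc_spin_conn k x) *m u) v.
    rewrite (omega_comm gammaC (Wa k)) mulmx_suml rprod_suml; apply: eq_bigr => c _.
    by rewrite -scalemxAl rprodZl.
  by rewrite mulmxBl rprodBl !mulmxA; ring.
have T2 : rprod (\sum_a gamma a *m \sum_k rc (E x a k) *: Du k) v =
   \sum_k \sum_a E x a k * rprod (gamma a *m Du k) v.
  rewrite rprod_suml exchange_big; apply: eq_bigr => a _ /=.
  rewrite mulmx_sumr rprod_suml; apply: eq_bigr => k _.
  by rewrite -scalemxAr rprodZl.
have T3 : rprod u (\sum_a gamma a *m \sum_k rc (E x a k) *: Dv k) =
   \sum_k \sum_a E x a k * rprod u (gamma a *m Dv k).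
  rewrite rprod_sumr exchange_big; apply: eq_bigr => a _ /=.
  rewrite mulmx_sumr rprod_sumr; apply: eq_bigr => k _.
  by rewrite -scalemxAr rprodZr.
rewrite T2 T3 -sumrB mulr_sumr.
have T4 : \sum_k \sum_a rho x * E x a k * (\sum_c W k a c * rprod (gamma c *m u) v) =
   - \sum_k \sum_a pd k (fun y => rho y * E y a k) x * rprod (gamma a *m u) v.
  rewrite [in RHS]exchange_big /=.
  have -> : \sum_a \sum_k pd k (fun y => rho y * E y a k) x * rprod (gamma a *m u) v =
     \sum_c (rho x * \sum_k \sum_a E x a k * W k c a) * rprod (gamma c *m u) v.
    by apply: eq_bigr => c _; rewrite -mulr_suml (div_frame oU sE sg gT EgE c Ux).
  rewrite -sumrN.
  transitivity (\sum_k \sum_c \sum_a rho x * E x a k * (W k a c * rprod (gamma c *m u) v)).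
    apply: eq_bigr => k _; rewrite exchange_big; apply: eq_bigr => a _; exact: mulr_sumr.
  rewrite exchange_big; apply: eq_bigr => c _ /=.
  rewrite -mulNr -mulrN -sumrN mulr_sumr mulr_suml; apply: eq_bigr => k _.
  rewrite -sumrN mulr_sumr mulr_suml; apply: eq_bigr => a _.
  have -> : W k a c = - W k c a.
    by have := congr1 (fun M : 'M[R]_m => M c a) (Wa k); rewrite !mxE.
  by ring.
transitivity (\sum_k \sum_a rho x * (E x a k * rprod (gamma a *m Du k)
  v - E x a k * rprod u (gamma a *m Dv k))
   + \sum_k \sum_a rho x * E x a k * (\sum_c W k a c * rprod (gamma c *m u) v)
   + \sum_k \sum_a pd k (fun y => rho y * E y a k) x * rprod (gamma a *m u) v).
  rewrite -!big_split; apply: eq_bigr => k _; rewrite -!big_split; apply: eq_bigr => a _ /=.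
  by rewrite T1; ring.
rewrite T4 subrK; apply: eq_bigr => k _.
by rewrite -sumrB mulr_sumr.
Qed.

(** The coefficients [rho * E] are smooth, so [weak_diff_smul] applies to every component of the
    current; [frame_current_div] then identifies the integrand. *)
Theorem current_law u v Du Dv c z :
  weak_spinor u (fun k x => Du k x - loc_spin_conn k x *m u x) ->
  weak_spinor v (fun k x => Dv k x - loc_spin_conn k x *m v x) ->
  cube_test x0 r c -> cube_test x0 r z ->
  [/\ L1 (fun x => \sum_k (\sum_a rho x * E x a k * rprod (gamma a *m u x) (v x)) *
       pd k (fun y => c y * z y) x),
  L1 (fun x => rho x * (rprod (\sum_a gamma a *m \sum_k rc (E x a k) *: Du k x) (v x) -
           rprod (u x) (\sum_a gamma a *m \sum_k rc (E x a k) *: Dv k x)) * (c x * z x)) &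
  Int (fun x => \sum_k (\sum_a rho x * E x a k * rprod (gamma a *m u x) (v x)) *
       pd k (fun y => c y * z y) x) =
  - Int (fun x => rho x * (rprod (\sum_a gamma a *m \sum_k rc (E x a k) *: Du k x) (v x) -
           rprod (u x) (\sum_a gamma a *m \sum_k rc (E x a k) *: Dv k x)) * (c x * z x))].
Proof.
move=> Hu Hv tc tz.
have [bcz bpcz] := cube_testP (cube_testMM tc tz).
pose P a x := rprod (gamma a *m u x) (v x).
pose P' a k x := rprod (gamma a *m (Du k x - loc_spin_conn k x *m u x)) (v x) +
    rprod (gamma a *m u x) (Dv k x - loc_spin_conn k x *m v x).
have wP a : weak_diff leb x0 r (P a) (P' a) by exact: weak_diff_rprod.
have LP a : L1 (P a) by case: (wP a).
have LP' a k : L1 (P' a k) by case: (wP a).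
have bW a k := bc (sW a k); have bpW a k := bc (sD k (sW a k)).
have swap f w : L1 f -> bmeas (D : set (borel rV)) w -> L1 (fun x => w x * f x).
  by move=> Lf bw; have := bmeasM_L1 mD bw Lf; congr (L1 _); apply/funext => x; rewrite mulrC.
have LA a k : L1 (fun x => rho x * E x a k * P' a k x * (c x * z x)).
  by apply: bmeasM_L1 => //; exact: swap.
have LB a k : L1 (fun x => pd k (fun y => rho y * E y a k) x * P a x * (c x * z x)).
  by apply: bmeasM_L1 => //; exact: swap.
have LC a k : L1 (fun x => rho x * E x a k * P a x * pd k (fun y => c y * z y) x).
  by apply: bmeasM_L1 => //; exact: swap.
have LAB a k : L1 (fun x => (rho x * E x a k * P' a k x + pd k (fun y => rho y * E y a k)
  x * P a x) * (c x * z x)).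
  by apply: (L1_eq mD _ (L1D mD (LA a k) (LB a k))) => x _; rewrite mulrDl.
have H a k : Int (fun x => rho x * E x a k * P a x * pd k (fun y => c y * z y) x) =
  - Int (fun x => (rho x * E x a k * P' a k x + pd k (fun y => rho y * E y a k) x * P a x)
    * (c x * z x)).
  apply: (weak_diff_smul (a := fun x => rho x * E x a k) (wP a)) => //.
  by move=> q; apply: (Ck_sub _ (sW a k q)) => y Dy; apply: cU => l; exact: ltW.
have EX x : \sum_k (\sum_a rho x * E x a k * P a x) * pd k (fun y => c y * z y) x =
   \sum_k \sum_a rho x * E x a k * P a x * pd k (fun y => c y * z y) x.
  by apply: eq_bigr => k _; rewrite mulr_suml.
have ER x : D x -> \sum_k \sum_a (rho x * E x a k * P' a k x + pd k (fun y => rho y * E y a k)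
  x * P a x) * (c x * z x) =
   rho x * (rprod (\sum_a gamma a *m \sum_k rc (E x a k) *: Du k x) (v x) -
           rprod (u x) (\sum_a gamma a *m \sum_k rc (E x a k) *: Dv k x)) * (c x * z x).
  move=> Dx; rewrite -frame_current_div; last by apply: cU => l; exact: ltW.
  by rewrite mulr_suml; apply: eq_bigr => k _; rewrite mulr_suml.
split.
- apply: (L1_eq mD (f := fun x => \sum_k \sum_a rho x * E x a k * P a x * pd k (fun y =>
  c y * z y) x)).
    by move=> x _; rewrite EX.
  by apply: L1_sum => // k _; apply: L1_sum.
- by apply: (L1_eq mD ER); apply: L1_sum => // k _; apply: L1_sum.
transitivity (\sum_k \sum_a Int (fun x => rho x * E x a k * P a x * pd k (fun y => c y * z y) x)).
  rewrite (Int_eq leb (fun x _ => EX x)) (Int_sum mD); last by move=> k _; apply: L1_sum.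
  by apply: eq_bigr => k _; rewrite (Int_sum mD).
transitivity (- \sum_k \sum_a Int (fun x => (rho x * E x a k * P' a k x + pd k (fun y =>
  rho y * E y a k) x * P a x) * (c x * z x))).
  by rewrite -sumrN; apply: eq_bigr => k _; rewrite -sumrN; apply: eq_bigr => a _; exact: H.
congr (- _).
transitivity (Int (fun x => \sum_k \sum_a (rho x * E x a k * P' a k x + pd k (fun y =>
  rho y * E y a k) x * P a x) * (c x * z x))).
  rewrite (Int_sum mD); last by move=> k _; apply: L1_sum.
  by apply: eq_bigr => k _; rewrite (Int_sum mD).
by apply: Int_eq => x Dx; exact: ER.
Qed.

End Current.

(** * Change of variables in a chart *)

Section Transfer.
Context {d1 d2 : measure_display} {T1 : measurableType d1} {T2 : measurableType d2} {R : realType}.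
Variables (nu : {measure set T1 -> \bar R}) (mu : {measure set T2 -> \bar R}).
Variables (P : set T1) (D : set T2) (t : T1 -> T2) (s : T2 -> T1) (rho : T2 -> R).
Hypotheses (mP : measurable P) (mD : measurable D).
Hypotheses (mt : measurable_fun P t) (ms : measurable_fun D s) (mrho : measurable_fun D rho).
Hypotheses (tP : forall p, P p -> D (t p)) (sD : forall x, D x -> P (s x)).
Hypotheses (ts : forall x, D x -> t (s x) = x) (st : forall p, P p -> s (t p) = p).
Hypothesis rho0 : forall x, D x -> 0 < rho x.
Hypothesis nuE : forall B, measurable B -> B `<=` D ->
  nu (P `&` t @^-1` B) = (\int[mu]_(x in B) (rho x)%:E)%E.

Import HBNNSimple.

(** [nuE] is the formula for indicators. Simple functions follow by linearity, nonnegative ones by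
    monotone convergence along [nnsfun_approx]. *)
Lemma ge0_transfer (f : T2 -> \bar R) : (forall x, D x -> (0 <= f x)%E) -> measurable_fun D f ->
  (\int[nu]_(p in P) f (t p) = \int[mu]_(x in D) (f x * (rho x)%:E))%E.
Proof.
move=> f0 mf; pose h := nnsfun_approx mD mf.
have mhD n : measurable_fun D (h n) by apply: measurable_funTS.
have mht n : measurable_fun P (h n \o t).
  by apply: (@measurable_comp _ _ _ _ _ _ setT) => //.
have -> : (\int[nu]_(p in P) f (t p) = limn (fun n => \int[nu]_(p in P) (h n (t p))%:E))%E.
  have fE p : P p -> f (t p) = limn (fun n => (h n (t p))%:E).
    by move=> Pp; apply/esym/cvg_lim => //; apply: cvg_nnsfun_approx => //; exact: tP.
  under eq_integral => p /[!inE] /fE -> //.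
  apply: monotone_convergence => //.
  - by move=> n; apply/measurable_EFinP; exact: mht.
  - by move=> n p Pp; rewrite lee_fin.
  - by move=> p Pp a b ab; rewrite lee_fin; exact/lefP/nd_nnsfun_approx.
have -> : (\int[mu]_(x in D) (f x * (rho x)%:E) =
    limn (fun n => \int[mu]_(x in D) ((h n x)%:E * (rho x)%:E)))%E.
  have fg x : D x -> (f x * (rho x)%:E = limn (fun n => (h n x)%:E * (rho x)%:E))%E.
    by move=> Dx; apply/esym/cvg_lim => //; apply: cvgeZr => //; exact: cvg_nnsfun_approx.
  under eq_integral => x /[!inE] /fg -> //.
  apply: monotone_convergence => //.
  - by move=> n; apply: emeasurable_funM; apply/measurable_EFinP.
  - by move=> n x Dx; rewrite mule_ge0 ?lee_fin ?(ltW (rho0 Dx)).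
  - move=> x Dx a b ab; rewrite lee_wpmul2r ?lee_fin ?(ltW (rho0 Dx))//;
    exact/lefP/nd_nnsfun_approx.
suff suf n : (\int[nu]_(p in P) (h n (t p))%:E = \int[mu]_(x in D) ((h n x)%:E * (rho x)%:E))%E.
  by congr (limn _); apply/funext => n; exact: suf.
pose A r : set T2 := h n @^-1` [set r].
have mA r : measurable (A r).
  by rewrite -[A r]setTI; apply: (@measurable_funPT _ _ _ _ (h n)).
have yA r x : (0 <= (r * \1_(A r) x)%:E)%E.
  exact: nnfun_muleindic_ge0.
transitivity (\int[nu]_(p in P) (\sum_(r \in range (h n)) (r * \1_(A r) (t p))%:E))%E.
  by apply: eq_integral => p _; rewrite fimfunE -fsumEFin.
have mind r : measurable_fun D (fun x => (r * \1_(A r) x)%:E).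
  by apply/measurable_EFinP; apply: measurable_funM => //; apply: measurable_funTS.
have mindt r : measurable_fun P (fun p => (r * \1_(A r) (t p))%:E).
  apply/measurable_EFinP; apply: measurable_funM => //.
  by apply: (@measurable_comp _ _ _ _ _ _ setT) => //.
rewrite ge0_integral_fsum//.
transitivity (\int[mu]_(x in D) (\sum_(r \in range (h n)) ((r * \1_(A r) x)%:E * (rho x)%:E)))%E;
  last first.
  apply: eq_integral => x _.
  by rewrite -ge0_mule_fsuml// fsumEFin// -fimfunE.
rewrite ge0_integral_fsum//; last 2 first.
- by move=> r; apply: emeasurable_funM => //; apply/measurable_EFinP.
- by move=> r x Dx; rewrite mule_ge0// lee_fin ltW// rho0.
apply: eq_fsbigr => r rh.
have r0 : 0 <= r by move: rh; rewrite inE => -[x _ <-].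
have mAD : measurable (A r `&` D) by exact: measurableI.
transitivity (r%:E * \int[nu]_(p in P) (\1_(A r) (t p))%:E)%E.
  rewrite -ge0_integralZl//; last by apply/measurable_EFinP;
    apply: (@measurable_comp _ _ _ _ _ _ setT) => //.
transitivity (r%:E * \int[mu]_(x in D) ((\1_(A r) x)%:E * (rho x)%:E))%E; last first.
  rewrite -ge0_integralZl//.
  - by apply: eq_integral => x _; rewrite EFinM muleA.
  - apply: emeasurable_funM; apply/measurable_EFinP => //.
  - by move=> x Dx; rewrite mule_ge0// lee_fin ?(ltW (rho0 Dx)).
congr (_ * _)%E.
have E1 : (\int[mu]_(x in D) ((\1_(A r) x)%:E * (rho x)%:E) = \int[mu]_(x in A r `&` D)
  (rho x)%:E)%E.
  rewrite setIC integral_mkcondr; apply: eq_integral => x _.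
  by rewrite patchE indicE; case: (x \in A r); rewrite ?mul1e ?mul0e.
have mPA : measurable (P `&` t @^-1` A r) by exact: mt.
rewrite E1 -nuE//.
transitivity (\int[nu]_(p in P) (\1_(P `&` t @^-1` A r) p)%:E)%E.
  apply: eq_integral => p; rewrite inE => Pp; congr EFin; rewrite !indicE; congr (_%:R).
  rewrite in_setI (mem_set Pp) andTb; exact: erefl.
rewrite integral_indic//; congr (nu _).
by apply/seteqP; split=> p /=; [move=> [[Pp Ap] _]; split=> //; split=> //;
  exact: tP|move=> [Pp [Ap _]]].
Qed.

Lemma transfer (f : T2 -> R) : measurable_fun D f ->
  (\int[nu]_(p in P) (f (t p))%:E = \int[mu]_(x in D) (f x * rho x)%:E)%E.
Proof.
move=> mf; rewrite (integralE nu) (integralE mu).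
have me : measurable_fun D (EFin \o f) by exact/measurable_EFinP.
congr (_ - _)%E.
  transitivity (\int[nu]_(p in P) ((EFin \o f)^\+ (t p)))%E; first by apply: eq_integral => p _;
    rewrite !funepos.unlock.
  rewrite ge0_transfer; [|by []|exact: measurable_funepos].
  apply: eq_integral => x; rewrite inE => Dx; rewrite !funepos.unlock /=.
  by rewrite -!EFin_max -EFinM maxr_pMl ?mul0r// ltW// rho0.
transitivity (\int[nu]_(p in P) ((EFin \o f)^\- (t p)))%E; first by apply: eq_integral => p _;
  rewrite !funeneg.unlock.
rewrite ge0_transfer; [|by []|exact: measurable_funeneg].
apply: eq_integral => x; rewrite inE => Dx; rewrite !funeneg.unlock /=.
by rewrite -!EFin_max -EFinM maxr_pMl ?mul0r ?mulNr// ltW// rho0.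
Qed.

Lemma transfer_L1 (f : T2 -> R) : measurable_fun D f ->
  L1 nu P (fun p => f (t p)) <-> L1 mu D (fun x => f x * rho x).
Proof.
move=> mf.
have mft : measurable_fun P (fun p => (f (t p))%:E).
  apply/measurable_EFinP; apply: (measurable_comp mD) mf mt.
  by move=> _ [p Pp <-]; exact: tP.
have mfr : measurable_fun D (fun x => (f x * rho x)%:E).
  by apply/measurable_EFinP; exact: measurable_funM.
have E : (\int[nu]_(p in P) `|(f (t p))%:E| = \int[mu]_(x in D) `|(f x * rho x)%:E|)%E.
  transitivity (\int[mu]_(x in D) (`|(f x)%:E| * (rho x)%:E))%E.
    rewrite -(@ge0_transfer (fun x => `|(f x)%:E|%E))//.
    by apply: measurableT_comp => //; exact/measurable_EFinP.
  apply: eq_integral => x; rewrite inE => Dx.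
  by rewrite EFinM abseM (@gee0_abs _ (rho x)%:E)// lee_fin ltW// rho0.
split=> /integrableP[_ H]; apply/integrableP; split=> //=.
  by move: H; rewrite /comp E.
by move: H; rewrite /comp -E.
Qed.

(** Over the set that corresponds to a null set the positive density [rho] has integral zero, so
    that set is null as well. *)
Lemma transfer_ae (Q : T1 -> Prop) : {ae nu, forall p, Q p} ->
  {ae mu, forall x, D x -> Q (s x)}.
Proof.
move=> [N [mN N0 HN]].
pose B := D `&` s @^-1` N; have mB : measurable B by exact: ms.
have BD : B `<=` D by move=> x [].
have mrB : measurable_fun B (fun x => (rho x)%:E).
  by apply/measurable_EFinP; apply: measurable_funS mrho.
have mPB : measurable (P `&` t @^-1` B) by exact: mt.
have I0 : (\int[mu]_(x in B) (rho x)%:E = 0)%E.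
  rewrite -nuE//; apply/eqP; rewrite -measure_le0 -N0; apply: le_measure; rewrite ?inE//.
  by move=> p [Pp [_]] /=; rewrite st.
have : (\int[mu]_(x in B) `|(rho x)%:E| = 0)%E.
  by rewrite -I0; apply: eq_integral => x; rewrite inE => /BD Dx;
    rewrite gee0_abs// lee_fin ltW// rho0.
move/(ae_eq_integral_abs mu mB mrB) => H.
have : {ae mu, forall x, B x -> False}.
  by apply: filterS H => x Hx Bx; have := Hx Bx => /= -[] /eqP; rewrite gt_eqF// rho0//; exact: BD.
apply: filterS => x Hx Dx; apply: contrapT => nQ; apply: Hx; split=> //=.
exact: HN.
Qed.

End Transfer.

Section AlmostEverywhere.
Context {d : measure_display} {T : measurableType d} {R : realType}.
Variables (mu : {measure set T -> \bar R}) (D : set T).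
Hypothesis mD : measurable D.
Implicit Types f g : T -> R.

Lemma Int_ae f g : measurable_fun D f -> measurable_fun D g ->
  {ae mu, forall x, D x -> f x = g x} -> Int mu D f = Int mu D g.
Proof.
move=> mf mg fg; rewrite /Int /Rintegral; congr fine; apply: ae_eq_integral => //.
- exact/measurable_EFinP.
- exact/measurable_EFinP.
- by apply: filterS fg => x H Dx /=; rewrite H.
Qed.

Lemma L1_ae f g : measurable_fun D g ->
  {ae mu, forall x, D x -> f x = g x} -> L1 mu D f -> L1 mu D g.
Proof.
move=> mg fg Lf; have mf := L1_meas Lf; move: Lf => /integrableP[_ H].
apply/integrableP; split; first exact/measurable_EFinP.
apply: le_lt_trans H; rewrite le_eqVlt; apply/orP; left; apply/eqP.
apply: ae_eq_integral => //.
- by apply: measurableT_comp => //; exact/measurable_EFinP.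
- by apply: measurableT_comp => //; exact/measurable_EFinP.
- by apply: filterS fg => x Hx Dx /=; rewrite Hx.
Qed.

End AlmostEverywhere.

(** * Charts and frames *)

Section ManifoldCharts.
Context {R : realType} {m : nat} (X : closed_manifold R m).
Local Notation rV := 'rV[R]_m.
Implicit Types (c i j : chart_index X) (p : X) (x : rV).

Lemma img_inv c x : img c x -> dom c (chart_inv c x) /\ chart c (chart_inv c x) = x.
Proof. by move=> [p cp <-]; rewrite chartK. Qed.

Lemma open_chart_image c (O : set X) : open O -> open (chart c @` (dom c `&` O)).
Proof.
move=> oO; rewrite (_ : _ @` _ = img c `&` chart_inv c @^-1` O).
  by apply: open_preimage => //; [exact: img_open|exact: chart_inv_continuous].
apply/seteqP; split=> x.
  by move=> [p [cp Op] <-]; split; [exists p|rewrite /= chartK].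
by move=> [/img_inv[h1 h2] h3]; exists (chart_inv c x).
Qed.

Lemma smooth_funE (f : X -> R) : smooth_fun f <-> forall c, smooth (img c) (f \o chart_inv c).
Proof. by rewrite /smooth_fun /smooth_on; split=> H c; have := H c; rewrite setIT. Qed.

Lemma smooth_funM (f g : X -> R) : smooth_fun f -> smooth_fun g -> smooth_fun (fun p => f p * g p).
Proof.
move=> /smooth_funE sf /smooth_funE sg; apply/smooth_funE => c r.
by apply: (CkM (@img_open _ _ X c)); [exact: sf|exact: sg].
Qed.

Lemma smooth_funV (f : X -> R) : (forall p, f p != 0) -> smooth_fun f -> smooth_fun (fun p =>
  (f p)^-1).
Proof.
move=> f0 /smooth_funE sf; apply/smooth_funE => c r.
by apply: (CkV (@img_open _ _ X c)) => [x _|]; [exact: f0|exact: sf].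
Qed.

Lemma smooth_fun_sum (I : Type) (s : seq I) (f : I -> X -> R) : (forall n, smooth_fun (f n)) ->
  smooth_fun (fun p => \sum_(n <- s) f n p).
Proof.
move=> sf; apply/smooth_funE => c r.
by apply: (@Ck_sum _ _ r (img c) I s predT (fun n x => f n (chart_inv c x))) => [|n _];
  [exact: img_open|move: (sf n) => /smooth_funE; exact].
Qed.

Lemma smooth_fun_diff (f : X -> R) c p : smooth_fun f -> dom c p ->
  differentiable (f \o chart_inv c) (chart c p).
Proof. by move=> /smooth_funE /(_ c 1)[df _] cp; apply: df; exists p. Qed.

Lemma jac_entry i j p k l : dom i p -> dom j p ->
  differentiable (fun x => chart j (chart_inv i x) 0 l) (chart i p) /\
  jac i j p k l = pd k (fun x => chart j (chart_inv i x) 0 l) (chart i p).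
Proof.
move=> ip jp; have Vp : (chart i @` (dom i `&` dom j)) (chart i p) by exists p.
have dl q : differentiable (fun x => chart j (chart_inv i x) 0 q) (chart i p).
  by apply: (transition_smooth i j q 1).1.
split=> //; have dJ : differentiable (fun x => chart j (chart_inv i x)) (chart i p)
  by exact: differentiable_row.
rewrite /jac /jacobian mxE /pd -deriveE// derive_mx; last exact: diff_derivable.
by rewrite mxE.
Qed.

Lemma dchart_chain i j k (f : X -> R) p : smooth_fun f -> dom i p -> dom j p ->
  dchart i k f p = \sum_l jac i j p k l * dchart j l f p.
Proof.
move=> sf ip jp.
have oV : open (chart i @` (dom i `&` dom j)) by apply: open_chart_image; exact: dom_open.
have Vp : (chart i @` (dom i `&` dom j)) (chart i p) by exists p.
pose t x := chart j (chart_inv i x).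
have tp : t (chart i p) = chart j p by rewrite /t chartK.
rewrite /dchart (@pd_eq _ _ k _ ((f \o chart_inv j) \o t) _ _ oV Vp); last first.
  by move=> _ [q [iq jq] <-] /=; rewrite /t !chartK.
have [_ ->] := @pd_chain _ _ _ k t (f \o chart_inv j) (chart i p)
   (fun l => (jac_entry k l ip jp).1) (eq_ind_r (fun y => differentiable _ y)
     (smooth_fun_diff sf jp) tp).
by rewrite tp; apply: eq_bigr => l _; rewrite (jac_entry k l ip jp).2.
Qed.

Lemma dchart_covector (f : X -> R) : smooth_fun f ->
  is_covector_field (fun i q => \col_k dchart i k f q).
Proof.
move=> sf i j p ip jp; apply/matrixP => k l; rewrite !mxE (dchart_chain k sf ip jp).
by apply: eq_bigr => q _; congr (_ * _); rewrite mxE.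
Qed.

Lemma dchart_eq0 i k (f : X -> R) (O : set X) p : open O -> O p -> dom i p ->
  (forall q, O q -> f q = 0) -> dchart i k f p = 0.
Proof.
move=> oO Op ip f0; have Vp : (chart i @` (dom i `&` O)) (chart i p) by exists p.
rewrite /dchart (@pd_eq _ _ k _ (fun=> 0) _ _ (@open_chart_image i _ oO) Vp) ?pd_cst//.
by move=> _ [q [iq Oq] <-] /=; rewrite chartK// f0.
Qed.

Lemma dchart_sum i k (I : Type) (s : seq I) (f : I -> X -> R) p : (forall n, smooth_fun (f n)) ->
  dom i p -> dchart i k (fun q => \sum_(n <- s) f n q) p = \sum_(n <- s) dchart i k (f n) p.
Proof.
move=> sf ip; have [_ H] := @pd_sum R m k I s predT (fun n => f n \o chart_inv i) (chart i p)
  (fun n => smooth_fun_diff (sf n) ip).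
exact: H.
Qed.

Definition chart_extend c (z : rV -> R) (p : X) : R :=
  if `[< dom c p >] then z (chart c p) else 0.

Lemma chart_extendE c z p : dom c p -> chart_extend c z p = z (chart c p).
Proof. by move=> cp; rewrite /chart_extend asboolT. Qed.

Section Extend.
Variables (c : chart_index X) (K : set rV) (z : rV -> R).
Hypotheses (cK : compact K) (Kc : K `<=` img c) (sz : smooth setT z).
Hypothesis zK : forall x, ~ K x -> z x = 0.

Lemma chart_extend0 p : ~ (chart_inv c @` K) p -> chart_extend c z p = 0.
Proof.
move=> np; rewrite /chart_extend; case: asboolP => // cp; apply: zK => Kp.
by apply: np; exists (chart c p) => //; rewrite chartK.
Qed.

(** The image of a compact set is compact, hence closed, the carrier being a Hausdorff space. *)
Lemma open_chart_outside : open (~` (chart_inv c @` K)).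
Proof.
apply: closed_openC; apply: compact_closed; first exact: manifold_hausdorff.
apply: continuous_compact => //; apply: continuous_in_subspaceT => x.
by rewrite inE => /Kc; exact: chart_inv_continuous.
Qed.

(** In a chart [j] the function is [z] after a transition map on the domain of [c], and 0 off the
    compact image of [K]; these two open sets cover everything. *)
Lemma smooth_chart_extend : smooth_fun (chart_extend c z).
Proof.
apply/smooth_funE => j r; pose W (b : bool) :=
  chart j @` (dom j `&` if b then dom c else ~` (chart_inv c @` K)).
have oW b : open (W b).
  by apply: open_chart_image; case: b; [exact: dom_open|exact: open_chart_outside].
apply: (@Ck_sub _ _ _ (\bigcup_(b in setT) W b)).
  move=> _ [q jq <-]; have [cq|ncq] := pselect (dom c q); first by exists true => //; exists q.
  exists false => //; exists q => //; split=> // -[x Kx xq]; apply: ncq.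
  by rewrite -xq; have [] := img_inv (Kc Kx).
apply: Ck_bigcup => -[] _.
  apply: (@Ck_eq _ _ _ _ (z \o (fun x => chart c (chart_inv j x)))) => //.
    by move=> _ [q [jq cq] <-] /=; rewrite !chartK// chart_extendE.
  apply: (@Ck_comp _ _ _ r _ setT) => // l.
  exact: transition_smooth.
apply: (Ck_eq (oW false)) (Ck_cst r _ 0).
by move=> _ [q [jq nq] <-] /=; rewrite chartK// chart_extend0.
Qed.

Lemma dchart_extend k p : dom c p -> dchart c k (chart_extend c z) p = pd k z (chart c p).
Proof.
move=> cp; apply: (@pd_eq _ _ k _ z (img c)); [exact: img_open|by exists p|].
by move=> x /img_inv[h1 h2] /=; rewrite chart_extendE// h2.
Qed.

Lemma dchart_extend_out i k p : dom i p -> ~ (chart_inv c @` K) p ->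
  dchart i k (chart_extend c z) p = 0.
Proof.
move=> ip np; apply: (dchart_eq0 k open_chart_outside np ip) => q.
exact: chart_extend0.
Qed.

End Extend.

End ManifoldCharts.

(** * From the chart chosen at a point to a fixed chart *)

Section FrameChange.
Context {R : realType} {m : nat} {X : closed_manifold R m} {h : riemannian_metric X}.
Variable S : spin_structure h.
Variable p : X.
Local Notation c' := (chart_at p).
Local Notation rc := (real_complex R).
Variable c : chart_index X.
Hypothesis cp : dom c p.
Let cp' : dom c' p := dom_chart_at p.
Local Notation A := (frame_change (frame S) c c' p).
Local Notation T := (spin_trans S c c' p).

Lemma frame_unit i : dom i p -> frame S i p \in unitmx.
Proof. by move=> ip; have := frame_orthonormal S ip; rewrite -mulmxA => /mulmx1_unit[]. Qed.

Lemma frame_change_frame : A *m frame S c' p = frame S c p *m jac c c' p.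
Proof. by rewrite -mulmxA mulVmx ?mulmx1// frame_unit. Qed.

(** Both frames are orthonormal for the same metric, whose two matrices are related through the
    Jacobian by [gmat_covariant]. *)
Lemma frame_change_orth : A *m A^T = 1%:M.
Proof.
have gE : invmx (frame S c' p) *m (invmx (frame S c' p))^T = h c' p.
  have u := frame_unit cp'.
  rewrite -{1}(mulmx1 (invmx _)) -(frame_orthonormal S cp') -!mulmxA mulKmx//.
  by rewrite -trmx_mul mulVmx// trmx1 mulmx1.
rewrite /frame_change !trmx_mul -!mulmxA (mulmxA (invmx _)) gE.
rewrite (mulmxA (h c' p)) (mulmxA (jac c c' p)) (mulmxA (jac c c' p)) -gmat_covariant//.
by rewrite mulmxA frame_orthonormal.
Qed.

Lemma frame_change_orthT : A^T *m A = 1%:M.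
Proof. exact/mulmx1C/frame_change_orth. Qed.

Lemma frame_change_col b e : \sum_a A a b * A a e = (b == e)%:R.
Proof.
have := congr1 (fun M : 'M[R]_m => M b e) frame_change_orthT; rewrite [in RHS]mxE => <-.
by rewrite mxE; apply: eq_bigr => a _; congr (_ * _); apply/esym; rewrite mxE.
Qed.

Lemma frame_change_dot (u v : 'I_m -> R) :
  \sum_a (\sum_b A a b * u b) * (\sum_b A a b * v b) = \sum_b u b * v b.
Proof.
transitivity (\sum_b \sum_e (u b * v e) * \sum_a A a b * A a e).
  under eq_bigr => a _ do rewrite mulr_suml.
  rewrite exchange_big; apply: eq_bigr => b _.
  under eq_bigr => a _ do rewrite mulr_sumr.
  rewrite exchange_big; apply: eq_bigr => e _; rewrite mulr_sumr.
  by apply: eq_bigr => a _; ring.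
apply: eq_bigr => b _; rewrite (bigD1 b)//= frame_change_col eqxx mulr1 big1 ?addr0// => e eb.
by rewrite frame_change_col eq_sym (negPf eb) mulr0.
Qed.

Definition chart_covector (w : chart_index X -> X -> 'cV[R]_m) (a : 'I_m) : R :=
  (frame S c p *m w c p) a 0.

Lemma chart_covectorE w a : is_covector_field w ->
  chart_covector w a = \sum_b A a b * covector_frame S w p b.
Proof.
move=> Hw; rewrite /chart_covector (Hw c c')// mulmxA -frame_change_frame -mulmxA mxE.
exact: eq_bigr.
Qed.

Lemma covector_dot w w' : is_covector_field w -> is_covector_field w' ->
  \sum_a covector_frame S w p a * covector_frame S w' p a =
  \sum_a chart_covector w a * chart_covector w' a.
Proof.
move=> Hw Hw'; rewrite -frame_change_dot; apply: eq_bigr => a _.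
by rewrite !chart_covectorE.
Qed.

Lemma trans_unitary : adj T *m T = 1%:M.
Proof.
apply: (@spin_unitary _ _ _ (gamma S)); [exact: gamma_clifford|exact: gamma_skew|].
exact: trans_spin.
Qed.

Lemma hnorm2_chart psi : is_spinor_field S psi -> hnorm2 (psi c p) = hnorm2 (psi c' p).
Proof. by move=> Hp; rewrite (Hp c c')// hnorm2_unitary// trans_unitary. Qed.

Definition chart_current (psi eta : chart_index X -> X -> 'cV[R[i]]_(spin_dim m)) a : R :=
  rprod (gamma S a *m psi c p) (eta c p).

Lemma gamma_trans a (u : 'cV[R[i]]_(spin_dim m)) :
  gamma S a *m (T *m u) = T *m \sum_b rc (A a b) *: (gamma S b *m u).
Proof.
rewrite mulmxA trans_lift// -mulmxA; congr (_ *m _).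
rewrite /clifford mulmx_suml; apply: eq_bigr => b _.
by rewrite -scalemxAl mxE.
Qed.

Lemma chart_currentE psi eta a : is_spinor_field S psi -> is_spinor_field S eta ->
  chart_current psi eta a = \sum_b A a b * rprod (gamma S b *m psi c' p) (eta c' p).
Proof.
move=> Hp He; rewrite /chart_current (Hp c c')// (He c c')// gamma_trans.
rewrite /rprod hprod_unitary ?trans_unitary// -/(rprod _ _) rprod_suml.
by apply: eq_bigr => b _; rewrite rprodZl.
Qed.

Lemma current_dot psi eta w : is_spinor_field S psi -> is_spinor_field S eta ->
  is_covector_field w ->
  \sum_a rprod (gamma S a *m psi c' p) (eta c' p) * covector_frame S w p a =
  \sum_a chart_current psi eta a * chart_covector w a.
Proof.
move=> Hp He Hw; rewrite -frame_change_dot; apply: eq_bigr => a _.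
by rewrite chart_currentE// chart_covectorE.
Qed.

Definition chart_nabla (D : chart_index X -> X -> 'I_m -> 'cV[R[i]]_(spin_dim m)) a :=
  \sum_k rc (frame S c p a k) *: D c p k.

Lemma chart_nablaE D a : is_spinor_form S D ->
  chart_nabla D a = T *m \sum_b rc (A a b) *: nabla_frame S D p b.
Proof.
move=> HD; rewrite /chart_nabla.
transitivity (T *m \sum_l rc ((frame S c p *m jac c c' p) a l) *: D c' p l).
  transitivity (\sum_k T *m (rc (frame S c p a k) *: \sum_l rc (jac c c' p k l) *: D c' p l)).
    by apply: eq_bigr => k _; rewrite (HD c c')// scalemxAr.
  rewrite -mulmx_sumr; congr (_ *m _).
  under eq_bigr => k _ do rewrite scaler_sumr.
  rewrite exchange_big; apply: eq_bigr => l _ /=.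
  rewrite mxE rmorph_sum scaler_suml; apply: eq_bigr => k _.
  by rewrite scalerA rmorphM.
congr (_ *m _); rewrite -frame_change_frame.
under [RHS]eq_bigr => b _ do rewrite scaler_sumr.
rewrite exchange_big; apply: eq_bigr => l _ /=.
rewrite mxE rmorph_sum scaler_suml; apply: eq_bigr => k _.
by rewrite scalerA rmorphM.
Qed.

Lemma rc_sum (I : finType) (F : I -> R) : rc (\sum_i F i) = \sum_i rc (F i).
Proof. exact: rmorph_sum. Qed.

(** Orthogonality of [A] for values in any complex module, to serve both for spinors and for
    hermitian products. *)
Lemma frame_change_sum (V : lmodType R[i]) (G : 'I_m -> 'I_m -> V) :
  \sum_a \sum_b \sum_e rc (A a b * A a e) *: G b e = \sum_b G b b.
Proof.
transitivity (\sum_b \sum_e rc (\sum_a A a b * A a e) *: G b e).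
  rewrite exchange_big; apply: eq_bigr => b _; rewrite exchange_big; apply: eq_bigr => e _.
  by rewrite rc_sum scaler_suml.
apply: eq_bigr => b _;
  rewrite (bigD1 b)//= frame_change_col eqxx rmorph1 scale1r big1 ?addr0// => e eb.
by rewrite frame_change_col eq_sym (negPf eb) rmorph0 scale0r.
Qed.

(** The rotation in the Clifford action and the one in the derivative are by the same matrix and
    cancel by orthogonality; only the lift [T] is left. *)
Lemma chart_diracE D : is_spinor_form S D ->
  \sum_a gamma S a *m chart_nabla D a = T *m Defs.dirac S D p.
Proof.
move=> HD; rewrite /Defs.dirac -(frame_change_sum (fun b e => gamma S b *m nabla_frame S D p e))
  mulmx_sumr.
apply: eq_bigr => a _; rewrite chart_nablaE// gamma_trans; congr (_ *m _).
apply: eq_bigr => b _; rewrite mulmx_sumr scaler_sumr; apply: eq_bigr => e _.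
by rewrite -scalemxAr scalerA -rmorphM.
Qed.

Lemma rprod_dirac D psi : is_spinor_form S D -> is_spinor_field S psi ->
  rprod (\sum_a gamma S a *m chart_nabla D a) (psi c p) = rprod (Defs.dirac S D p) (psi c' p).
Proof. by move=> HD Hp; rewrite chart_diracE// (Hp c c')// /rprod hprod_unitary// trans_unitary.
  Qed.

Lemma hnorm2_nabla D : is_spinor_form S D ->
  \sum_a hnorm2 (chart_nabla D a) = \sum_a hnorm2 (nabla_frame S D p a).
Proof.
move=> HD; rewrite /hnorm2 -!Re_sum; congr complex.Re.
rewrite -(@frame_change_sum R[i]^o (fun b e => hprod (nabla_frame S D p b) (nabla_frame S D p e))).
apply: eq_bigr => a _; rewrite chart_nablaE// hprod_unitary ?trans_unitary// hprod_suml.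
apply: eq_bigr => b _; rewrite hprod_sumr; apply: eq_bigr => e _.
by rewrite hprodZl hprodZr conjc_real mulrA -rmorphM.
Qed.

End FrameChange.

(** * The equations in a chart *)

Section PointwiseCancellation.
Context {R : realType} {m : nat} {X : closed_manifold R m} {h : riemannian_metric X}.
Variables (S : spin_structure h) (n : nat) (kappa : R).
Variables (phi : 'I_n.+1 -> X -> R) (dphi : 'I_n.+1 -> chart_index X -> X -> 'cV[R]_m).
Variable psi : 'I_n.+1 -> chart_index X -> X -> 'cV[R[i]]_(spin_dim m).

(** [K l q] is the real part of a sum of terms [conjc (hprod (u j) (u l)) * hprod (u j) (u q)], and
    conjugation exchanges [l] and [q]. The term with [|dphi|^2] is symmetric too, so both sides
    reduce to [N i * phi k - N k * phi i]. *)
Lemma rhs_cancellation i k p :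
  rprod (spinor_rhs S kappa phi dphi psi i p) (spinor_at psi k p) -
  rprod (spinor_at psi i p) (spinor_rhs S kappa phi dphi psi k p) =
  map_rhs S phi dphi psi i p * phi k p - map_rhs S phi dphi psi k p * phi i p.
Proof.
pose u j := spinor_at psi j p; pose e j a := dphi_frame S dphi j p a.
pose N l := \sum_j \sum_a rprod (u l) (gamma S a *m u j) * e j a.
pose K l q := rprod (\sum_j (hprod (u j) (u l)) *: u j) (u q).
have E l q : rprod (spinor_rhs S kappa phi dphi psi l p) (u q) =
    - (phi l p * N q) - 2 * kappa * ((\sum_j hnorm2 (u j)) * rprod (u l) (u q) - K l q).
  rewrite /spinor_rhs rprodBl rprodNl rprodZl rprodBl rprodZl -/(K l q); congr (- _ - _).
  rewrite rprod_suml /N mulr_sumr; apply: eq_bigr => j _.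
  rewrite rprod_suml mulr_sumr; apply: eq_bigr => a _.
  by rewrite rprodZl -/(u j) -/(e j a) (rprodC (gamma S a *m _)); ring.
have KC l q : K l q = K q l.
  rewrite /K !rprod_suml; apply: eq_bigr => j _.
  by rewrite /rprod !hprodZl -[RHS]ReJ rmorphM /= conjcK mulrC.
have M l : map_rhs S phi dphi psi l p = (\sum_j \sum_a e j a ^+ 2) * phi l p + N l by [].
rewrite (etrans (rprodC _ _) (E k i) : rprod (spinor_at psi i p) _ = _)
  (E i k : rprod _ (spinor_at psi k p) = _).
rewrite !M (KC k) (rprodC (u k)); clearbody K N; clear E KC M.
move: (\sum_j hnorm2 _) (rprod _ _) (K i k) (N i) (N k) (\sum_j _) (phi i p) (phi k p).
by clear=> s a b c d f x y; ring.
Qed.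

End PointwiseCancellation.

Section ChartSetup.
Context {R : realType} {m : nat} {X : closed_manifold R m} {h : riemannian_metric X}.
Variable S : spin_structure h.
Local Notation rV := 'rV[R]_m.
Local Notation rc := (real_complex R).
Variable leb : {measure set (borel rV) -> \bar R}.
Hypothesis Hleb : is_lebesgue leb.
Variable vol : {measure set (borel X) -> \bar R}.
Hypothesis Hvol : is_volume h leb vol.
Variable c : chart_index X.

Definition loc_frame x := frame S c (chart_inv c x).
Definition loc_metric x := h c (chart_inv c x).
Local Notation rho := (vol_density loc_metric).

Lemma loc_frame_smooth a b : smooth (img c) (fun x => loc_frame x a b).
Proof. by have := frame_smooth S c a b; rewrite /smooth_on setIT. Qed.

Lemma loc_metric_smooth a b : smooth (img c) (fun x => loc_metric x a b).
Proof. by have := gmat_smooth h c a b; rewrite /smooth_on setIT. Qed.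

Lemma loc_metricT x : img c x -> (loc_metric x)^T = loc_metric x.
Proof. by move=> /img_inv[cx _]; exact: gmat_sym. Qed.

Lemma loc_frame_orth x : img c x -> loc_frame x *m loc_metric x *m (loc_frame x)^T = 1%:M.
Proof. by move=> /img_inv[cx _]; exact: frame_orthonormal. Qed.

Let oU : open (img c) := @img_open _ _ X c.
Let sE := loc_frame_smooth.
Let sg := loc_metric_smooth.
Let gT := loc_metricT.
Let EgE := loc_frame_orth.

Lemma conn_form_loc k x : img c x -> conn_form S c (chart_inv c x)
  k = loc_conn loc_frame loc_metric k x.
Proof. by move=> /img_inv[cx xc];
  rewrite /conn_form /loc_conn /loc_christoffel /dmx /christoffel /dchart xc. Qed.

Lemma spin_conn_loc k x : img c x -> spin_conn S c (chart_inv c x) k =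
  loc_spin_conn (gamma S) loc_frame loc_metric k x.
Proof. by move=> xc; rewrite /spin_conn conn_form_loc. Qed.

Variables (x0 : rV) (r : R).
Hypothesis cU : ccube x0 r `<=` img c.
Local Notation D := (cube x0 r).

Let mD := measurable_cube x0 r.
Let fD := leb_cube_lty Hleb x0 r.
Let DU : D `<=` img c.
Proof. by move=> x Dx; apply: cU => k; exact/ltW. Qed.

Definition patch : set X := dom c `&` chart c @^-1` D.

Lemma patch_open : open patch.
Proof.
by apply: open_preimage; [exact: dom_open|exact: chart_continuous|exact: open_cube].
Qed.

Lemma patch_measurable : measurable (patch : set (borel X)).
Proof. by apply: borel_open; exact: patch_open. Qed.

Lemma patch_inv x : D x -> patch (chart_inv c x).
Proof. by move=> Dx; have [h1 h2] := img_inv (DU Dx); split=> //=; rewrite h2. Qed.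

Lemma chart_invK x : D x -> chart c (chart_inv c x) = x.
Proof. by move=> Dx; have [] := img_inv (DU Dx). Qed.

Let mt : measurable_fun (patch : set (borel X)) (chart c : borel X -> borel rV).
Proof.
by apply: borel_continuous => [|p [cp _]]; [exact: patch_open|exact: chart_continuous].
Qed.

Let ms : measurable_fun (D : set (borel rV)) (chart_inv c : borel rV -> borel X).
Proof.
by apply: borel_continuous => [|x /DU]; [exact: open_cube|exact: chart_inv_continuous].
Qed.

Let rho0 x : D x -> 0 < rho x.
Proof. by move=> /DU; exact: (vol_density_gt0 EgE). Qed.

Lemma bmeas_smooth f : smooth (img c) f -> bmeas (D : set (borel rV)) f.
Proof. by move=> sf; apply: bmeas_ccube => y /cU; exact: (Ck_cont (sf 0)). Qed.

Lemma vol_smooth : smooth (img c) rho.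
Proof. exact: (smooth_vol oU sg EgE). Qed.

Let brho := bmeas_smooth vol_smooth.

Let nuE (B : set (borel rV)) : measurable B -> B `<=` D ->
  vol ((patch : set (borel X)) `&` chart c @^-1` B) = (\int[leb]_(x in B) (rho x)%:E)%E.
Proof.
move=> mB BD; rewrite (@Hvol c); [|exact: mt patch_measurable _ mB|by move=> p [[]]].
congr (integral _ _ _); apply/seteqP; split=> [_ [p [[cp Dp] Bp] <-]//|x Bx].
have Dx := BD x Bx; exists (chart_inv c x); last exact: chart_invK.
by split; [exact: patch_inv|rewrite /= chart_invK].
Qed.

Lemma chart_inv_meas (f : X -> R) : measurable_on c f ->
  measurable_fun (D : set (borel rV)) (f \o chart_inv c : borel rV -> R).
Proof.
move=> mf; apply: (@measurable_comp _ _ _ _ _ _ (dom c : set (borel X))) mf ms.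
  by apply: borel_open; exact: dom_open.
by move=> _ [x Dx <-]; have [] := patch_inv Dx.
Qed.

Lemma chart_inv_measT (f : X -> R) : measurable_fun setT (f : borel X -> R) ->
  measurable_fun (D : set (borel rV)) (f \o chart_inv c : borel rV -> R).
Proof. by move=> mf; apply: chart_inv_meas; apply: measurable_funTS. Qed.

Lemma chart_integral (f : X -> R) : measurable_fun (D : set (borel rV))
  (f \o chart_inv c : borel rV -> R) ->
  (\int[vol]_(p in patch) (f p)%:E = \int[leb]_(x in D) (f (chart_inv c x) * rho x)%:E)%E.
Proof.
move=> mf; rewrite -(transfer patch_measurable mD mt brho.1 (fun p => @proj2 _ _) rho0 nuE mf).
by apply: eq_integral => p; rewrite inE => -[cp _] /=; rewrite chartK.
Qed.

Lemma chart_L1 (f : X -> R) : measurable_fun (D : set (borel rV)) (f \o chart_inv c : borel rV ->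
  R) ->
  L1 vol (patch : set (borel X)) f <-> L1 leb D (fun x => f (chart_inv c x) * rho x).
Proof.
move=> mf; have H := transfer_L1 patch_measurable mD mt brho.1 (fun p => @proj2 _ _) rho0 nuE mf.
have E p : patch p -> f (chart_inv c (chart c p)) = f p by move=> [cp _]; rewrite chartK.
split=> [L|/H L]; last exact: (L1_eq patch_measurable E L).
apply/H; apply: (L1_eq patch_measurable _ L) => p Pp; exact/esym/E.
Qed.

Lemma chart_ae (Q : X -> Prop) : {ae vol, forall p : borel X, Q p} ->
  {ae leb, forall x : borel rV, D x -> Q (chart_inv c x)}.
Proof.
move=> HQ; apply: (transfer_ae patch_measurable mD mt ms brho.1 _ rho0 nuE HQ).
by move=> p [cp _]; exact: chartK.
Qed.

(** The inverse of [rho] is bounded on the cube, so integrability for the volume passes to Lebesgue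
    measure. The factor [C] allows [f] to be a pointwise norm and [G] a component. *)
Lemma Lp_chart (q : R) (f : X -> R) (G : rV -> R) (C : R) : 1 <= q -> Lp vol q f ->
  measurable_fun (D : set (borel rV)) (G : borel rV -> R) ->
  (forall x, D x -> `|G x| <= C * `|f (chart_inv c x)|) -> Lpow leb D q G.
Proof.
move=> q1 Lf mG HG; have q0 : 0 <= q by exact: le_trans q1.
have If := Lfun_integrable q1 Lf.
have mf : measurable_fun setT (f : borel X -> R).
  by move: Lf; rewrite /Lp inE => /andP[/[!inE]].
have mfq : measurable_fun (D : set (borel rV)) ((fun p => `|f p| `^ q)
  \o chart_inv c : borel rV -> R).
  by apply: (@measurable_pow _ (borel rV)); exact: chart_inv_measT.
have L2 : L1 leb D (fun x => `|f (chart_inv c x)| `^ q * rho x).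
  apply/(chart_L1 mfq); exact: (L1_sub patch_measurable measurableT).
have birho : bmeas (D : set (borel rV)) (fun x => (rho x)^-1).
  apply: bmeas_smooth => k; apply: CkV => //; last exact: vol_smooth.
  by move=> x xc; rewrite gt_eqF// (vol_density_gt0 EgE).
have L3 : L1 leb D (fun x => `|f (chart_inv c x)| `^ q).
  apply: (L1_eq mD _ (bmeasM_L1 mD birho L2)) => x Dx.
  by rewrite mulfK// gt_eqF// rho0.
have : Lpow leb D q (f \o chart_inv c) by split=> //; exact: chart_inv_measT.
move=> /(fun L => LpowM mD q0 L (bmeas_cst (D : set (borel rV)) C)).
apply: (@Lpow_le _ _ _ leb D mD) => // x Dx.
by apply: le_trans (HG x Dx) _; rewrite normrM ler_wpM2r// ler_norm.
Qed.

Lemma weak_pd_cube k (u v : X -> R) : weak_pd leb c k u v ->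
  cube_wpd leb x0 r k (u \o chart_inv c) (v \o chart_inv c).
Proof.
move=> wp z [sz [e er z0]].
have := wp z (conj sz (ex_intro _ (ccube x0 e) _)).
have cD := ccube_sub_cube er.
have H f : (forall x, ~ ccube x0 e x -> f x = 0) ->
    (\int[leb]_(x in img c) (f x)%:E = \int[leb]_(x in D) (f x)%:E)%E.
  move=> f0; rewrite integral_mkcond [RHS]integral_mkcond; apply: eq_integral => x _.
  rewrite !patchE; case: ifPn => hU; case: ifPn => hD //.
    by rewrite f0// => /cD; move: hD; rewrite notin_setE.
  by move: hU hD; rewrite notin_setE inE => hU /DU.
rewrite !H; last 2 first.
- by move=> x nx; rewrite z0// mulr0.
- by move=> x nx; rewrite (pd_out k z0 nx) mulr0.
move=> E; rewrite /Int /Rintegral -fineN; congr fine; apply: E; split=> //.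
- exact: ccube_compact.
- by move=> x /cD /DU.
Qed.

End ChartSetup.

(** * Smoothness and integrability of components in a chart *)

Section SmoothMatrices.
Context {R : realType} {m : nat}.
Local Notation rV := 'rV[R]_m.
Variable U : set rV.
Hypothesis oU : open U.

Definition smooth_mx (F : rV -> 'M[R]_m) := forall a b, smooth U (fun x => F x a b).

Lemma smooth_mxM F G : smooth_mx F -> smooth_mx G -> smooth_mx (fun x => F x *m G x).
Proof.
move=> sF sG a b q.
apply: (Ck_eq oU) (_ : Ck q U (fun x => \sum_e F x a e * G x e b)); first by move=> x _;
  rewrite mxE.
by apply: Ck_sum => // e _; apply: CkM => //; [exact: sF|exact: sG].
Qed.

Lemma smooth_mxD F G : smooth_mx F -> smooth_mx G -> smooth_mx (fun x => F x + G x).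
Proof.
move=> sF sG a b q.
apply: (Ck_eq oU) (_ : Ck q U (fun x => F x a b + G x a b)); first by move=> x _; rewrite mxE.
by apply: CkD => //; [exact: sF|exact: sG].
Qed.

Lemma smooth_mxT F : smooth_mx F -> smooth_mx (fun x => (F x)^T).
Proof.
by move=> sF a b q; apply: (Ck_eq oU) (sF b a q) => x _; rewrite mxE.
Qed.

Lemma smooth_mx_eq F G : (forall x, U x -> F x = G x) -> smooth_mx F -> smooth_mx G.
Proof. by move=> FG sF a b q; apply: (Ck_eq oU) (sF a b q) => x Ux; rewrite FG. Qed.

Variables E g : rV -> 'M[R]_m.
Hypothesis sE : smooth_mx E.
Hypothesis sg : smooth_mx g.
Hypothesis EgE : forall x, U x -> E x *m g x *m (E x)^T = 1%:M.

Lemma smooth_coframe : smooth_mx (fun x => g x *m (E x)^T).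
Proof. by apply: smooth_mxM => //; exact: smooth_mxT. Qed.

(** The inverse metric is [E^T *m E], polynomial in the frame. *)
Lemma smooth_metric_inv : smooth_mx (fun x => invmx (g x)).
Proof.
apply: (@smooth_mx_eq (fun x => (E x)^T *m E x)) => [x Ux|].
  by rewrite (metric_inv EgE).
by apply: smooth_mxM => //; exact: smooth_mxT.
Qed.

Lemma smooth_loc_conn k : smooth_mx (loc_conn E g k).
Proof.
have spd f l : smooth U f -> smooth U (pd l f) by move=> sf q; exact: (sf q.+1).2.
apply: smooth_mxM; last exact: smooth_mxT.
apply: smooth_mxM => //; apply: smooth_mxD.
  by move=> a b q; apply: (Ck_eq oU) (spd _ k (sE a b) q) => x _; rewrite mxE.
apply: smooth_mxM => //; apply: smooth_mxM; last exact: smooth_metric_inv.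
move=> a b q.
apply: (Ck_eq oU) (_ : Ck q U (fun x => 2^-1 * (pd k (fun y => g y a b) x + pd a (fun y =>
  g y k b) x
     - pd b (fun y => g y k a) x))); first by move=> x _; rewrite mxE.
apply: CkZ => //; apply: CkB => //; last exact: spd.
by apply: CkD => //; exact: spd.
Qed.

End SmoothMatrices.

Section ComplexParts.
Context {R : realType}.
Local Notation rc := (real_complex R).
Implicit Types x y : R[i].

Lemma ImD x y : complex.Im (x + y) = complex.Im x + complex.Im y.
Proof. by case: x y => [a b] [c e]. Qed.

Lemma ImZ (a : R) x : complex.Im (rc a * x) = a * complex.Im x.
Proof. by case: x => [u v] /=; rewrite mul0r addr0. Qed.

Lemma Im_sum (I : finType) (F : I -> R[i]) : complex.Im (\sum_i F i) = \sum_i complex.Im (F i).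
Proof. by apply: (big_ind2 (fun u v => complex.Im u = v)) => // x1 x2 y1 y2 <- <-; exact: ImD. Qed.

Lemma ReM x y : complex.Re (x * y) = complex.Re x * complex.Re y - complex.Im x * complex.Im y.
Proof. by case: x y => [a b] [c e]. Qed.

Lemma ImM x y : complex.Im (x * y) = complex.Re x * complex.Im y + complex.Im x * complex.Re y.
Proof. by case: x y => [a b] [c e]. Qed.

Lemma ReB x y : complex.Re (x - y) = complex.Re x - complex.Re y.
Proof. by case: x y => [a b] [c e]. Qed.

Lemma ImB x y : complex.Im (x - y) = complex.Im x - complex.Im y.
Proof. by case: x y => [a b] [c e]. Qed.

Lemma normr_le_sqrt (a b : R) : a ^+ 2 <= b -> `|a| <= Num.sqrt b.
Proof. by move=> ab; rewrite -sqrtr_sqr ler_wsqrtr. Qed.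

Lemma normr_sum_le (I : finType) (G B y : I -> R) (n : R) : (forall i, `|G i| <= B i) ->
  (forall i, `|y i| <= n) -> `|\sum_i G i * y i| <= (\sum_i B i) * n.
Proof.
move=> HG Hy; apply: le_trans (ler_norm_sum _ _ _) _; rewrite mulr_suml.
by apply: ler_sum => i _; rewrite normrM ler_pM.
Qed.

End ComplexParts.

Lemma cube_wpd_eq (R : realType) (m : nat) (leb : {measure set (borel 'rV[R]_m) -> \bar R})
  x0 r k (u v w : 'rV[R]_m -> R) : (forall x, cube x0 r x -> v x = w x) ->
  cube_wpd leb x0 r k u v -> cube_wpd leb x0 r k u w.
Proof.
by move=> vw H z tz; rewrite H//; congr (- _); apply: Int_eq => x Dx; rewrite vw.
Qed.

Section LpowSum.
Context {d : measure_display} {T : measurableType d} {R : realType}.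
Variables (mu : {measure set T -> \bar R}) (D : set T).
Hypothesis mD : measurable D.

Lemma Lpow_sum (p : R) (I : finType) (F : I -> T -> R) : 1 <= p ->
  (forall i, Lpow mu D p (F i)) -> Lpow mu D p (fun x => \sum_i F i x).
Proof.
move=> p1 HF; have p0 : 0 <= p by exact: le_trans p1.
elim: (index_enum I) => [|i s IH].
  have -> : (fun x => \sum_(i <- [::]) F i x) = fun=> 0 by apply/funext => x; rewrite big_nil.
  split; first exact: measurable_cst.
  by apply: (L1_eq mD (f := fun=> 0)) (L1_0 _ _) => x _;
    rewrite normr0 powR0// gt_eqF// (lt_le_trans _ p1).
have -> : (fun x => \sum_(j <- i :: s) F j x) = fun x => F i x + \sum_(j <- s) F j x.
  by apply/funext => x; rewrite big_cons.
exact: LpowD.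
Qed.

Lemma LpowB (p : R) (f g : T -> R) : 0 <= p -> Lpow mu D p f -> Lpow mu D p g ->
  Lpow mu D p (fun x => f x - g x).
Proof.
move=> p0 Lf Lg; apply: LpowD => //.
have := LpowM mD p0 Lg (bmeas_cst D (-1)).
by congr (Lpow _ _ _); apply/funext => x; rewrite mulN1r.
Qed.

End LpowSum.

Section ChartBounds.
Context {R : realType} {m : nat} {X : closed_manifold R m} {h : riemannian_metric X}.
Variable S : spin_structure h.
Local Notation rV := 'rV[R]_m.
Local Notation N := (spin_dim m).
Local Notation rc := (real_complex R).
Variable leb : {measure set (borel rV) -> \bar R}.
Hypothesis Hleb : is_lebesgue leb.
Variable vol : {measure set (borel X) -> \bar R}.
Hypothesis Hvol : is_volume h leb vol.
Variable c : chart_index X.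
Variables (x0 : rV) (r : R).
Hypothesis cU : ccube x0 r `<=` img c.
Local Notation D := (cube x0 r).
Local Notation inv := (chart_inv c).
Local Notation E := (loc_frame S c).
Local Notation g := (@loc_metric _ _ _ h c).

Let mD := measurable_cube x0 r.
Let fD := leb_cube_lty Hleb x0 r.
Let oU : open (img c) := @img_open _ _ X c.
Let DU : D `<=` img c.
Proof. by move=> x Dx; apply: cU => k; exact/ltW. Qed.
Let dU x : D x -> dom c (inv x).
Proof. by move=> /DU /img_inv[]. Qed.

Let bnd f : smooth (img c) f -> exists B : R, forall x, D x -> `|f x| <= B.
Proof. by move=> /(bmeas_smooth cU)[_]. Qed.

Lemma spinor_Lpow q psi s : 1 <= q -> is_spinor_field S psi -> measurable_spinor psi ->
  Lp vol q (spinor_norm psi) ->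
  Lpow leb D q (fun x => complex.Re (psi c (inv x) s 0)) /\
  Lpow leb D q (fun x => complex.Im (psi c (inv x) s 0)).
Proof.
move=> q1 Hp Hm HL; split.
  apply: (Lp_chart S Hvol cU (C := 1) q1 HL); first exact: (chart_inv_meas cU (Hm c s).1).
  move=> x Dx; rewrite mul1r (ger0_norm (sqrtr_ge0 _)); apply: normr_le_sqrt.
  by rewrite -(hnorm2_chart (dU Dx) Hp); exact: Re_le_hnorm.
apply: (Lp_chart S Hvol cU (C := 1) q1 HL); first exact: (chart_inv_meas cU (Hm c s).2).
move=> x Dx; rewrite mul1r (ger0_norm (sqrtr_ge0 _)); apply: normr_le_sqrt.
by rewrite -(hnorm2_chart (dU Dx) Hp); exact: Im_le_hnorm.
Qed.

(** [g *m E^T] is the inverse of [E], so it leads from frame components back to coordinate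
    components. *)
Lemma coframe_sum x (D0 : 'I_m -> 'cV[R[i]]_N) k : D x ->
  D0 k = \sum_a rc ((g x *m (E x)^T) k a) *: \sum_l rc (E x a l) *: D0 l.
Proof.
move=> Dx; transitivity (\sum_l rc ((g x *m (E x)^T *m E x) k l) *: D0 l).
  rewrite (frame_inv (@loc_frame_orth _ _ _ _ S c) (DU Dx)) (bigD1 k)//= big1 ?addr0 => [|l lk].
    by rewrite mxE eqxx rmorph1 scale1r.
  by rewrite mxE eq_sym (negPf lk) rmorph0 scale0r.
under [RHS]eq_bigr => a _ do rewrite scaler_sumr.
rewrite exchange_big; apply: eq_bigr => l _ /=.
rewrite mxE rmorph_sum scaler_suml; apply: eq_bigr => a _.
by rewrite scalerA rmorphM.
Qed.

Lemma nabla_bound (p : X) D0 a s : dom c p -> is_spinor_form S D0 ->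
  `|complex.Re (chart_nabla S p c D0 a s 0)| <= spinor_form_norm S D0 p /\
  `|complex.Im (chart_nabla S p c D0 a s 0)| <= spinor_form_norm S D0 p.
Proof.
move=> cp HD; rewrite /spinor_form_norm -(hnorm2_nabla cp HD).
have H : hnorm2 (chart_nabla S p c D0 a) <= \sum_b hnorm2 (chart_nabla S p c D0 b).
  by rewrite (bigD1 a)//= lerDl sumr_ge0// => b _; exact: hnorm2_ge0.
by split; apply: normr_le_sqrt; apply: le_trans H; [exact: Re_le_hnorm|exact: Im_le_hnorm].
Qed.

(** The pointwise norm controls the frame components in every chart, by unitarity of the change of
    frame; coordinate components follow with the bounds [B a] on the coframe. *)
Lemma form_Lpow q (D0 : chart_index X -> X -> 'I_m -> 'cV[R[i]]_N) k s : 1 <= q ->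
  is_spinor_form S D0 ->
  (forall l, measurable_spinor (fun i p => D0 i p l)) -> Lp vol q (spinor_form_norm S D0) ->
  Lpow leb D q (fun x => complex.Re (D0 c (inv x) k s 0)) /\
  Lpow leb D q (fun x => complex.Im (D0 c (inv x) k s 0)).
Proof.
move=> q1 HD Hm HL.
have /choice[B HB] : forall a, exists B : R, forall x, D x -> `|(g x *m (E x)^T) k a| <= B.
  move=> a; apply: bnd.
  exact: (smooth_coframe oU (@loc_frame_smooth _ _ _ _ S c) (@loc_metric_smooth _ _ _ h c)).
have EQ x : D x -> D0 c (inv x) k = \sum_a rc ((g x *m (E x)^T) k a) *: chart_nabla S (inv x)
  c D0 a.
  by move=> Dx; exact: (coframe_sum (D0 c (inv x)) k Dx).
have n0 p : 0 <= spinor_form_norm S D0 p by exact: sqrtr_ge0.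
split; apply: (Lp_chart S Hvol cU (C := \sum_a B a) q1 HL).
- exact: (chart_inv_meas cU (Hm k c s).1).
- move=> x Dx; rewrite EQ// summxE Re_sum (ger0_norm (n0 _)).
  under eq_bigr => a _ do rewrite mxE ReZ.
  by apply: normr_sum_le => a; [exact: HB|exact: (nabla_bound a s (dU Dx) HD).1].
- exact: (chart_inv_meas cU (Hm k c s).2).
- move=> x Dx; rewrite EQ// summxE Im_sum (ger0_norm (n0 _)).
  under eq_bigr => a _ do rewrite mxE ImZ.
  by apply: normr_sum_le => a; [exact: HB|exact: (nabla_bound a s (dU Dx) HD).2].
Qed.

Lemma covector_Lpow q (w : chart_index X -> X -> 'cV[R]_m) k : 1 <= q -> is_covector_field w ->
  measurable_covector w -> Lp vol q (covector_norm S w) ->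
  Lpow leb D q (fun x => w c (inv x) k 0).
Proof.
move=> q1 Hw Hm HL.
have /choice[B HB] : forall a, exists B : R, forall x, D x -> `|(g x *m (E x)^T) k a| <= B.
  move=> a; apply: bnd.
  exact: (smooth_coframe oU (@loc_frame_smooth _ _ _ _ S c) (@loc_metric_smooth _ _ _ h c)).
apply: (Lp_chart S Hvol cU (C := \sum_a B a) q1 HL); first exact: (chart_inv_meas cU (Hm c k)).
move=> x Dx; rewrite (ger0_norm (sqrtr_ge0 _)).
have -> : w c (inv x) k 0 = \sum_a (g x *m (E x)^T) k a * chart_covector S (inv x) c w a.
  transitivity ((g x *m (E x)^T *m (E x *m w c (inv x))) k 0).
    by rewrite mulmxA (frame_inv (@loc_frame_orth _ _ _ _ S c) (DU Dx)) mul1mx.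
  by rewrite mxE.
apply: normr_sum_le => a; first exact: HB.
apply: normr_le_sqrt.
have -> : \sum_b covector_frame S w (inv x) b ^+ 2 = \sum_b chart_covector S (inv x)
  c w b * chart_covector S (inv x) c w b.
  by rewrite -(covector_dot S (dU Dx) Hw Hw); apply: eq_bigr => b _; rewrite expr2.
by rewrite (bigD1 a)//= -expr2 lerDl sumr_ge0// => b _; rewrite -expr2 sqr_ge0.
Qed.

Lemma spin_conn_bmeas k s t :
  bmeas (D : set (borel rV)) (fun x => complex.Re (loc_spin_conn (gamma S) E g k x s t)) /\
  bmeas (D : set (borel rV)) (fun x => complex.Im (loc_spin_conn (gamma S) E g k x s t)).
Proof.
have h4 : (4^-1 : R[i]) = rc 4^-1 by rewrite fmorphV rmorph_nat.
have bW b e : bmeas (D : set (borel rV)) (fun x => loc_conn E g k x b e).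
  apply: (bmeas_smooth cU).
  exact: (smooth_loc_conn oU (@loc_frame_smooth _ _ _ _ S c) (@loc_metric_smooth _ _ _ h c)
    (@loc_frame_orth _ _ _ _ S c)).
pose G b e := (gamma S b *m gamma S e) s t.
have EQ x : loc_spin_conn (gamma S)
  E g k x s t = rc 4^-1 * \sum_b \sum_e rc (loc_conn E g k x b e) * G b e.
  rewrite /loc_spin_conn h4 mxE; congr (_ * _); rewrite summxE; apply: eq_bigr => b _.
  by rewrite summxE; apply: eq_bigr => e _; rewrite mxE.
split.
  apply: (@bmeas_eq _ (borel rV) R (D : set (borel rV)) (fun x =>
    4^-1 * \sum_b \sum_e loc_conn E g k x b e * complex.Re (G b e))).
    move=> x _; rewrite EQ ReZ Re_sum; congr (_ * _); apply: eq_bigr => b _.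
    by rewrite Re_sum; apply: eq_bigr => e _; rewrite ReZ.
  apply: bmeasM; first exact: bmeas_cst.
  by apply: bmeas_sum => b _; apply: bmeas_sum => e _; apply: bmeasM => //; exact: bmeas_cst.
apply: (@bmeas_eq _ (borel rV) R (D : set (borel rV)) (fun x =>
  4^-1 * \sum_b \sum_e loc_conn E g k x b e * complex.Im (G b e))).
  move=> x _; rewrite EQ ImZ Im_sum; congr (_ * _); apply: eq_bigr => b _.
  by rewrite Im_sum; apply: eq_bigr => e _; rewrite ImZ.
apply: bmeasM; first exact: bmeas_cst.
by apply: bmeas_sum => b _; apply: bmeas_sum => e _; apply: bmeasM => //; exact: bmeas_cst.
Qed.

Definition spinor_L4 (psi : chart_index X -> X -> 'cV[R[i]]_N) := forall s,
  Lpow leb D 4 (fun x => complex.Re (psi c (inv x) s 0)) /\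
  Lpow leb D 4 (fun x => complex.Im (psi c (inv x) s 0)).

(** Covariant derivative minus connection term: the ordinary weak partial derivative of the
    components of [psi]. *)
Definition chart_wpd (psi : chart_index X -> X -> 'cV[R[i]]_N)
    (D0 : chart_index X -> X -> 'I_m -> 'cV[R[i]]_N) k x : 'cV[R[i]]_N :=
  D0 c (inv x) k - loc_spin_conn (gamma S) E g k x *m psi c (inv x).

Lemma chart_wpd_Lpow psi D0 k s : sobolev_spinor S leb vol (4 / 3) psi D0 ->
  Lpow leb D (4 / 3) (fun x => complex.Re (chart_wpd psi D0 k x s 0)) /\
  Lpow leb D (4 / 3) (fun x => complex.Im (chart_wpd psi D0 k x s 0)).
Proof.
move=> [Hp Hpm HpL HD HDm HDL Hw].
have q1 : 1 <= 4 / 3 :> R by lra.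
have q0 : 0 <= 4 / 3 :> R by lra.
have [LR LI] := @form_Lpow (4 / 3) D0 k s q1 HD HDm HDL.
have LP t := @spinor_Lpow (4 / 3) psi t q1 Hp Hpm HpL.
split.
  have -> : (fun x => complex.Re (chart_wpd psi D0 k x s 0)) = fun x =>
    complex.Re (D0 c (inv x) k s 0) - \sum_t (complex.Re (loc_spin_conn (gamma S) E g k x s t)
      * complex.Re (psi c (inv x) t 0)
     - complex.Im (loc_spin_conn (gamma S) E g k x s t) * complex.Im (psi c (inv x) t 0)).
    apply/funext => x; rewrite !mxE ReB; congr (_ - _).
    by rewrite Re_sum; apply: eq_bigr => t _; rewrite ReM.
  apply: LpowB => //; apply: Lpow_sum => // t; apply: LpowB => //.
    by apply: LpowM => //; [exact: (LP t).1|exact: (spin_conn_bmeas k s t).1].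
  by apply: LpowM => //; [exact: (LP t).2|exact: (spin_conn_bmeas k s t).2].
have -> : (fun x => complex.Im (chart_wpd psi D0 k x s 0)) = fun x =>
    complex.Im (D0 c (inv x) k s 0) - \sum_t (complex.Re (loc_spin_conn (gamma S) E g k x s t)
      * complex.Im (psi c (inv x) t 0)
     + complex.Im (loc_spin_conn (gamma S) E g k x s t) * complex.Re (psi c (inv x) t 0)).
  apply/funext => x; rewrite !mxE ImB; congr (_ - _).
  by rewrite Im_sum; apply: eq_bigr => t _; rewrite ImM.
apply: LpowB => //; apply: Lpow_sum => // t; apply: LpowD => //.
  by apply: LpowM => //; [exact: (LP t).2|exact: (spin_conn_bmeas k s t).1].
by apply: LpowM => //; [exact: (LP t).1|exact: (spin_conn_bmeas k s t).2].
Qed.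

Lemma chart_wpd_weak psi D0 k s : weak_nabla S leb psi D0 ->
  cube_wpd leb x0 r k (fun x => complex.Re (psi c (inv x) s 0)) (fun x =>
    complex.Re (chart_wpd psi D0 k x s 0)) /\
  cube_wpd leb x0 r k (fun x => complex.Im (psi c (inv x) s 0)) (fun x =>
    complex.Im (chart_wpd psi D0 k x s 0)).
Proof.
move=> /(_ c k s)[/(weak_pd_cube cU) wR /(weak_pd_cube cU) wI].
by split; [apply: (cube_wpd_eq _ wR)|apply: (cube_wpd_eq _ wI)] => x Dx /=;
  rewrite (spin_conn_loc S k (DU Dx)).
Qed.

Lemma chart_weak_spinor psi D0 : sobolev_spinor S leb vol (4 / 3) psi D0 -> spinor_L4 psi ->
  weak_spinor leb x0 r (fun x => psi c (inv x)) (chart_wpd psi D0).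
Proof.
move=> HS H4 s; have [L4R L4I] := H4 s.
split; split=> // k; [exact: (chart_wpd_Lpow k s HS).1| |exact: (chart_wpd_Lpow k s HS).2|];
  by have [] := chart_wpd_weak k s (sobolev_spinor_weak HS).
Qed.

End ChartBounds.

(** * Bump functions and the L^4 bound in low dimension *)

Section Bumps.
Context {R : realType} {m : nat}.
Local Notation rV := 'rV[R]_m.
Implicit Types (x : rV) (s r : R).

Definition bump x0 s x : R := \prod_k flat 0 (s ^+ 2 - (x 0 k - x0 0 k) ^+ 2).

Lemma bump_gt0 x0 s x : cube x0 s x -> 0 < bump x0 s x.
Proof.
move=> Dx; apply: prodr_gt0 => k _; apply: flat_gt0; rewrite subr_gt0.
have s0 : 0 <= s by exact: le_trans (ltW (Dx k)).
by rewrite -[ltLHS]real_normK ?num_real// ltr_sqr ?nnegrE//; exact: Dx.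
Qed.

Lemma bump_out x0 s x : 0 <= s -> ~ ccube x0 s x -> bump x0 s x = 0.
Proof.
move=> s0 /existsNP[k /negP]; rewrite -ltNge => sk.
rewrite /bump (bigD1 k)//= flat_le0 ?mul0r// subr_le0.
by rewrite -[leRHS]real_normK ?num_real// ler_sqr ?nnegrE// ltW.
Qed.

Lemma smooth_bump x0 s : smooth setT (bump x0 s).
Proof.
move=> q; apply: Ck_prod => [|k _]; first exact: openT.
apply: Ck_flat; first exact: openT.
apply: CkB; [exact: openT|exact: Ck_cst|].
by apply: Ck_exp; [exact: openT|apply: CkB; [exact: openT|exact: Ck_coord|exact: Ck_cst]].
Qed.

Lemma cube_test_bump x0 s r : 0 <= s -> s < r -> cube_test x0 r (bump x0 s).
Proof.
by move=> s0 sr; split; [exact: smooth_bump|exists s => // x; exact: bump_out].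
Qed.

Lemma sobolev_cube_low (leb : {measure set (borel rV) -> \bar R}) x0 r :
  (0 < m <= 2)%N -> is_lebesgue leb -> sobolev_cube leb x0 r.
Proof.
move: leb x0; case: m => [|[|[|q]]]// leb x0 _ Hleb; [exact: sobolev_cube1|exact: sobolev_cube2].
Qed.

(** The bump of radius 3r/4 serves as both cutoffs: it is supported inside the cube of radius [r],
    and on the closed cube of radius r/2 it is positive, so that its powers can be divided out. *)
Lemma sobolev_L4_half (leb : {measure set (borel rV) -> \bar R}) x0 r (v : rV -> R) (v' : 'I_m ->
  rV -> R) :
  is_lebesgue leb -> (0 < m <= 2)%N -> 0 < r ->
  Lpow leb (cube x0 r : set (borel rV)) (4 / 3) v ->
  (forall k, Lpow leb (cube x0 r : set (borel rV)) (4 / 3) (v' k)) ->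
  (forall k, cube_wpd leb x0 r k v (v' k)) ->
  Lpow leb (cube x0 (r / 2) : set (borel rV)) 4 v.
Proof.
move=> Hleb hm r0 Lv Lv' wv; set s := 3 / 4 * r.
have s0 : 0 <= s by rewrite /s; lra.
have sr : s < r by rewrite /s; lra.
have tb := cube_test_bump x0 s0 sr.
have L := sobolev_L4 Hleb r0 (@sobolev_cube_low leb x0 r hm Hleb) Lv Lv' wv tb tb.
have mD := measurable_cube x0 r; have mD2 := measurable_cube x0 (r / 2).
have DD : cube x0 (r / 2) `<=` cube x0 r by apply: le_cube; lra.
have L2 := L1_sub mD2 mD DD L.
pose b x := bump x0 s x.
have bi : bmeas (cube x0 (r / 2) : set (borel rV)) (fun x => ((b x * b x) ^+ 4)^-1).
  apply: bmeas_ccube => y cy.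
  have b0 : 0 < b y.
    by apply: bump_gt0 => k; apply: le_lt_trans (cy k) _; rewrite /s; lra.
  have oV := @open_cube R m x0 s.
  apply: (@Ck_cont _ _ 0 (cube x0 s) (fun x => ((b x * b x) ^+ 4)^-1)); last first.
    by move=> k; apply: le_lt_trans (cy k) _; rewrite /s; lra.
  apply: CkV => // [x Dx|]; first by rewrite expf_neq0// mulf_neq0// gt_eqF// bump_gt0.
  have sb : Ck 0 (cube x0 s) b by exact: (Ck_sub (W := cube x0 s) (V := setT)
    _ (smooth_bump x0 s 0)).
  by apply: Ck_exp => //; exact: CkM.
have [mv _] := Lv; split; first exact: measurable_funS mv.
apply: (L1_eq mD2 _ (bmeasM_L1 mD2 bi L2)) => x Dx /=.
have b0 : 0 < b x by apply: bump_gt0 => k; apply: lt_trans (Dx k) _; rewrite /s; lra.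
rewrite (powR_mulrn 4 (normr_ge0 _)) -expr4_norm -/(b x) mulrA exprMn mulrAC mulfV ?mul1r//.
by rewrite expf_neq0// mulf_neq0// gt_eqF.
Qed.

End Bumps.

Section ChartTest.
Context {R : realType} {m : nat} {X : closed_manifold R m} {h : riemannian_metric X}.
Variable S : spin_structure h.
Local Notation rV := 'rV[R]_m.
Local Notation N := (spin_dim m).
Variable leb : {measure set (borel rV) -> \bar R}.
Hypothesis Hleb : is_lebesgue leb.
Variable vol : {measure set (borel X) -> \bar R}.
Hypothesis Hvol : is_volume h leb vol.
Variable c : chart_index X.
Variables (x0 : rV) (r : R).
Hypothesis r0 : 0 < r.
Hypothesis cU : ccube x0 r `<=` img c.
Local Notation D := (cube x0 r).
Local Notation inv := (chart_inv c).
Local Notation E := (loc_frame S c).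
Local Notation g := (@loc_metric _ _ _ h c).
Local Notation rho := (vol_density g).
Local Notation P := (patch c x0 r).

Let mD := measurable_cube x0 r.
Let fD := leb_cube_lty Hleb x0 r.
Let DU : D `<=` img c.
Proof. by move=> x Dx; apply: cU => k; exact/ltW. Qed.
Let dU x : D x -> dom c (inv x).
Proof. by move=> /DU /img_inv[]. Qed.
Let mP := patch_measurable c x0 r.

Lemma vol_local (F : X -> R) : (forall p, ~ P p -> F p = 0) ->
  measurable_fun (D : set (borel rV)) (F \o inv : borel rV -> R) ->
  (\int[vol]_p (F p)%:E = \int[leb]_(x in D) (F (inv x) * rho x)%:E)%E.
Proof.
move=> F0 mF; rewrite -(chart_integral S Hvol cU mF) [RHS]integral_mkcond.
apply: eq_integral => p _; rewrite patchE; case: ifPn => //.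
by rewrite notin_setE => /F0 ->.
Qed.

Lemma vol_local_L1 (F : X -> R) : (forall p, ~ P p -> F p = 0) ->
  L1 leb (D : set (borel rV)) (fun x => F (inv x) * rho x) ->
  measurable_fun (D : set (borel rV)) (F \o inv : borel rV -> R) ->
  L1 vol setT F.
Proof.
move=> F0 LF mF; have /(chart_L1 S Hvol cU mF).2 LP := LF.
have := (@integrable_mkcond _ (borel X) R vol _ (fun p => (F p)%:E) mP).1 LP.
apply: eq_integrable => // p _; rewrite patchE; case: ifPn => //.
by rewrite notin_setE => /F0 /= ->.
Qed.

Variable z : rV -> R.
Hypothesis tz : cube_test x0 r z.
Local Notation eta := (chart_extend c z).

Lemma extend_smooth : smooth_fun eta.
Proof.
have [sz [e er z0]] := tz; apply: (smooth_chart_extend (@ccube_compact R m x0 e)) => //.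
by move=> x cx; apply: cU => k; apply: le_trans (cx k) (ltW er).
Qed.

Lemma not_patch p : ~ P p -> forall e, e < r -> ~ (chart_inv c @` ccube x0 e) p.
Proof.
move=> nP e er [x cx xp]; apply: nP; rewrite -xp; apply: patch_inv => //.
exact: ccube_sub_cube cx.
Qed.

Lemma extend_out p : ~ P p -> eta p = 0.
Proof.
move=> nP; have [sz [e er z0]] := tz.
exact: (chart_extend0 z0 (not_patch nP er)).
Qed.

Lemma deriv_extend_out p a : ~ P p -> deriv_frame S eta p a = 0.
Proof.
move=> nP; have [sz [e er z0]] := tz.
have eU : ccube x0 e `<=` img c by move=> x cx; apply: cU => k; apply: le_trans (cx k) (ltW er).
rewrite /deriv_frame /covector_frame mxE big1// => k _; rewrite mxE.
rewrite (dchart_extend_out (@ccube_compact R m x0 e) eU z0) ?mulr0//; first exact: dom_chart_at.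
exact: not_patch.
Qed.

Lemma chart_covector_extend x a : D x ->
  chart_covector S (inv x) c (fun i q => \col_k dchart i k eta q) a = \sum_l E x a l * pd l z x.
Proof.
move=> Dx; rewrite /chart_covector mxE; apply: eq_bigr => l _; rewrite mxE.
by rewrite (dchart_extend z l (dU Dx)) (chart_invK cU Dx).
Qed.

Lemma covector_extend w x : is_covector_field w -> D x ->
  \sum_a covector_frame S w (inv x) a * deriv_frame S eta (inv x) a =
  \sum_a chart_covector S (inv x) c w a * \sum_l E x a l * pd l z x.
Proof.
move=> Hw Dx; rewrite /deriv_frame (covector_dot S (dU Dx) Hw (dchart_covector extend_smooth)).
by apply: eq_bigr => a _; rewrite chart_covector_extend.
Qed.

Lemma current_extend psi xi x : is_spinor_field S psi -> is_spinor_field S xi -> D x ->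
  \sum_a rprod (gamma S a *m psi (chart_at (inv x)) (inv x)) (xi (chart_at (inv x)) (inv x)) *
    deriv_frame S eta (inv x) a =
  \sum_a rprod (gamma S a *m psi c (inv x)) (xi c (inv x)) * \sum_l E x a l * pd l z x.
Proof.
move=> Hp Hx Dx; rewrite /deriv_frame (current_dot (dU Dx) Hp Hx (dchart_covector extend_smooth)).
by apply: eq_bigr => a _; rewrite chart_covector_extend.
Qed.

End ChartTest.

(** * The current of the map *)

Section MapPart.
Context {R : realType} {m : nat} {X : closed_manifold R m} {h : riemannian_metric X}.
Variable S : spin_structure h.
Local Notation rV := 'rV[R]_m.
Variable leb : {measure set (borel rV) -> \bar R}.
Hypothesis Hleb : is_lebesgue leb.
Variable vol : {measure set (borel X) -> \bar R}.
Hypothesis Hvol : is_volume h leb vol.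
Variable c : chart_index X.
Variables (x0 : rV) (r : R).
Hypothesis r0 : 0 < r.
Hypothesis cU : ccube x0 r `<=` img c.
Local Notation D := (cube x0 r).
Local Notation inv := (chart_inv c).
Local Notation E := (loc_frame S c).
Local Notation g := (@loc_metric _ _ _ h c).
Local Notation rho := (vol_density g).
Local Notation P := (patch c x0 r).
Local Notation LD1 := (L1 leb (D : set (borel rV))).
Local Notation ID := (Int leb (D : set (borel rV))).
Local Notation Lp2 := (Lpow leb (D : set (borel rV)) 2).

Let mD := measurable_cube x0 r.
Let fD := leb_cube_lty Hleb x0 r.
Let DU : D `<=` img c.
Proof. by move=> x Dx; apply: cU => k; exact/ltW. Qed.

Let p2 : 1 <= 2 :> R. Proof. by lra. Qed.
Let p20 : 0 <= 2 :> R. Proof. by []. Qed.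

Lemma bmeas_Lpow p (f : rV -> R) : 0 <= p -> bmeas (D : set (borel rV)) f ->
  Lpow leb (D : set (borel rV)) p f.
Proof.
move=> pp bf; split; first exact: bf.1.
by apply: (bmeas_L1 mD fD); exact: bmeas_pow.
Qed.

Lemma Lpow_mulr p (f w : rV -> R) : 0 <= p -> Lpow leb (D : set (borel rV)) p f ->
  bmeas (D : set (borel rV)) w -> Lpow leb (D : set (borel rV)) p (fun x => f x * w x).
Proof.
move=> pp Lf bw; have := LpowM mD pp Lf bw.
by congr (Lpow _ _ _); apply/funext => x; rewrite mulrC.
Qed.

Lemma dual_pair_2 (f w : rV -> R) : Lp2 f -> Lp2 w -> dual_pair leb (D : set (borel rV)) f w.
Proof.
move=> Lf Lw; apply: (dual_pair_pow mD (p := 2) (q := 2)) => //.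
- by field.
- exact: (Lpow_L1 mD fD p2).
- exact: (Lpow_L1 mD fD p2).
- exact: Lf.2.
- exact: Lw.2.
Qed.

Let bE a l : bmeas (D : set (borel rV)) (fun x => E x a l).
Proof. by apply: (bmeas_smooth cU); exact: loc_frame_smooth. Qed.

Let brho : bmeas (D : set (borel rV)) rho.
Proof. by apply: (bmeas_smooth cU); exact: (vol_smooth S). Qed.

(** The vector field dual to [w], in coordinates and multiplied by the volume density, so that its
    coordinate divergence is [rho] times the Riemannian one. *)
Definition flux (w : chart_index X -> X -> 'cV[R]_m) l x : R :=
  rho x * \sum_a chart_covector S (inv x) c w a * E x a l.

Lemma flux_dot (w1 w2 : chart_index X -> X -> 'cV[R]_m) x : \sum_l flux w1 l x * w2 c (inv x) l 0 =
  rho x * \sum_a chart_covector S (inv x) c w1 a * chart_covector S (inv x) c w2 a.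
Proof.
rewrite /flux; under eq_bigr => l _ do rewrite -mulrA mulr_suml.
rewrite -mulr_sumr exchange_big; congr (_ * _); apply: eq_bigr => a _ /=.
under eq_bigr => l _ do rewrite -mulrA.
by rewrite -mulr_sumr; congr (_ * _); rewrite /chart_covector mxE.
Qed.

Lemma flux_test w (z : rV -> R) x : \sum_l flux w l x * pd l z x =
  (\sum_a chart_covector S (inv x) c w a * \sum_l E x a l * pd l z x) * rho x.
Proof.
rewrite /flux mulrC; under eq_bigr => l _ do rewrite -mulrA mulr_suml.
rewrite -mulr_sumr exchange_big; congr (_ * _); apply: eq_bigr => a _ /=.
by under eq_bigr => l _ do rewrite -mulrA; rewrite -mulr_sumr.
Qed.

Section Weak.
Variables (w : chart_index X -> X -> 'cV[R]_m).
Hypotheses (Hw : is_covector_field w) (Hm : measurable_covector w)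
  (HL : Lp vol 2 (covector_norm S w)).

Lemma component_Lp2 k : Lp2 (fun x => w c (inv x) k 0).
Proof. exact: (covector_Lpow Hvol cU k p2 Hw Hm HL). Qed.

Lemma frame_component_Lp2 a : Lp2 (fun x => chart_covector S (inv x) c w a).
Proof.
have -> : (fun x => chart_covector S (inv x) c w a) = fun x => \sum_k E x a k * w c (inv x) k 0.
  by apply/funext => x; rewrite /chart_covector mxE.
by apply: (Lpow_sum mD p2) => k; apply: LpowM => //; exact: component_Lp2.
Qed.

Lemma flux_Lp2 l : Lp2 (flux w l).
Proof.
apply: LpowM => //; apply: (Lpow_sum mD p2) => a.
by apply: Lpow_mulr => //; exact: frame_component_Lp2.
Qed.

(** A test function of the cube extends by zero to a smooth function on the manifold, at which the
    global equation is evaluated. *)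
Lemma weak_div_flux (F : X -> R) : L1 vol setT F ->
  (forall eta, smooth_fun eta ->
    (\int[vol]_p (\sum_a covector_frame S w p a * deriv_frame S eta p a)%:E =
     \int[vol]_p (F p * eta p)%:E)%E) ->
  weak_div leb x0 r (flux w) (fun x => rho x * F (inv x)).
Proof.
move=> LF HF z tz; have [bz bpz] := cube_testP tz.
have mF := chart_inv_measT cU (L1_meas LF).
have LFr : LD1 (fun x => F (inv x) * rho x).
  by apply/(chart_L1 S Hvol cU mF); exact: (L1_sub (patch_measurable c x0 r) measurableT).
have L1f l : LD1 (flux w l) by exact: (Lpow_L1 mD fD p2 (flux_Lp2 l)).
have L1fz l : LD1 (fun x => flux w l x * pd l z x) by exact: bmeasM_L1.
have L1s : LD1 (fun x => \sum_l flux w l x * pd l z x) by exact: L1_sum.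
have := HF _ (extend_smooth cU tz).
have cE x : D x -> chart_extend c z (inv x) = z x.
  by move=> Dx; have [h1 h2] := img_inv (DU Dx); rewrite chart_extendE// h2.
have birho : bmeas (D : set (borel rV)) (fun x => (rho x)^-1).
  apply: (bmeas_smooth cU) => k; apply: CkV; [exact: img_open| |exact: (vol_smooth S)].
  by move=> x xc; rewrite gt_eqF// (vol_density_gt0 (@loc_frame_orth _ _ _ _ S c)).
have rn0 x : D x -> rho x != 0.
  by move=> Dx; rewrite gt_eqF// (vol_density_gt0 (@loc_frame_orth _ _ _ _ S c))//; exact: DU.
have LA x : D x -> (\sum_a covector_frame S w (inv x) a * deriv_frame S (chart_extend c z)
  (inv x) a) * rho x =
    \sum_l flux w l x * pd l z x.
  by move=> Dx; rewrite (covector_extend S cU tz Hw Dx) flux_test.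
rewrite (vol_local S Hvol cU (F := fun p =>
  \sum_a covector_frame S w p a * deriv_frame S (chart_extend c z) p a)); first last.
- apply: (@eq_measurable_fun _ _ (borel rV) R _ (fun x => (\sum_l flux w l x * pd l z x)
  * (rho x)^-1)).
    by move=> x; rewrite inE => Dx /=; rewrite -LA// mulfK// rn0.
  by apply: measurable_funM; [exact: L1_meas L1s|exact: birho.1].
- move=> p nP; apply: big1 => a _.
  by rewrite (deriv_extend_out S cU tz a nP) mulr0.
rewrite (vol_local S Hvol cU (F := fun p => F p * chart_extend c z p)); first last.
- apply: (@eq_measurable_fun _ _ (borel rV) R _ (fun x => F (inv x) * z x)).
    by move=> x; rewrite inE => Dx /=; rewrite cE.
  by apply: measurable_funM; [exact: mF|exact: bz.1].
- by move=> p nP; rewrite (extend_out cU tz nP) mulr0.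
move=> H; rewrite -(Int_sum mD)//.
rewrite /Int /Rintegral; congr fine.
transitivity (\int[leb]_(x in D) ((\sum_a covector_frame S w (inv x)
  a * deriv_frame S (chart_extend c z) (inv x) a) * rho x)%:E)%E.
  by apply: eq_integral => x; rewrite inE => Dx; rewrite LA.
rewrite H; apply: eq_integral => x; rewrite inE => Dx; rewrite cE//.
by congr EFin; ring.
Qed.

End Weak.

(** The bound of the map components by 1 holds almost everywhere, while [dual_pair_bdd] asks for a
    bound at every point; clamping picks a representative that has it. *)
Definition clamp (t : R) : R := Num.max (-1) (Num.min t 1).

Lemma clamp_id t : `|t| <= 1 -> clamp t = t.
Proof.
rewrite ler_norml => /andP[h1 h2]; rewrite /clamp (min_idPl h2).
by apply/max_idPr.
Qed.

Lemma clamp_bound t : `|clamp t| <= 1.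
Proof.
rewrite ler_norml /clamp le_max lexx /= ge_max ge_min lexx orbT andbT.
by lra.
Qed.

Section HalfLaw.
Variables (w1 w2 : chart_index X -> X -> 'cV[R]_m) (F : X -> R) (u2 : X -> R).
Hypotheses (H1 : is_covector_field w1) (M1 : measurable_covector w1)
  (L21 : Lp vol 2 (covector_norm S w1)).
Hypothesis LF : L1 vol setT F.
Hypothesis HF : forall eta, smooth_fun eta ->
    (\int[vol]_p (\sum_a covector_frame S w1 p a * deriv_frame S eta p a)%:E =
     \int[vol]_p (F p * eta p)%:E)%E.
Hypothesis S2 : sobolev_function S leb vol 2 u2 w2.
Hypothesis u21 : {ae vol, forall p : borel X, `|u2 p| <= 1}.
Variables cc z : rV -> R.
Hypotheses (tc : cube_test x0 r cc) (tz : cube_test x0 r z).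
Local Notation zeta := (fun x => cc x * z x).

(** The equation with flux [w1] is tested with [u2 * zeta]. The derivative of [u2] meets the flux by
    duality in L^2; the right-hand side, merely integrable, meets the bounded function [u2]
    itself. *)
Lemma half_law :
  [/\ LD1 (fun x => \sum_k flux w1 k x * u2 (inv x) * pd k zeta x),
      LD1 (fun x => (\sum_k flux w1 k x * w2 c (inv x) k 0) * zeta x),
      LD1 (fun x => rho x * F (inv x) * u2 (inv x) * zeta x) &
      ID (fun x => \sum_k flux w1 k x * u2 (inv x) * pd k zeta x) +
      ID (fun x => (\sum_k flux w1 k x * w2 c (inv x) k 0) * zeta x) =
      ID (fun x => rho x * F (inv x) * u2 (inv x) * zeta x)].
Proof.
have [HL2 H2 M2 L22 W2] := S2.
have [bz bpz] := cube_testP tz; have [bc bpc] := cube_testP tc.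
have [bcz bpcz] := cube_testP (cube_testMM tc tz).
have mu2 : measurable_fun (D : set (borel rV)) (fun x => u2 (inv x)).
  by apply: (chart_inv_measT cU); move: HL2; rewrite /Lp inE => /andP[/[!inE]].
pose v x := clamp (u2 (inv x)).
have mv : measurable_fun (D : set (borel rV)) v.
  by apply: measurable_maxr => //; exact: measurable_minr.
have bv : bmeas (D : set (borel rV)) v by split=> //; exists 1 => x _; exact: clamp_bound.
have ae2 : {ae leb, forall x : borel rV, D x -> u2 (inv x) = v x}.
  have := chart_ae S Hvol cU u21; apply: filterS => x Hx Dx; rewrite /v clamp_id//; exact: Hx.
have Lf k : Lp2 (flux w1 k) by exact: flux_Lp2.
have Lw k : Lp2 (fun x => w2 c (inv x) k 0) by exact: component_Lp2.
have L1f k := Lpow_L1 mD fD p2 (Lf k); have L1w k := Lpow_L1 mD fD p2 (Lw k).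
have mF := chart_inv_measT cU (L1_meas LF).
have LFr : LD1 (fun x => F (inv x) * rho x).
  by apply/(chart_L1 S Hvol cU mF); exact: (L1_sub (patch_measurable c x0 r) measurableT).
have LFr' : LD1 (fun x => rho x * F (inv x)).
  by apply: (L1_eq mD _ LFr) => x _; rewrite mulrC.
have L1v : LD1 v by exact: bmeas_L1.
have wv k : cube_wpd leb x0 r k v (fun x => w2 c (inv x) k 0).
  move=> y ty; rewrite -(weak_pd_cube cU (W2 c k) ty).
  have [by_ bpy] := cube_testP ty.
  apply: (Int_ae mD).
  - by apply: measurable_funM => //; exact: (bpy k).1.
  - by apply: measurable_funM => //; exact: (bpy k).1.
  - by apply: filterS ae2 => x Hx Dx /=; rewrite -Hx.
have bcv : bmeas (D : set (borel rV)) (fun x => cc x * v x) by exact: bmeasM.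
have dp1 k : dual_pair leb (D : set (borel rV)) (fun x => cc x * v x) (fun x =>
  flux w1 k x * pd k z x).
  apply: (dual_pair_bdd mD bcv.1 bcv.2); first exact: bmeas_L1.
  exact: bmeasM_L1.
have dp2 k : dual_pair leb (D : set (borel rV)) (fun x => cc x * w2 c (inv x)
  k 0 + v x * pd k cc x) (fun x => flux w1 k x * z x).
  apply: dual_pair_2; last exact: Lpow_mulr.
  apply: LpowD => //; first exact: LpowM.
  by apply: bmeas_Lpow => //; exact: bmeasM.
have dp3 : dual_pair leb (D : set (borel rV)) (fun x => cc x * v x) (fun x => rho x * F (inv x)
  * z x).
  apply: (dual_pair_bdd mD bcv.1 bcv.2); first exact: bmeas_L1.
  exact: bmeasM_L1.
have PR := product_rule Hleb r0 L1f LFr' L1v L1w (weak_div_flux H1 M1 L21 LF HF)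
  wv tc tz dp1 dp2 dp3.
have Lfw k : LD1 (fun x => flux w1 k x * w2 c (inv x) k 0).
  exact: dual_pair_L1 (dual_pair_2 (Lw k) (Lf k)).
have LB : LD1 (fun x => (\sum_k flux w1 k x * w2 c (inv x) k 0) * zeta x).
  by apply: bmeasM_L1 => //; exact: L1_sum.
have LAv k : LD1 (fun x => flux w1 k x * v x * pd k zeta x).
  by apply: bmeasM_L1 => //; exact: bmeasM_L1.
have LAv' : LD1 (fun x => \sum_k flux w1 k x * v x * pd k zeta x) by exact: L1_sum.
have LCv : LD1 (fun x => rho x * F (inv x) * v x * zeta x).
  by apply: bmeasM_L1 => //; exact: bmeasM_L1.
have mA : measurable_fun (D : set (borel rV)) (fun x => \sum_k flux w1 k x * u2 (inv x)
  * pd k zeta x).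
  apply: measurable_sum => k; apply: measurable_funM; last exact: (bpcz k).1.
  by apply: measurable_funM => //; exact: L1_meas (L1f k).
have mC : measurable_fun (D : set (borel rV)) (fun x => rho x * F (inv x) * u2 (inv x) * zeta x).
  apply: measurable_funM; last exact: bcz.1.
  by apply: measurable_funM => //; exact: L1_meas LFr'.
have aeA : {ae leb, forall x : borel rV, D x -> \sum_k flux w1 k x * v x * pd k zeta x =
    \sum_k flux w1 k x * u2 (inv x) * pd k zeta x}.
  by apply: filterS ae2 => x Hx Dx; rewrite Hx.
have aeC : {ae leb, forall x : borel rV, D x -> rho x * F (inv x) * v x * zeta x =
    rho x * F (inv x) * u2 (inv x) * zeta x}.
  by apply: filterS ae2 => x Hx Dx; rewrite Hx.
have LA := L1_ae mD mA aeA LAv'; have LC := L1_ae mD mC aeC LCv.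
split=> //.
rewrite -(Int_ae mD (L1_meas LAv') mA aeA) -(Int_ae mD (L1_meas LCv) mC aeC) -PR.
rewrite -(IntD mD LAv' LB).
rewrite -(Int_sum mD) => [|k _]; last first.
  have LL := L1D mD (bmeasM_L1 mD bcz (Lfw k)) (LAv k).
  by apply: (L1_eq mD _ LL) => x _; ring.
apply: Int_eq => x _; rewrite mulr_suml -big_split; apply: eq_bigr => k _ /=.
by ring.
Qed.

End HalfLaw.

Section MapLaw.
Variables (w1 w2 : chart_index X -> X -> 'cV[R]_m) (F1 F2 u1 u2 : X -> R).
Hypotheses (S1 : sobolev_function S leb vol 2 u1 w1) (S2 : sobolev_function S leb vol 2 u2 w2).
Hypotheses (LF1 : L1 vol setT F1) (LF2 : L1 vol setT F2).
Hypothesis HF1 : forall eta, smooth_fun eta ->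
    (\int[vol]_p (\sum_a covector_frame S w1 p a * deriv_frame S eta p a)%:E =
     \int[vol]_p (F1 p * eta p)%:E)%E.
Hypothesis HF2 : forall eta, smooth_fun eta ->
    (\int[vol]_p (\sum_a covector_frame S w2 p a * deriv_frame S eta p a)%:E =
     \int[vol]_p (F2 p * eta p)%:E)%E.
Hypothesis u11 : {ae vol, forall p : borel X, `|u1 p| <= 1}.
Hypothesis u21 : {ae vol, forall p : borel X, `|u2 p| <= 1}.
Variables cc z : rV -> R.
Hypotheses (tc : cube_test x0 r cc) (tz : cube_test x0 r z).
Local Notation zeta := (fun x => cc x * z x).

(** The half laws in the two orders are subtracted; the pairing of [w1] with [w2] is symmetric by
    [flux_dot] and cancels. *)
Lemma map_law :
  [/\ LD1 (fun x => \sum_k (flux w1 k x * u2 (inv x) - flux w2 k x * u1 (inv x)) * pd k zeta x),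
      LD1 (fun x => rho x * (F1 (inv x) * u2 (inv x) - F2 (inv x) * u1 (inv x)) * zeta x) &
      ID (fun x => \sum_k (flux w1 k x * u2 (inv x) - flux w2 k x * u1 (inv x)) * pd k zeta x) =
      ID (fun x => rho x * (F1 (inv x) * u2 (inv x) - F2 (inv x) * u1 (inv x)) * zeta x)].
Proof.
have [_ C1 M1 L21 _] := S1; have [_ C2 M2 L22 _] := S2.
have [A1 B1 D1 I1] := half_law C1 M1 L21 LF1 HF1 S2 u21 tc tz.
have [A2 B2 D2 I2] := half_law C2 M2 L22 LF2 HF2 S1 u11 tc tz.
have EB : ID (fun x => (\sum_k flux w1 k x * w2 c (inv x) k 0) * zeta x) =
    ID (fun x => (\sum_k flux w2 k x * w1 c (inv x) k 0) * zeta x).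
  apply: Int_eq => x _; rewrite !flux_dot; congr (_ * _ * _).
  by apply: eq_bigr => a _; rewrite mulrC.
have EA x : \sum_k (flux w1 k x * u2 (inv x) - flux w2 k x * u1 (inv x)) * pd k zeta x =
    \sum_k flux w1 k x * u2 (inv x) * pd k zeta x - \sum_k flux w2 k x * u1 (inv x) * pd k zeta x.
  by rewrite -sumrB; apply: eq_bigr => k _; rewrite mulrBl.
have EC x : rho x * (F1 (inv x) * u2 (inv x) - F2 (inv x) * u1 (inv x)) * zeta x =
    rho x * F1 (inv x) * u2 (inv x) * zeta x - rho x * F2 (inv x) * u1 (inv x) * zeta x by ring.
split.
- by apply: (L1_eq mD _ (L1B mD A1 A2)) => x _; rewrite EA.
- by apply: (L1_eq mD _ (L1B mD D1 D2)) => x _; rewrite EC.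
rewrite (Int_eq leb (fun x _ => EA x)) (Int_eq leb (fun x _ => EC x)) (IntB mD A1 A2)
  (IntB mD D1 D2).
move: I1 I2; rewrite EB; move: (Int _ _ _) (Int _ _ _) (Int _ _ _) (Int _ _ _) (Int _ _ _) =>
  a b e f k; lra.
Qed.

End MapLaw.
End MapPart.

(** * The law for test functions supported in one chart *)

Section LocalLaw.
Context {R : realType} {m : nat} {X : closed_manifold R m} {h : riemannian_metric X}.
Variable S : spin_structure h.
Local Notation rV := 'rV[R]_m.
Local Notation rc := (real_complex R).
Variable leb : {measure set (borel rV) -> \bar R}.
Hypothesis Hleb : is_lebesgue leb.
Variable vol : {measure set (borel X) -> \bar R}.
Hypothesis Hvol : is_volume h leb vol.
Variables (n : nat) (kappa : R).
Variables (phi : 'I_n.+1 -> X -> R) (dphi : 'I_n.+1 -> chart_index X -> X -> 'cV[R]_m).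
Variable psi : 'I_n.+1 -> chart_index X -> X -> 'cV[R[i]]_(spin_dim m).
Variable Dpsi : 'I_n.+1 -> chart_index X -> X -> 'I_m -> 'cV[R[i]]_(spin_dim m).
Hypothesis Hweak : weak_dirac_harmonic S leb vol kappa phi dphi psi Dpsi.
Variables i k : 'I_n.+1.

Definition current_density (eta : X -> R) (p : X) : R :=
  \sum_a (complex.Re (hprod (gamma S a *m spinor_at psi i p) (spinor_at psi k p))
          + (dphi_frame S dphi i p a * phi k p - phi i p * dphi_frame S dphi k p a))
        * deriv_frame S eta p a.

Lemma sphere_bound j : {ae vol, forall p : borel X, `|phi j p| <= 1}.
Proof.
have := wdh_sphere Hweak; apply: filterS => p Hp.
rewrite -sqrtr1 -Hp; apply: normr_le_sqrt.
by rewrite (bigD1 j)//= lerDl sumr_ge0// => l _; exact: sqr_ge0.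
Qed.

Variable c : chart_index X.
Variables (x0 : rV) (r : R).
Hypothesis r0 : 0 < r.
Hypothesis cU : ccube x0 r `<=` img c.
Local Notation D := (cube x0 r).
Local Notation inv := (chart_inv c).
Local Notation E := (loc_frame S c).
Local Notation g := (@loc_metric _ _ _ h c).
Local Notation rho := (vol_density g).

Let mD := measurable_cube x0 r.
Let fD := leb_cube_lty Hleb x0 r.
Let DU : D `<=` img c.
Proof. by move=> x Dx; apply: cU => l; exact/ltW. Qed.
Let dU x : D x -> dom c (inv x).
Proof. by move=> /DU /img_inv[]. Qed.

Hypothesis L4 : forall j, spinor_L4 leb c x0 r (psi j).
Variables cc z : rV -> R.
Hypotheses (tc : cube_test x0 r cc) (tz : cube_test x0 r z).
Local Notation zeta := (fun x => cc x * z x).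
Local Notation eta := (chart_extend c zeta).

Let tzeta := cube_testMM tc tz.

Lemma current_density_out p : ~ patch c x0 r p -> current_density eta p = 0.
Proof.
move=> nP; apply: big1 => a _.
by rewrite (deriv_extend_out S cU tzeta a nP) mulr0.
Qed.

(** Sums over the orthonormal frame do not depend on the chart, so they are computed in [c], where
    [rho] turns them into coordinate fluxes. *)
Lemma current_density_chart x : D x -> current_density eta (inv x) * rho x =
  \sum_l (\sum_a rho x * E x a l * rprod (gamma S a *m psi i c (inv x)) (psi k c (inv x)))
    * pd l zeta x +
  \sum_l (flux S c (dphi i) l x * phi k (inv x) - flux S c (dphi k) l x * phi i (inv x))
    * pd l zeta x.
Proof.
move=> Dx.
have [_ Hi _ _ _] := wdh_phi Hweak i; have [_ Hk _ _ _] := wdh_phi Hweak k.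
have Pi := sobolev_spinor_field (wdh_psi Hweak i); have Pk :=
  sobolev_spinor_field (wdh_psi Hweak k).
have CE := current_extend cU tzeta Pi Pk Dx.
have CI := covector_extend S cU tzeta Hi Dx; have CK := covector_extend S cU tzeta Hk Dx.
have -> : current_density eta (inv x) =
   \sum_a rprod (gamma S a *m psi i (chart_at (inv x)) (inv x)) (psi k (chart_at (inv x))
     (inv x)) * deriv_frame S eta (inv x) a
   + (phi k (inv x) * \sum_a covector_frame S (dphi i) (inv x) a * deriv_frame S eta (inv x) a
   - phi i (inv x) * \sum_a covector_frame S (dphi k) (inv x) a * deriv_frame S eta (inv x) a).
  rewrite !mulr_sumr -sumrB -big_split; apply: eq_bigr => a _ /=.
  rewrite /rprod /spinor_at /dphi_frame mulrDl mulrBl; congr (_ + (_ - _)).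
    by rewrite mulrAC mulrC.
  by rewrite mulrA.
rewrite CE CI CK.
have -> : \sum_l (flux S c (dphi i) l x * phi k (inv x) - flux S c (dphi k) l x * phi i (inv x))
  * pd l zeta x =
   phi k (inv x) * \sum_l flux S c (dphi i) l x * pd l zeta x - phi i (inv x)
     * \sum_l flux S c (dphi k) l x * pd l zeta x.
  rewrite !mulr_sumr -sumrB; apply: eq_bigr => l _.
  by move: (flux S c (dphi i) l x) (flux S c (dphi k) l x) (phi k _) (phi i _) (pd l _ x) =>
    t1 t2 t3 t4 t5; ring.
rewrite !flux_test mulrDl mulrBl -!mulrA; congr (_ + _).
rewrite mulr_suml; under [RHS]eq_bigr => l _ do rewrite mulr_suml.
rewrite exchange_big; apply: eq_bigr => a _ /=.
rewrite -mulrA mulr_suml mulr_sumr; apply: eq_bigr => l _.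
by move: (rprod _ _) (E x a l) (rho x) (pd l _ x) => t1 t2 t3 t4; ring.
Qed.

(** [rprod_dirac] replaces the Dirac expressions of [c] by those of the chart chosen at the point;
    there the spinor equation and [rhs_cancellation] apply. *)
Lemma chart_equation :
  {ae leb, forall x : borel rV, D x ->
    rho x * (rprod (\sum_a gamma S a *m \sum_l rc (E x a l) *: Dpsi i c (inv x) l)
      (psi k c (inv x)) -
       rprod (psi i c (inv x)) (\sum_a gamma S a *m \sum_l rc (E x a l) *: Dpsi k c (inv x) l))
         * zeta x =
    rho x * (map_rhs S phi dphi psi i (inv x) * phi k (inv x) -
             map_rhs S phi dphi psi k (inv x) * phi i (inv x)) * zeta x}.
Proof.
have Ai := chart_ae S Hvol cU (wdh_spinor Hweak i); have Ak :=
  chart_ae S Hvol cU (wdh_spinor Hweak k).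
have Fi := sobolev_spinor_form (wdh_psi Hweak i); have Fk := sobolev_spinor_form (wdh_psi Hweak k).
have Pi := sobolev_spinor_field (wdh_psi Hweak i); have Pk :=
  sobolev_spinor_field (wdh_psi Hweak k).
apply: filterS2 Ai Ak => x Hi Hk Dx.
have RI := rprod_dirac (dU Dx) Fi Pk; have RK := rprod_dirac (dU Dx) Fk Pi.
congr (_ * _ * _).
rewrite -(rhs_cancellation S kappa phi dphi psi i k) -(Hi Dx) -(Hk Dx).
by rewrite (rprodC (psi i c (inv x))) (rprodC (spinor_at psi i (inv x))); congr (_ - _).
Qed.

(** [current_law] gives minus the integral of the left side of [chart_equation], and [map_law] gives
    the integral of its right side. *)
Theorem local_law : L1 vol setT (current_density eta) /\
  (\int[vol]_p (current_density eta p)%:E = 0)%E.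
Proof.
have WI := chart_weak_spinor Hvol cU (wdh_psi Hweak i) (L4 i).
have WK := chart_weak_spinor Hvol cU (wdh_psi Hweak k) (L4 k).
have [A1 A2 A3] := current_law Hleb r0 (gamma_clifford S) (gamma_skew S) (@img_open _ _ X c) cU
  (@loc_frame_smooth _ _ _ _ S c) (@loc_metric_smooth _ _ _ h c) (@loc_metricT _ _ _ h c)
  (@loc_frame_orth _ _ _ _ S c) WI WK tc tz.
have [B1 B2 B3] := map_law Hleb Hvol r0 cU (wdh_phi Hweak i) (wdh_phi Hweak k)
  (wdh_map_integrable Hweak i) (wdh_map_integrable Hweak k) (wdh_map Hweak i) (wdh_map Hweak k)
  (sphere_bound i) (sphere_bound k) tc tz.
have LG : L1 leb (D : set (borel rV)) (fun x => current_density eta (inv x) * rho x).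
  by apply: (L1_eq mD _ (L1D mD A1 B1)) => x Dx; rewrite current_density_chart.
have rpos x : D x -> 0 < rho x.
  by move=> /DU; exact: (vol_density_gt0 (@loc_frame_orth _ _ _ _ S c)).
have birho : bmeas (D : set (borel rV)) (fun x => (rho x)^-1).
  apply: (bmeas_smooth cU) => q; apply: CkV; [exact: img_open| |exact: (vol_smooth S)].
  by move=> x xc; rewrite gt_eqF// (vol_density_gt0 (@loc_frame_orth _ _ _ _ S c)).
have mG : measurable_fun (D : set (borel rV)) (current_density eta \o inv : borel rV -> R).
  apply: (@eq_measurable_fun _ _ (borel rV) R _ (fun x => current_density eta (inv x)
    * rho x * (rho x)^-1)).
    by move=> x; rewrite inE => Dx /=; rewrite mulfK// gt_eqF// rpos.
  by apply: measurable_funM; [exact: L1_meas LG|exact: birho.1].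
split; first exact: (vol_local_L1 S Hvol cU current_density_out LG mG).
rewrite (vol_local S Hvol cU current_density_out mG) -(Int_fin mD LG).
congr EFin.
rewrite (Int_eq leb (fun x Dx => current_density_chart Dx)) (IntD mD A1 B1) A3 B3.
rewrite (Int_ae mD (L1_meas A2) (L1_meas B2) chart_equation).
by rewrite addrC subrr.
Qed.

End LocalLaw.

(** * Globalisation *)

Section Globalisation.
Context {R : realType} {d : nat} {X : closed_manifold R d} {h : riemannian_metric X}.
Variable S : spin_structure h.
Local Notation rV := 'rV[R]_d.
Variable leb : {measure set (borel rV) -> \bar R}.
Hypothesis Hleb : is_lebesgue leb.
Variable vol : {measure set (borel X) -> \bar R}.
Hypothesis Hvol : is_volume h leb vol.
Variables (n : nat) (kappa : R).
Variables (phi : 'I_n.+1 -> X -> R) (dphi : 'I_n.+1 -> chart_index X -> X -> 'cV[R]_d).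
Variable psi : 'I_n.+1 -> chart_index X -> X -> 'cV[R[i]]_(spin_dim d).
Variable Dpsi : 'I_n.+1 -> chart_index X -> X -> 'I_d -> 'cV[R[i]]_(spin_dim d).
Hypothesis Hweak : weak_dirac_harmonic S leb vol kappa phi dphi psi Dpsi.
Hypothesis d0 : (0 < d)%N.

(** Above dimension two the bound is [wdh_L4]; in dimensions one and two it is the Sobolev bound for
    real and imaginary parts, which costs half of the radius. *)
Lemma spinor_L4_patch (c : chart_index X) (x0 : rV) r j : 0 < r -> ccube x0 r `<=` img c ->
  spinor_L4 leb c x0 (r / 2) (psi j).
Proof.
move=> r0 cU s; have HS := wdh_psi Hweak j.
have [Hp Hpm HpL _ _ _ _] := HS.
have [dle|dgt] := leqP d 2; last first.
  apply: (spinor_Lpow Hvol (S := S) _ s _ Hp Hpm (wdh_L4 Hweak dgt j)); last by lra.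
  by move=> x cx; apply: cU => l; apply: le_trans (cx l) _; lra.
have d02 : (0 < d <= 2)%N by rewrite d0.
have q1 : 1 <= 4 / 3 :> R by lra.
have [LR LI] := spinor_Lpow Hvol cU s q1 Hp Hpm HpL.
split.
  apply: (sobolev_L4_half Hleb d02 r0 LR (v' := fun k x => complex.Re (chart_wpd S c (psi j)
    (Dpsi j) k x s 0))) => k.
    exact: (chart_wpd_Lpow Hvol cU k s HS).1.
  exact: (chart_wpd_weak cU k s (sobolev_spinor_weak HS)).1.
apply: (sobolev_L4_half Hleb d02 r0 LI (v' := fun k x => complex.Im (chart_wpd S c (psi j)
  (Dpsi j) k x s 0))) => k.
  exact: (chart_wpd_Lpow Hvol cU k s HS).2.
exact: (chart_wpd_weak cU k s (sobolev_spinor_weak HS)).2.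
Qed.

Local Notation xat p := (chart (chart_at p) p).

Lemma good_patch (p : X) : exists r : R, [/\ 0 < r, ccube (xat p) r `<=` img (chart_at p) &
  forall j, spinor_L4 leb (chart_at p) (xat p) r (psi j)].
Proof.
have /nbhs_cube[e e0 He] : nbhs (xat p) (img (chart_at p)).
  apply: open_nbhs_nbhs; split; first exact: img_open.
  by exists p => //; exact: dom_chart_at.
have cU : ccube (xat p) (e / 2) `<=` img (chart_at p).
  by move=> x cx; apply: He => l; apply: le_lt_trans (cx l) _; lra.
(* One halving places the closed cube inside the image of the chart, the other is the loss in
   [spinor_L4_patch]. *)
exists (e / 2 / 2); split; first by lra.
  by move=> x cx; apply: cU => l; apply: le_trans (cx l) _; lra.
by move=> j; apply: spinor_L4_patch => //; lra.
Qed.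

Lemma deriv_frame_sum (I : Type) (s : seq I) (f : I -> X -> R) p a :
  (forall l, smooth_fun (f l)) ->
  deriv_frame S (fun q => \sum_(l <- s) f l q) p a = \sum_(l <- s) deriv_frame S (f l) p a.
Proof.
move=> sf; rewrite /deriv_frame /covector_frame mxE.
under eq_bigr => k _ do rewrite mxE (dchart_sum k s sf (dom_chart_at p)) mulr_sumr.
rewrite exchange_big; apply: eq_bigr => l _ /=; rewrite mxE.
by apply: eq_bigr => k _; rewrite mxE.
Qed.

Theorem conservation_law (i k : 'I_n.+1) (eta : X -> R) : smooth_fun eta ->
  (\int[vol]_p (current_density S phi dphi psi i k eta p)%:E = 0)%E.
Proof.
move=> Heta; have /choice[r Hr] := good_patch.
pose b (p : X) := bump (xat p) (r p / 2).
have tb p : cube_test (xat p) (r p) (b p).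
  by have [r0 _ _] := Hr p; apply: cube_test_bump; lra.
pose beta p := chart_extend (chart_at p) (b p).
have sbeta p : smooth_fun (beta p).
  by have [_ cU _] := Hr p; exact: (extend_smooth cU (tb p)).
(* The bump of [p] is positive on this patch of half size; by compactness finitely many patches
   cover the manifold. *)
pose O p := patch (chart_at p) (xat p) (r p / 2).
have betaO p q : O p q -> 0 < beta p q.
  by move=> [cq Dq]; rewrite /beta chart_extendE//; exact: bump_gt0.
have : cover_compact [set: X] by rewrite -compact_cover; exact: manifold_compact.
move=> /(_ X setT O (fun p _ => @patch_open _ _ X (chart_at p) (xat p) (r p / 2)))[].
  move=> p _; exists p => //; split; first exact: dom_chart_at.
  by apply: cube_center; have [r0 _ _] := Hr p; lra.
move=> F _ HF; pose s : seq X := finmap.enum_fset F.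
pose B q := \sum_(p <- s) beta p q * beta p q.
have B0 q : B q != 0.
  have [p Fp Oq] := HF q I.
  rewrite gt_eqF// /B (big_rem p)//=; apply: ltr_wpDr; last by rewrite mulr_gt0// betaO.
  by apply: sumr_ge0 => l _; rewrite -expr2 sqr_ge0.
have sB : smooth_fun B by apply: smooth_fun_sum => p; exact: smooth_funM.
pose theta q := eta q * (B q)^-1.
have sth : smooth_fun theta by apply: smooth_funM => //; exact: smooth_funV.
(* The term of index [p] is written as [b p * z p], with both factors test functions, the shape that
   [local_law] requires. *)
pose z p x := theta (chart_inv (chart_at p) x) * b p x.
have tz p : cube_test (xat p) (r p) (z p).
  apply: cube_test_smul; last exact: tb.
  move=> q; have [_ cU _] := Hr p; apply: (@Ck_sub _ _ q (img (chart_at p))).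
    by move=> x Dx; apply: cU => l; exact/ltW.
  by move: sth => /smooth_funE; exact.
pose et p := chart_extend (chart_at p) (fun x => b p x * z p x).
have set_ p : smooth_fun (et p).
  by have [_ cU _] := Hr p; exact: (extend_smooth cU (cube_testMM (tb p) (tz p))).
have etE : eta = fun q => \sum_(p <- s) et p q.
  apply/funext => q; have E p : et p q = beta p q * beta p q * theta q.
    rewrite /et /beta /chart_extend; case: asboolP => cq; last by rewrite mul0r mul0r.
    by rewrite /z chartK// mulrCA mulrC.
  under eq_bigr => p _ do rewrite E.
  by rewrite -mulr_suml -/(B q) /theta mulrCA mulfV// mulr1.
have LL p : L1 vol setT (current_density S phi dphi psi i k (et p)) /\
    (\int[vol]_q (current_density S phi dphi psi i k (et p) q)%:E = 0)%E.
  have [r0 cU L4] := Hr p.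
  exact: (local_law Hleb Hvol Hweak i k r0 cU L4 (tb p) (tz p)).
have CE q : current_density S phi dphi psi i k eta q =
    \sum_(p <- s) current_density S phi dphi psi i k (et p) q.
  rewrite {1}etE /current_density exchange_big; apply: eq_bigr => a _ /=.
  by rewrite deriv_frame_sum// mulr_sumr.
have mT := @measurableT _ (borel X).
have LS : L1 vol setT (fun q => \sum_(p <- s) current_density S phi dphi psi i k (et p) q).
  by apply: (L1_sum mT) => p _; exact: (LL p).1.
transitivity (\int[vol]_q (\sum_(p <- s) current_density S phi dphi psi i k (et p) q)%:E)%E.
  by apply: eq_integral => q _; rewrite CE.
rewrite -(Int_fin mT LS) (Int_sum mT) => [|p _]; last exact: (LL p).1.
rewrite big1// => p _; rewrite /Int /Rintegral (LL p).2//.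
Qed.

End Globalisation.

Theorem proposition3p3 (R : realType) (d : nat) (M : closed_manifold R d)
    (h : riemannian_metric M) (S : spin_structure h)
    (leb : {measure set (borel 'rV[R]_d) -> \bar R}) (Hleb : is_lebesgue leb)
    (vol : {measure set (borel M) -> \bar R}) (Hvol : is_volume h leb vol)
    (n : nat) (kappa : R)
    (phi : 'I_n.+1 -> M -> R) (dphi : 'I_n.+1 -> chart_index M -> M -> 'cV[R]_d)
    (psi : 'I_n.+1 -> chart_index M -> M -> 'cV[R[i]]_(spin_dim d))
    (Dpsi : 'I_n.+1 -> chart_index M -> M -> 'I_d -> 'cV[R[i]]_(spin_dim d))
    (Hweak : weak_dirac_harmonic S leb vol kappa phi dphi psi Dpsi)
    (i m : 'I_n.+1) (eta : M -> R) (Heta : smooth_fun eta) :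
  (\int[vol]_p
     (\sum_a
        (complex.Re (hprod (gamma S a *m spinor_at psi i p) (spinor_at psi m p))
         + (dphi_frame S dphi i p a * phi m p
            - phi i p * dphi_frame S dphi m p a))
        * deriv_frame S eta p a)%:E = 0)%E.
Proof.
(* In dimension zero the sum over the frame is empty; the Sobolev bound used for small [d] assumes
   [0 < d]. *)
have [d0|d0] := posnP d; last exact: (conservation_law Hleb Hvol Hweak d0 i m Heta).
rewrite -[RHS](integral0 vol setT); apply: eq_integral => p _.
rewrite big1// => a _; exfalso; have := ltn_ord a; by rewrite [X in (_ < X)%N]d0.
Qed.
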